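(* For any non-empty open set $D\subset\mathbb{R}^d$, the subprocess $X^D$ has a jointly (locally) Hölder continuous density function $p_D(t,x,y)$ on $(0,\infty)\times D\times D$; that is, for any $t>0$, any $x\in D$ and any non-negative Borel measurable function $\varphi$ on $D$, $$\mathbb{E}_x\left[\varphi(X^D_t)\right]=\int_D p_D(t,x,y)\,\varphi(y)\,dy .$$
   Context: Let $d\ge 2$ and $\alpha\in(0,2)$. $X=(X_t)_{t\ge0}$, $X_t=(X^{(1)}_t,\dots,X^{(d)}_t)$, is the rectilinear $\alpha$-stable process on $\mathbb{R}^d$: its coordinates are independent one-dimensional symmetric $\alpha$-stable processes, i.e. $X$ is the Lévy process with $\mathbb{E}\,e^{i\xi\cdot(X_t-X_0)}=e^{-t\sum_{j=1}^d|\xi^{(j)}|^\alpha}$ for $\xi\in\mathbb{R}^d$. $\mathbb{P}_x,\mathbb{E}_x$ denote law and expectation when $X_0=x$. For open $D$, $\tau_D:=\inf\{t>0:X_t\notin D\}$, and the subprocess $X^D$ is $X$ killed upon leaving $D$: $X^D_t=X_t$ for $t<\tau_D$ and $X^D_t=\partial$ (a cemetery state) for $t\ge\tau_D$. Functions $\varphi$ on $D$ are extended by $\varphi(\partial)=0$. *)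

(* Defs.v *)
From HB Require Import structures.
From mathcomp Require Import all_boot all_order all_algebra.
From mathcomp Require Import all_classical all_reals all_analysis.
From mathcomp Require Import complex.

Set Implicit Arguments.
Unset Strict Implicit.
Unset Printing Implicit Defensive.

Import Order.TTheory GRing.Theory Num.Theory.
Import numFieldNormedType.Exports.

Local Open Scope classical_set_scope.
Local Open Scope ring_scope.

(* R^n is 'rV[R]_n with the library's topology and max-norm, which is
   equivalent to the Euclidean one. Matrices get their Borel sigma-algebra. *)

Definition borel_mx_display : measure_display.
Proof. exact: default_measure_display. Qed.

Section borel_mx.
Context {R : realType} {m n : nat}.

Let borel : set (set 'M[R]_(m, n)) := <<s @open 'M[R]_(m, n) >>.

Let borel0 : borel set0. Proof. exact: sigma_algebra0. Qed.

Let borelC A : borel A -> borel (~` A). Proof. exact: sigma_algebraC. Qed.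

Let borel_bigcup (F : (set 'M[R]_(m, n))^nat) :
  (forall i, borel (F i)) -> borel (\bigcup_i F i).
Proof. exact: sigma_algebra_bigcup. Qed.

HB.instance Definition _ := @isMeasurable.Build borel_mx_display
  'M[R]_(m, n) borel borel0 borelC borel_bigcup.

End borel_mx.

(* Lebesgue measure on R^n: the n-fold product of the one-dimensional one,
   built on tuples and transported to row vectors. *)

Section lebesgue_measure_tuple.
Context {R : realType}.
Local Notation T := (measurableTypeR R).

Definition tcons n (z : T * n.-tuple T) : n.+1.-tuple T := [tuple of z.1 :: z.2].

Let measurable_tcons n : measurable_fun setT (@tcons n).
Proof. exact: measurable_cons. Qed.

Section step.
Context {n : nat} (mu : {sigma_finite_measure set (n.-tuple T) -> \bar R}).

Definition tlebesgueS : set (n.+1.-tuple T) -> \bar R :=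
  pushforward (@lebesgue_measure R \x mu)%E (@tcons n).

HB.instance Definition _ := Measure.copy tlebesgueS
  (measure_function_pushforward__canonical__measure_function_Measure
     (@lebesgue_measure R \x mu)%E (@measurable_tcons n)).

Let tlebesgueS_sigma_finite : sigma_finite setT tlebesgueS.
Proof.
have /sigma_finiteP[F [TF ndF Foo]] := sigma_finiteT (@lebesgue_measure R).
have /sigma_finiteP[G [TG ndG Goo]] := sigma_finiteT mu.
pose h (t : n.+1.-tuple T) : T * n.-tuple T := (thead t, [tuple of behead t]).
have tK z : h (tcons z) = z.
  by case: z => a t; rewrite /tcons /h/=; congr pair; exact/val_inj.
have mh : measurable_fun setT h.
  apply/measurable_fun_pairP; split; last exact: measurable_behead.
  exact: measurable_tnth.
exists (fun k => h @^-1` (F k `*` G k)).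
  rewrite -preimage_bigcup (_ : \bigcup_i _ = setT) ?preimage_setT//.
  rewrite -setXTT TF TG; apply/seteqP; split=> -[x y].
    by move=> [k _ []/= ? ?]; split; exists k.
  move=> [/= [k _ Fkx] [l _ Gly]]; exists (maxn k l) => //; split.
  - by move: x Fkx; exact/subsetPset/ndF/leq_maxl.
  - by move: y Gly; exact/subsetPset/ndG/leq_maxr.
move=> k; have [mF Fk] := Foo k; have [mG Gk] := Goo k; split.
  by rewrite -[X in measurable X]setTI; apply: mh => //; exact: measurableX.
rewrite /tlebesgueS /pushforward -comp_preimage.
rewrite (_ : h \o @tcons n = id); last exact/funext.
by rewrite /= product_measure1E// lte_mul_pinfty// ge0_fin_numE.
Qed.

HB.instance Definition _ := Measure_isSigmaFinite.Build _ _ _ tlebesgueS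
  tlebesgueS_sigma_finite.

End step.

Fixpoint tlebesgue n : {sigma_finite_measure set (n.-tuple T) -> \bar R} :=
  if n is n'.+1 then tlebesgueS (tlebesgue n') else \d_ [tuple].

Lemma tlebesgue_prod n (A : 'I_n -> set T) : (forall i, measurable (A i)) ->
  tlebesgue n [set t | forall i, A i (tnth t i)] =
  (\prod_(i < n) lebesgue_measure (A i))%E.
Proof.
elim: n A => [A _|n IH A mA].
  rewrite big_ord0 /= diracE mem_set//=; last by case.
rewrite big_ord_recl /= /tlebesgueS /pushforward -IH//.
rewrite -product_measure1E//; last first.
  rewrite (_ : mkset _ = \bigcap_i ((@tnth _ T)^~ i @^-1` A (lift ord0 i))).
    apply: fin_bigcap_measurable => // i _.
    by rewrite -[X in measurable X]setTI; exact: measurable_tnth.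
  by apply/seteqP; split=> t /= h i; [move=> _|]; exact: h.
congr product_measure1; apply/seteqP; split=> -[a t] /=.
  move=> h; split; first exact: (h ord0).
  by move=> i; have := h (lift ord0 i); rewrite tnthS.
move=> [Aa h] i; have [j ->|->] := unliftP ord0 i; last exact: Aa.
by rewrite tnthS; exact: h.
Qed.

End lebesgue_measure_tuple.

Section lebesgue_measure_rV.
Context {R : realType} (n : nat).
Local Notation T := (measurableTypeR R).

Let row_of_tuple (t : n.-tuple T) : 'rV[R]_n := \row_i tnth t i.

Let measurable_row_of_tuple : measurable_fun setT row_of_tuple.
Proof.
apply: (@measurability _ _ _ _ setT row_of_tuple (@open 'rV[R]_n)) => //.
move=> _ [U oU <-]; rewrite setTI.
pose box (q : 'rV[rat]_n * nat) : set (n.-tuple T) :=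
  [set t | forall i, ball (ratr (q.1 ord0 i) : R) q.2.+1%:R^-1 (tnth t i)].
pose P q := box q `<=` row_of_tuple @^-1` U.
rewrite (_ : _ @^-1` _ = \bigcup_(q in P) box q).
  rewrite bigcup_mkcond; apply: countable_bigcupT_measurable => // q.
  case: ifPn => // _.
  rewrite (_ : box q = \bigcap_i
      ((@tnth _ T)^~ i @^-1` (ball (ratr (q.1 ord0 i) : R) q.2.+1%:R^-1))).
    apply: fin_bigcap_measurable => // i _.
    rewrite -[X in measurable X]setTI; apply: measurable_tnth => //.
    by rewrite ball_itv; exact: measurable_itv.
  by apply/seteqP; split=> t /= h i; [move=> _|]; exact: h.
apply/seteqP; split=> [t /= Ut|t [q Pq] /Pq//].
have /nbhs_ballP[e /= e0 eU] := open_nbhs_nbhs (conj oU Ut).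
have [//|k] := @ltr_add_invr R 0 (e / 2); first by rewrite divr_gt0.
rewrite add0r => ke.
have /choice[q hq] (i : 'I_n) : exists q : rat,
    ball (ratr q : R) k.+1%:R^-1 (tnth t i).
  have [||x [tx [q _ qx]]] := @dense_rat R (ball (tnth t i : R) k.+1%:R^-1).
  - by exists (tnth t i); exact: ballxx.
  - exact: ball_open.
  - by exists q; apply: ball_sym; rewrite qx.
exists (\row_i q i, k); last by move=> i /=; rewrite mxE; exact: hq.
move=> s hs; apply: eU; split=> // i j.
rewrite !mxE; have := hs j; rewrite /= mxE => sq.
apply: (@ball_splitr _ _ (ratr (q j) : R)).
  exact: (le_ball (ltW ke)).
exact: (le_ball (ltW ke)).
Qed.

Definition lebesgue_rV : set 'rV[R]_n -> \bar R :=
  pushforward (tlebesgue n) row_of_tuple.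

HB.instance Definition _ := Measure.copy lebesgue_rV
  (measure_function_pushforward__canonical__measure_function_Measure
     (tlebesgue n) measurable_row_of_tuple).

Lemma lebesgue_rV_prod (A : 'I_n -> set R) :
  (forall i, measurable (A i : set (measurableTypeR R))) ->
  lebesgue_rV [set x | forall i, A i (x ord0 i)] =
  (\prod_(i < n) lebesgue_measure (A i))%E.
Proof.
move=> mA; rewrite -tlebesgue_prod//; congr (tlebesgue n _).
by apply/seteqP; split=> t /= h i; have := h i; rewrite mxE.
Qed.

End lebesgue_measure_rV.

(* Each compact subset of U has its own constant C; the exponent is common. *)
Definition locally_holder {R : realType} {V : normedModType R}
    (U : set V) (f : V -> R) : Prop :=
  exists2 gamma : R, 0 < gamma <= 1 &
    forall K : set V, compact K -> K `<=` U ->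
    exists C : R, forall u v, K u -> K v ->
      `|f u - f v| <= C * `|u - v| `^ gamma.

Definition cadlag {R : realType} {d : nat} (x : R -> 'rV[R]_d) : Prop :=
  forall t : R, 0 <= t ->
    x s @[s --> t^'+] --> x t /\ (0 < t -> cvg (x s @[s --> t^'-])).

Definition dotv {R : realType} {d : nat} (u v : 'rV[R]_d) : R :=
  \sum_(j < d) u ord0 j * v ord0 j.

(* Time is the half-line t >= 0: values at negative times are never used. *)
Section levy.
Context {R : realType} {d : nat} {disp : measure_display}
  {Omega : measurableType disp}.

(* E [exp (i xi . Y)], integrated componentwise *)
Definition char_fun (P : probability Omega R) (Y : Omega -> 'rV[R]_d)
    (xi : 'rV[R]_d) : R[i] :=
  ((\int[P]_w cos (dotv xi (Y w))) +i* (\int[P]_w sin (dotv xi (Y w))))%C.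

Record levy_process (P : probability Omega R) (X : R -> Omega -> 'rV[R]_d) :
    Prop := LevyProcess {
  levy_measurable : forall t : R, 0 <= t -> measurable_fun setT (X t) ;
  levy_cadlag : {ae P, forall w, cadlag (X^~ w)} ;
  levy_independent : forall (n : nat) (t : nat -> R) (B : nat -> set 'rV[R]_d),
    0 <= t 0%N -> (forall k, t k <= t k.+1) -> (forall k, measurable (B k)) ->
    P (\bigcap_(k in `I_n) [set w | B k (X (t k.+1) w - X (t k) w)]) =
    (\prod_(k < n) P [set w | B k (X (t k.+1) w - X (t k) w)%R])%E ;
  levy_stationary : forall (s t : R) (B : set 'rV[R]_d),
    0 <= s -> 0 <= t -> measurable B ->
    P [set w | B (X (s + t) w - X s w)] = P [set w | B (X t w - X 0 w)]
}.

Definition rectilinear_stable (alpha : R) (P : probability Omega R)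
    (X : R -> Omega -> 'rV[R]_d) : Prop :=
  levy_process P X /\
  forall (t : R) (xi : 'rV[R]_d), 0 <= t ->
    char_fun P (fun w => X t w - X 0 w) xi =
    (expR (- (t * \sum_(j < d) `|xi ord0 j| `^ alpha)))%:C%C.

End levy.

Section killing.
Context {R : realType} {d : nat}.

Definition exit_time (D : set 'rV[R]_d) (x : R -> 'rV[R]_d) : \bar R :=
  ereal_inf [set t%:E | t in [set t : R | 0 < t /\ ~ D (x t)]].

(* None is the cemetery state. *)
Definition killed (D : set 'rV[R]_d) (x : R -> 'rV[R]_d) (t : R) :
    option 'rV[R]_d :=
  if (t%:E < exit_time D x)%E then Some (x t) else None.

Definition extend0 (phi : 'rV[R]_d -> R) : option 'rV[R]_d -> R :=
  oapp phi 0.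

End killing.

(* Main.v *)
(* The density p_t of an increment is a product of inverse cosine transforms. To
   identify its law without Levy's inversion theorem, the characteristic function
   is integrated coordinate by coordinate against e^(- eps xi), whose transform is
   a Cauchy kernel, and eps tends to 0; the weight e^(- s xi^alpha) gives
   Chapman-Kolmogorov for p_t at every point.

   With C_n exhausting D by closed sets, the transition density of X killed
   outside C_n is the decreasing limit, over finer and finer dyadic grids of
   times, of the iterates of the stable density p_t composed over C_n: these are
   the densities of X on the event that it lies in C_n at all grid times, which
   for a cadlag path and closed C_n becomes "at all times". The supremum q_t over
   n is the density of X^D, because a path of X does not leave all the C_n by a
   jump from the boundary of D back into D: at the first grid time outside C_n
   the past is independent of the jump that would have to follow at once.

   The kernels q_t are symmetric, satisfy Chapman-Kolmogorov at every point and
   lie below p_t, with mass at least 1 - c t near a compact subset of D (first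
   exit decomposition and tail bounds). So q_t = q_s q_(t-s) differs, in the
   first variable, by O(s) from what p_s would give, and p_s(x, .) is Lipschitz
   in x with a constant polynomial in 1 / s; optimizing in s gives Hoelder
   continuity in x. Symmetry gives y, and q_(t+h) = q_h q_t gives t. *)
Require Import Defs.
From HB Require Import structures.
From mathcomp Require Import all_boot all_order all_algebra.
From mathcomp Require Import all_classical all_reals all_analysis.
From mathcomp Require Import measurable_realfun.
From mathcomp Require Import complex.
From mathcomp Require Import ring lra.
Import Order.TTheory GRing.Theory Num.Theory.
Import numFieldNormedType.Exports.
Local Open Scope classical_set_scope.
Local Open Scope ring_scope.

Set Implicit Arguments.
Unset Strict Implicit.
Unset Printing Implicit Defensive.

(** * One-dimensional stable densities *)

(** The independence in [levy_process] concerns finitely many ordered times, and the strong Markov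
    property is avoided: every stopping argument takes place on a finite grid, with bounds that do
    not depend on the mesh. Closed sets make grids sufficient, since a right-continuous path that is
    outside a closed set stays outside for a while and is caught by a fine grid. For the open set
    [D] itself this fails, whence the exhaustion.

    Kernels confine only intermediate points, never the two ends. So they are defined and symmetric
    on the whole space, and the condition that [X_t] lies in [D] enters last, through the integral
    over [D].

    Equality of laws identifies densities only almost everywhere in the last variable, while Hoelder
    continuity requires the semigroup identity at every point. As for the estimates, any power of
    [1 / s] in the bounds on [p_s] is affordable, since it only lowers the exponent; the tails,
    however, must vanish linearly in time, because the mass lost by killing during time [s] is what
    remains after the optimisation. *)

Section real_line.
Context {R : realType}.
Implicit Types (a b x y e : R) (w : R -> R).
Local Notation mu := (@lebesgue_measure R).
Local Notation half := `[(0:R), +oo[%classic.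

Let mhalf : measurable (half : set (measurableTypeR R)).
Proof. exact: measurable_itv. Qed.

Lemma cos_lipschitz a b : `|cos a - cos b| <= `|a - b|.
Proof.
wlog ab : a b / a <= b => [h|].
  by have [/h //|/ltW/h] := leP a b; rewrite distrC (distrC b).
have [|x xab] := @MVT_segment R cos (fun x => - sin x) _ _ ab.
  by apply: derivable_within_continuous => x _; exact: derivable_cos.
rewrite (distrC (cos a)) => ->.
rewrite normrM normrN (distrC a) ler_piMl//.
by rewrite ler_norml sin_geN1 sin_le1.
Qed.

Lemma measurable_oneDsqrV : measurable_fun setT (fun x => (1 + x ^+ 2)^-1 : R).
Proof. exact: (continuous_measurable_fun (@continuous_oneDsqrV R)). Qed.

Lemma integrable_oneDsqrV : mu.-integrable half (EFin \o (fun x => (1 + x ^+ 2)^-1)).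
Proof.
apply/integrableP; split.
  by apply/measurable_EFinP; apply: measurable_funS measurable_oneDsqrV.
under eq_integral do rewrite /= ger0_norm ?invr_ge0 ?addr_ge0 ?sqr_ge0//.
rewrite (@ge0_continuous_FTC2y _ _ atan 0 (pi / 2)) ?ltry//.
- by move=> x _; rewrite invr_ge0 addr_ge0 ?sqr_ge0.
- by apply: continuous_subspaceT; exact: continuous_oneDsqrV.
- exact: cvgy_atan.
- by apply: cvg_at_right_filter; exact: continuous_atan.
- by move=> x _; rewrite derive1_atan.
Qed.

Let is_derive_exp e x : is_derive x 1 (fun x => expR (- (e * x))) (- e * expR (- (e * x))).
Proof.
have h : is_derive x 1 (fun x => - (e * x)) (- e).
  by apply: is_derive_eq; rewrite /GRing.scale/=; ring.
by have := @is_derive1_comp R expR (fun x => - (e * x)) x _ _ (is_derive_expR _) h; rewrite mulrC.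
Qed.

Let is_derive_laplace_cos e x y : 0 < e ->
  is_derive x 1 (fun x => expR (- (e * x)) * (y * sin (x * y) - e * cos (x * y)))
    ((e ^+ 2 + y ^+ 2) * (expR (- (e * x)) * cos (x * y))).
Proof.
move=> e0.
have hxy : is_derive x 1 (fun x => x * y) y.
  by apply: is_derive_eq; rewrite /GRing.scale/=; ring.
have hs : is_derive x 1 (fun x => sin (x * y)) (cos (x * y) * y).
  exact: (@is_derive1_comp R sin (fun x => x * y) x _ _ (is_derive_sin _) hxy).
have hc : is_derive x 1 (fun x => cos (x * y)) (- sin (x * y) * y).
  exact: (@is_derive1_comp R cos (fun x => x * y) x _ _ (is_derive_cos _) hxy).
have he := is_derive_exp e x.
have h2 : is_derive x 1 (fun x => y * sin (x * y) - e * cos (x * y)) (y * (cos (x * y) * y) - e * (- sin (x * y) * y)).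
  by apply: is_derive_eq; rewrite /GRing.scale/=; ring.
apply: (is_derive_eq (is_deriveM he h2)).
by rewrite /GRing.scale/=; ring.
Qed.

Let cvg_exp0 e : 0 < e -> (fun x => expR (- (e * x))) x @[x --> +oo] --> (0 : R).
Proof.
move=> e0; apply: (cvg_comp (fun x => e * x) (fun x => expR (- x))); last exact: cvgr_expR.
by apply/cvgryPge => A; near=> x; rewrite -ler_pdivrMl//; near: x; exact: nbhs_pinfty_ge.
Unshelve. all: by end_near. Qed.

Let continuous_exp e : continuous (fun x => expR (- (e * x))).
Proof. by move=> x; apply/differentiable_continuous/derivable1_diffP; case: (is_derive_exp e x). Qed.

Lemma ge0_integral_expRN e : 0 < e ->
  (\int[mu]_(x in half) (expR (- (e * x)))%:E = (e^-1)%:E)%E.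
Proof.
move=> e0.
have dF x : is_derive x 1 (fun x => - e^-1 * expR (- (e * x))) (expR (- (e * x))).
  have he := is_derive_exp e x.
  by apply: is_derive_eq; rewrite /GRing.scale/=; field; rewrite gt_eqF.
rewrite (@ge0_continuous_FTC2y _ _ (fun x => - e^-1 * expR (- (e * x))) 0 0).
- by rewrite mulr0 oppr0 expR0 -EFinB; congr EFin; ring.
- by move=> x _; exact: expR_ge0.
- by apply: continuous_subspaceT; exact: continuous_exp.
- by rewrite -[X in _ --> X](mulr0 (- e^-1)); apply: cvgMr; exact: cvg_exp0.
- by move=> x _; case: (dF x).
- apply: cvg_at_right_filter.
  have /derivable1_diffP : derivable (fun x => - e^-1 * expR (- (e * x))) 0 1 by case: (dF 0).
  exact: differentiable_continuous.
- by move=> x _; rewrite derive1E; exact: (@derive_val _ _ _ _ _ _ _ (dF x)).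
Qed.

Lemma integrable_expRN e : 0 < e ->
  mu.-integrable half (EFin \o (fun x => expR (- (e * x)))).
Proof.
move=> e0; apply/integrableP; split.
  apply/measurable_EFinP; apply: measurable_funS (continuous_measurable_fun (@continuous_exp e)) => //.
under eq_integral do rewrite /= ger0_norm ?expR_ge0//.
by rewrite ge0_integral_expRN// ltry.
Qed.

Lemma integrable_mul_cos w y : mu.-integrable half (EFin \o w) ->
  mu.-integrable half (EFin \o (fun x => w x * cos (x * y))).
Proof.
move=> iw; have mw : measurable_fun half w by apply/measurable_EFinP; exact: (measurable_int mu).
apply: le_integrable (iw) => //.
  apply/measurable_EFinP; apply: measurable_funM => //.
  apply: measurable_funS (measurableT) _ _ => //.
  apply: (@measurableT_comp _ _ _ _ _ _ cos) => //.
    by apply: continuous_measurable_fun; exact: continuous_cos.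
  exact: mulrr_measurable.
move=> x _; rewrite /= lee_fin normrM ler_piMr//.
by rewrite ler_norml cos_geN1 cos_le1.
Qed.

Lemma laplace_cos e y : 0 < e ->
  \int[mu]_(x in half) (expR (- (e * x)) * cos (x * y)) = e / (e ^+ 2 + y ^+ 2).
Proof.
move=> e0.
have ne0 : e ^+ 2 + y ^+ 2 != 0 by rewrite gt_eqF// ltr_pwDl ?exprn_gt0 ?sqr_ge0.
(* The fundamental theorem on the half-line is applied to a non-negative integrand: [1 + cos]
   replaces [cos]. The first term of [F] is the antiderivative of the added [e^(-e x)], whose
   integral [1/e] is removed at the end. *)
pose F x := - e^-1 * expR (- (e * x)) + (e ^+ 2 + y ^+ 2)^-1 * (expR (- (e * x)) * (y * sin (x * y) - e * cos (x * y))).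
have dF x : is_derive x 1 F (expR (- (e * x)) + expR (- (e * x)) * cos (x * y)).
  have he := is_derive_exp e x.
  have hl := is_derive_laplace_cos x y e0.
  apply: is_derive_eq; rewrite /GRing.scale/=.
  by rewrite mulKf// mulrA mulrNN mulVf ?gt_eqF// mul1r.
have cF : continuous F.
  by move=> x; apply/differentiable_continuous/derivable1_diffP; case: (dF x).
have : \int[mu]_(x in half) (expR (- (e * x)) + expR (- (e * x)) * cos (x * y)) = 0 - F 0.
  apply: Rintegral_ge0_continuous_FTC2y.
  - move=> x _; rewrite -[X in X + _]mulr1 -mulrDr mulr_ge0 ?expR_ge0// addrC -lerBlDr sub0r cos_geN1.
  - apply: continuous_subspaceT => x; apply: cvgD; first exact: continuous_exp.
    apply: cvgM; first exact: continuous_exp.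
    apply: (continuous_comp (f := fun x => x * y) (g := cos)); last exact: continuous_cos.
    by apply: cvgMl; exact: cvg_id.
  - rewrite -[X in _ --> X](addr0 0); apply: cvgD.
      by rewrite -[X in _ --> X](mulr0 (- e^-1)); apply: cvgMr; exact: cvg_exp0.
    rewrite -[X in _ --> X](mulr0 ((e ^+ 2 + y ^+ 2)^-1)); apply: cvgMr.
    apply: norm_cvg0.
    apply: (@squeeze_cvgr _ _ _ _ (cst 0) (fun x => expR (- (e * x)) * (`|y| + `|e|))).
    + near=> x; rewrite normr_ge0/= normrM (ger0_norm (expR_ge0 _)).
      rewrite ler_wpM2l ?expR_ge0// (le_trans (ler_normB _ _))// lerD// normrM ler_piMr//.
        by rewrite ler_norml sin_geN1 sin_le1.
      by rewrite ler_norml cos_geN1 cos_le1.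
    + exact: cvg_cst.
    + by rewrite -[X in _ --> X](mul0r (`|y| + `|e|)); apply: cvgMl; exact: cvg_exp0.
  - by move=> x _; case: (dF x).
  - by apply: cvg_at_right_filter; exact: cF.
  - by move=> x _; rewrite derive1E; exact: (@derive_val _ _ _ _ _ _ _ (dF x)).
rewrite RintegralD//=; last 2 first.
- exact: integrable_expRN.
- exact/integrable_mul_cos/integrable_expRN.
rewrite {1}/Rintegral ge0_integral_expRN//= => /(canRL (addKr _)) ->.
rewrite /F !(mulr0, mul0r) oppr0 expR0 sin0 cos0; field; by rewrite ne0 gt_eqF.
Unshelve. all: by end_near. Qed.

(** The inverse Fourier transform of the even extension of [w]: [1 / (2 pi)] over the line becomes
    [1 / pi] over the half-line. *)
Definition ft w y : R := pi^-1 * \int[mu]_(x in half) (w x * cos (x * y)).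

Lemma ftN w y : ft w (- y) = ft w y.
Proof. by rewrite /ft; under eq_Rintegral do rewrite mulrN cosN. Qed.

Lemma ft_le w y : mu.-integrable half (EFin \o w) ->
  `|ft w y| <= pi^-1 * \int[mu]_(x in half) `|w x|.
Proof.
move=> iw; rewrite /ft normrM ger0_norm ?invr_ge0 ?pi_ge0//.
rewrite ler_wpM2l ?invr_ge0 ?pi_ge0//.
apply: (le_trans (le_normr_Rintegral _ (integrable_mul_cos _ iw))) => //.
apply: le_Rintegral => //.
- by have := integrable_mul_cos y iw => /integrable_norm.
- exact: integrable_norm.
by move=> x _; rewrite normrM ler_piMr// ler_norml cos_geN1 cos_le1.
Qed.

Lemma ft_lipschitz w y y' : mu.-integrable half (EFin \o w) ->
  mu.-integrable half (EFin \o (fun x => x * w x)) ->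
  `|ft w y - ft w y'| <= pi^-1 * \int[mu]_(x in half) `|x * w x| * `|y - y'|.
Proof.
move=> iw ixw; rewrite /ft -mulrBr normrM ger0_norm ?invr_ge0 ?pi_ge0//.
rewrite -mulrA ler_wpM2l ?invr_ge0 ?pi_ge0//.
rewrite -RintegralB//; [|exact: integrable_mul_cos..].
have iB : mu.-integrable half (EFin \o (fun x => w x * cos (x * y) - w x * cos (x * y'))).
  have := integrableB mhalf (integrable_mul_cos y iw) (integrable_mul_cos y' iw).
  exact: eq_integrable.
apply: (le_trans (le_normr_Rintegral _ iB)) => //.
rewrite -RintegralZr//; last exact: integrable_norm.
apply: le_Rintegral => //.
- exact: integrable_norm.
- have := integrableZr mhalf `|y - y'| (integrable_norm ixw).
  by apply: eq_integrable => //.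
move=> x /=; rewrite in_itv/= andbT => x0; rewrite -mulrBr !normrM mulrAC mulrC.
rewrite ler_wpM2r// (le_trans (cos_lipschitz _ _))// -mulrBr normrM.
by rewrite ger0_norm.
Qed.

Definition sweight (alpha t x : R) : R := expR (- (t * x `^ alpha)).

Lemma measurable_sweight alpha t : measurable_fun setT (sweight alpha t).
Proof.
rewrite /sweight; apply: measurableT_comp => //.
apply: measurableT_comp => //; apply: measurable_funM => //; exact: measurable_powR.
Qed.

Lemma sweight_ge0 alpha t x : 0 <= sweight alpha t x.
Proof. exact: expR_ge0. Qed.

Lemma sweight_le1 alpha t x : 0 <= t -> sweight alpha t x <= 1.
Proof. by move=> t0; rewrite -expR0 ler_expR oppr_le0 mulr_ge0// powR_ge0. Qed.

(** For [x > 1], [e^(-v) <= N! / v^N] with [alpha N >= 3] beats [(1 + x) (1 + x^2) <= 4 x^3]. The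
    factor [1 + x] serves two purposes: its 1 gives the supremum of the transform, its [x] the
    Lipschitz constant. The time enters only through a power of [1/t]. *)
Lemma sweight_bound alpha : 0 < alpha -> exists C N, 0 <= C /\
  forall t x, 0 < t -> 0 <= x ->
  (1 + x) * sweight alpha t x <= C * (1 + t^-1 ^+ N) * (1 + x ^+ 2)^-1.
Proof.
move=> a0.
have [n Hn] : exists n, 3 <= alpha * n.+1%:R.
  exists (Num.truncn (3 / alpha)); rewrite mulrC -ler_pdivrMr//.
  by rewrite ltW// truncnS_gt.
exists (4 * n.+1`!%:R), n.+1; split=> [|t x t0 x0]; first by rewrite mulr_ge0.
have n1 : 1 <= n.+1`!%:R :> R by rewrite ler1n fact_gt0.
have tN : 0 <= t^-1 ^+ n.+1 by rewrite exprn_ge0// invr_ge0 ltW.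
have x2 : 0 < 1 + x ^+ 2 by rewrite ltr_pwDl// sqr_ge0.
rewrite ler_pdivlMr//.
have [x1|x1] := leP x 1.
  have s1 := sweight_le1 alpha x (ltW t0); have s0 := sweight_ge0 alpha t x.
  apply: (@le_trans _ _ (2 * 1 * 2)).
    rewrite ler_pM ?mulr_ge0// ?addr_ge0 ?sqr_ge0//.
      by rewrite ler_pM// ?addr_ge0//; lra.
    by nra.
  have : 4 <= 4 * n.+1`!%:R * (1 + t^-1 ^+ n.+1) by nra.
  lra.
have xp : 0 < x by lra.
pose v := t * x `^ alpha.
have v0 : 0 < v by rewrite mulr_gt0// powR_gt0.
have vn : t ^+ n.+1 * x ^+ 3 <= v ^+ n.+1.
  rewrite exprMn ler_wpM2l ?exprn_ge0 ?(ltW t0)//.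
  rewrite (_ : x ^+ 3 = x `^ 3%:R); last by rewrite powR_mulrn.
  rewrite (_ : _ ^+ n.+1 = x `^ (alpha * n.+1%:R)); last by rewrite powRrM powR_mulrn ?powR_ge0.
  by rewrite ler_powR// ltW.
have sv : sweight alpha t x <= n.+1`!%:R / v ^+ n.+1.
  rewrite /sweight -/v expRN -[leRHS]invf_div lef_pV2 ?posrE ?expR_gt0 ?divr_gt0 ?exprn_gt0 ?(lt_le_trans _ n1)//.
  by apply: le_trans (expR_ge1Dxn n (ltW v0)); rewrite lerDr.
have sv' : sweight alpha t x <= n.+1`!%:R * (t^-1 ^+ n.+1 / x ^+ 3).
  apply: (le_trans sv); rewrite ler_wpM2l ?ler0n// exprVn -invfM lef_pV2 ?posrE ?exprn_gt0 ?mulr_gt0 ?exprn_gt0 ?powR_gt0//.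
rewrite mulrAC; apply: (@le_trans _ _ (4 * x ^+ 3 * (n.+1`!%:R * (t^-1 ^+ n.+1 / x ^+ 3)))).
  rewrite ler_pM ?mulr_ge0 ?sweight_ge0 ?addr_ge0 ?sqr_ge0//.
  rewrite !exprS expr0; nra.
have x3 : x ^+ 3 != 0 by rewrite gt_eqF// exprn_gt0.
rewrite (_ : 4 * x ^+ 3 * _ = 4 * n.+1`!%:R * t^-1 ^+ n.+1); last first.
  by move: (t^-1 ^+ n.+1) => T; field; rewrite gt_eqF.
by rewrite ler_wpM2l ?mulr_ge0// lerDr.
Qed.

Section stable_weight.
Variable alpha : R.
Hypothesis alpha_gt0 : 0 < alpha.

Lemma integrable_sweight t : 0 < t ->
  mu.-integrable half (EFin \o sweight alpha t) /\
  mu.-integrable half (EFin \o (fun x => x * sweight alpha t x)).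
Proof.
move=> t0; have [C [N [C0 CN]]] := sweight_bound alpha_gt0.
have iC := integrableZl mhalf (C * (1 + t^-1 ^+ N)) integrable_oneDsqrV.
have ms : measurable_fun half (sweight alpha t).
  by apply: measurable_funS (measurable_sweight _ _).
split; apply: le_integrable iC => //.
- exact/measurable_EFinP.
- move=> x /=; rewrite in_itv/= andbT => x0; rewrite lee_fin.
  rewrite ger0_norm ?sweight_ge0//; apply: le_trans (le_trans (CN t x t0 x0) (ler_norm _)).
  by rewrite ler_peMl ?sweight_ge0// lerDl.
- by apply/measurable_EFinP; apply: measurable_funM.
- move=> x /=; rewrite in_itv/= andbT => x0; rewrite lee_fin.
  rewrite ger0_norm ?mulr_ge0 ?sweight_ge0//; apply: le_trans (le_trans (CN t x t0 x0) (ler_norm _)).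
  by rewrite ler_wpM2r ?sweight_ge0// lerDr.
Qed.

Definition sdens t z := ft (sweight alpha t) z.

Lemma sdens_bound : exists C N, 0 <= C /\ forall t, 0 < t ->
  (forall z, `|sdens t z| <= C * (1 + t^-1 ^+ N)) /\
  (forall z z', `|sdens t z - sdens t z'| <= C * (1 + t^-1 ^+ N) * `|z - z'|).
Proof.
have [C [N [C0 CN]]] := sweight_bound alpha_gt0.
pose I := \int[mu]_(x in half) (1 + x ^+ 2)^-1.
have I0 : 0 <= I by apply: Rintegral_ge0 => x _; rewrite invr_ge0 addr_ge0 ?sqr_ge0.
exists (pi^-1 * (C * I)), N; split=> [|t t0].
  by rewrite !mulr_ge0 ?invr_ge0 ?pi_ge0.
have [i1 i2] := integrable_sweight t0.
have iC := integrableZl mhalf (C * (1 + t^-1 ^+ N)) integrable_oneDsqrV.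
have key f : mu.-integrable half (EFin \o f) ->
  (forall x, 0 <= x -> `|f x| <= (1 + x) * sweight alpha t x) ->
  pi^-1 * \int[mu]_(x in half) `|f x| <= pi^-1 * (C * I) * (1 + t^-1 ^+ N).
  move=> fi fx; rewrite -!mulrA ler_wpM2l ?invr_ge0 ?pi_ge0//.
  rewrite (mulrC I) mulrA -RintegralZl//; last exact: integrable_oneDsqrV.
  apply: le_Rintegral => //; first exact: integrable_norm.
  move=> x; rewrite /= in_itv/= andbT => x0.
  exact: le_trans (fx x x0) (CN t x t0 x0).
split=> z.
  apply: (le_trans (ft_le z i1)); apply: key => // x x0.
  by rewrite ger0_norm ?sweight_ge0// ler_peMl ?sweight_ge0// lerDl.
move=> z'; apply: (le_trans (ft_lipschitz _ _ i1 i2)).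
rewrite ler_wpM2r//; apply: key => // x x0.
by rewrite ger0_norm ?mulr_ge0 ?sweight_ge0// ler_wpM2r ?sweight_ge0// lerDr.
Qed.

End stable_weight.

End real_line.

(** The bound [g] does not depend on the first variable, whose measure has mass 1; so the integrand,
    extended by 0 off [D], is integrable for the product. *)
Lemma Rintegral_Fubini_dominated d1 d2 (T1 : measurableType d1)
    (T2 : measurableType d2) (R : realType) (m1 : probability T1 R)
    (m2 : {sigma_finite_measure set T2 -> \bar R}) (D : set T2)
    (f : T1 * T2 -> R) (g : T2 -> R) :
  measurable D -> measurable_fun setT f -> m2.-integrable D (EFin \o g) ->
  (forall x y, D y -> `|f (x, y)| <= g y) ->
  \int[m1]_x \int[m2]_(y in D) f (x, y) = \int[m2]_(y in D) \int[m1]_x f (x, y).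
Proof.
move=> mD mf ig fg.
pose F (z : T1 * T2) : \bar R := (f z * \1_D z.2)%:E.
have mF : measurable_fun setT F.
  apply/measurable_EFinP; apply: measurable_funM => //.
  by apply: measurableT_comp => //; exact: measurable_indic.
have Fg x y : (`|F (x, y)| <= ((fun y => `|g y|%:E) \_ D) y)%E.
  rewrite /F /= patchE indicE; case: ifPn => yD /=; last by rewrite mulr0 normr0.
  rewrite mulr1 lee_fin (le_trans (fg _ _ _)) ?ler_norm//; exact: set_mem.
have mg : measurable_fun setT ((fun y => `|g y|%:E) \_ D).
  apply/(measurable_restrictT _ mD)/measurable_EFinP/measurableT_comp => //.
  by apply/measurable_EFinP; exact: (measurable_int m2).
have Ioo : (m1 \x m2)%E.-integrable setT F.
  apply/integrable21ltyP => //.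
  apply: (@le_lt_trans _ _ (\int[m2]_y ((fun y => `|g y|%:E) \_ D) y)%E).
    apply: ge0_le_integral => //.
    - by move=> y _; exact: integral_ge0.
    - apply: (measurable_fun_fubini_tonelli_G (abse \o F)) => //.
        exact: measurableT_comp.
      by move=> z; exact: abse_ge0.
    move=> y _; apply: (@le_trans _ _ (\int[m1]_x (((fun y => `|g y|%:E) \_ D) y))%E).
      apply: ge0_le_integral => //.
        by apply: measurableT_comp => //; exact: measurableT_comp.
    by rewrite integral_cst//= (_ : m1 setT = 1%E) ?mule1//; exact: probability_setT.
  by rewrite -integral_mkcond; case/integrableP : ig.
have F1 x : (\int[m2]_y F (x, y))%E = (\int[m2]_(y in D) f (x, y))%:E.
  rewrite /Rintegral integral_mkcond.
  have -> : (\int[m2]_y ((fun y => (f (x, y))%:E) \_ D) y = \int[m2]_y F (x, y))%E.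
    apply: eq_integral => y _; rewrite patchE /F/= indicE.
    by case: ifP => _; rewrite ?mulr1 ?mulr0.
  rewrite fineK//; apply: integrable_fin_num => //.
  apply: (@le_integrable _ _ _ _ _ _ _ ((fun y => `|g y|%:E) \_ D)) => //.
  - exact: measurableT_comp.
  - by move=> y _; apply: (le_trans (Fg x y)); rewrite gee0_abs// patchE; case: ifP.
  - by rewrite -integrable_mkcond//; exact: integrable_norm.
have F2 y : (\int[m1]_x F (x, y))%E = (((fun y => \int[m1]_x f (x, y)) \_ D) y)%:E.
  rewrite patchE; case: ifPn => yD; last first.
    by rewrite integral0_eq// => x _; rewrite /F/= indicE (negbTE yD) mulr0.
  rewrite /Rintegral fineK.
    by apply: eq_integral => x _; rewrite /F/= indicE yD mulr1.
  apply: integrable_fin_num => //.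
  apply: (@le_integrable _ _ _ _ _ _ _ (cst `|g y|%:E)) => //.
  - by apply/measurable_EFinP; exact: measurableT_comp.
  - move=> x _; rewrite /= lee_fin normr_id (le_trans (fg _ _ _)) ?ler_norm//; exact: set_mem.
  - by apply/integrableP; split => //=; rewrite integral_cst//= (_ : m1 setT = 1%E) ?mule1 ?ltry//; exact: probability_setT.
rewrite [RHS]Rintegral_mkcond /Rintegral.
rewrite -[RHS](congr1 fine (eq_integral _ _ (fun y _ => F2 y))).
rewrite -(Fubini Ioo); congr fine; apply: eq_integral => x _; exact/esym/F1.
Qed.

(** * The law of a stable increment *)

Lemma Rintegral_dominated_cvg d (T : measurableType d) (R : realType)
    (m : {measure set T -> \bar R}) (D : set T) (f_ : nat -> T -> R) (f g : T -> R) :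
  measurable D -> (forall n, measurable_fun D (f_ n)) -> measurable_fun D f ->
  (forall x, D x -> f_ ^~ x @ \oo --> f x) ->
  m.-integrable D (EFin \o g) -> (forall n x, D x -> `|f_ n x| <= g x) ->
  (fun n => \int[m]_(x in D) f_ n x) @ \oo --> \int[m]_(x in D) f x.
Proof.
move=> mD mf_ mf f_f ig fg.
have [|||||h1 _ h3] := @dominated_convergence _ _ _ m D mD (fun n => EFin \o f_ n) (EFin \o f) (EFin \o g).
- by move=> n; exact/measurable_EFinP.
- exact/measurable_EFinP.
- by apply/aeW => x Dx; apply: cvg_EFin; [exact: nearW|exact: f_f].
- exact: ig.
- by apply/aeW => x n Dx; rewrite /= lee_fin fg.
apply: fine_cvg; rewrite fineK//; exact: integrable_fin_num.
Qed.

Lemma integrable_bounded d (T : measurableType d) (R : realType)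
    (P : probability T R) (f : T -> R) (K : R) :
  measurable_fun setT f -> (forall x, `|f x| <= K) -> P.-integrable setT (EFin \o f).
Proof.
move=> mf fK; apply: measurable_bounded_integrable => //.
  exact: le_lt_trans (probability_le1 P measurableT) (ltry _).
exists K; split; first exact: num_real.
by move=> y Ky x _; exact: le_trans (fK x) (ltW Ky).
Qed.

Lemma measurable_cos {R : realType} : measurable_fun setT (@cos R).
Proof. by apply: continuous_measurable_fun; exact: continuous_cos. Qed.

Lemma norm_cos_le1 {R : realType} (x : R) : `|cos x| <= 1.
Proof. by rewrite ler_norml cos_geN1 cos_le1. Qed.

Lemma normr_prod_le1 {R : realType} (I : finType) (Q : pred I) (F : I -> R) :
  (forall i, `|F i| <= 1) -> `|\prod_(i | Q i) F i| <= 1.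
Proof.
by move=> F1; rewrite normr_prod; apply: prodr_ile1 => i _; rewrite normr_ge0 F1.
Qed.

Section cosine_products.
Context {R : realType} {d : nat} {disp : measure_display}
  {Omega : measurableType disp} (P : probability Omega R).
Variables (alpha t : R) (Y : Omega -> 'rV[R]_d).
Hypothesis mY : forall j, measurable_fun setT (fun w => Y w ord0 j).
Hypothesis Ecos : forall xi : 'rV[R]_d,
  \int[P]_w cos (dotv xi (Y w)) = expR (- (t * \sum_(j < d) `|xi ord0 j| `^ alpha)).
Hypothesis Esin : forall xi : 'rV[R]_d, \int[P]_w sin (dotv xi (Y w)) = 0.
Variable x : 'rV[R]_d.

Let Z j w := x ord0 j + Y w ord0 j.

Let mZ j : measurable_fun setT (Z j).
Proof. exact: measurable_funD. Qed.

Let flip (k : 'I_d) (xi : 'rV[R]_d) : 'rV[R]_d :=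
  \row_j (if j == k then - xi ord0 j else xi ord0 j).

Let partial k (xi : 'rV[R]_d) (b : R) (bb : 'I_d -> R) w :=
  (\prod_(j < d | (j < k)%N) cos (xi ord0 j * Z j w - bb j)) *
  cos (\sum_(j < d | (k <= j)%N) xi ord0 j * Y w ord0 j - b).

Let measurable_partial k xi b bb : measurable_fun setT (partial k xi b bb).
Proof.
apply: measurable_funM.
  rewrite [X in measurable_fun _ X](_ : _ = fun w => \prod_(j <- enum 'I_d) (if (j < k)%N then cos (xi ord0 j * Z j w - bb j) else 1)).
    apply: measurable_prod => j _; case: (j < k)%N => //.
    apply: measurableT_comp; first exact: measurable_cos.
    by apply: measurable_funB => //; exact: measurable_funM.
  by apply/funext => w; rewrite big_mkcond/= big_enum.
apply: measurableT_comp; first exact: measurable_cos.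
apply: measurable_funB => //.
  rewrite [X in measurable_fun _ X](_ : _ = fun w => \sum_(j <- enum 'I_d) (if (k <= j)%N then xi ord0 j * Y w ord0 j else 0)).
    apply: measurable_sum => j; case: (k <= j)%N => //.
    exact: measurable_funM.
  by apply/funext => w; rewrite big_mkcond/= big_enum.
Qed.

Let partial_le1 k xi b bb w : `|partial k xi b bb w| <= 1.
Proof.
rewrite normrM mulr_ile1 ?norm_cos_le1//.
by apply: normr_prod_le1 => i; exact: norm_cos_le1.
Qed.

(** Coordinates are separated one at a time by [cos u * cos v = (cos (v + u) + cos (v - u)) / 2].
    The two terms differ by the sign of one frequency, to which the symbol [sum |xi_j|^alpha] is
    blind; both thus carry the same exponential and recombine into a product. This factorisation of
    cosine moments stands in for the independence of the coordinates. The phases are free because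
    each separation shifts them. *)
Lemma Rintegral_partial_cos k xi b bb : (k <= d)%N ->
  \int[P]_w partial k xi b bb w =
  (\prod_(j < d | (j < k)%N) cos (xi ord0 j * x ord0 j - bb j)) * cos b *
  expR (- (t * \sum_(j < d) `|xi ord0 j| `^ alpha)).
Proof.
elim: k xi b => [xi b _|k IH xi b kd].
  rewrite big_pred0// mul1r.
  rewrite [LHS](@eq_Rintegral _ _ _ P setT (fun w => cos b * cos (dotv xi (Y w)) + sin b * sin (dotv xi (Y w)))); last first.
    move=> w _; rewrite /partial big_pred0// mul1r cosB mulrC; congr (_ + _).
    by rewrite mulrC.
  have ic : P.-integrable setT (EFin \o (fun w => cos (dotv xi (Y w)))).
    apply: (@integrable_bounded _ _ _ _ _ 1) => //; last by move=> w; exact: norm_cos_le1.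
    apply: measurableT_comp; first exact: measurable_cos.
    by apply: measurable_sum => j; exact: measurable_funM.
  have is_ : P.-integrable setT (EFin \o (fun w => sin (dotv xi (Y w)))).
    apply: (@integrable_bounded _ _ _ _ _ 1) => //; last first.
      by move=> w; rewrite ler_norml sin_geN1 sin_le1.
    apply: measurableT_comp.
      by apply: continuous_measurable_fun; exact: continuous_sin.
    by apply: measurable_sum => j; exact: measurable_funM.
  rewrite RintegralD//; last 2 first.
  - exact: (integrableZl measurableT (cos b) ic).
  - exact: (integrableZl measurableT (sin b) is_).
  by rewrite !RintegralZl// Ecos Esin mulr0 addr0.
pose k0 := Ordinal kd.
have pk (F : 'I_d -> R) : \prod_(j < d | (j < k.+1)%N) F j = F k0 * \prod_(j < d | (j < k)%N) F j.
  rewrite (bigD1 k0) ?ltnSn//=; congr (_ * _); apply: eq_bigl => j.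
  by rewrite ltnS ltn_neqAle andbC.
have sk (F : 'I_d -> R) : \sum_(j < d | (k <= j)%N) F j = F k0 + \sum_(j < d | (k.+1 <= j)%N) F j.
  rewrite (bigD1 k0) ?leqnn//=; congr (_ + _); apply: eq_bigl => j.
  by rewrite [in RHS]ltn_neqAle andbC eq_sym.
(* At [k0], [xi * Y = (xi * Z - bb) + c]: this shift turns a frequency of [Y] into the argument of
   the new factor. *)
pose c := bb k0 - xi ord0 k0 * x ord0 k0.
have flipk : flip k0 xi ord0 k0 = - xi ord0 k0 by rewrite mxE eqxx.
have flipP (Q : pred 'I_d) (F : R -> 'I_d -> R) : ~~ Q k0 -> \prod_(j < d | Q j) F (flip k0 xi ord0 j) j = \prod_(j < d | Q j) F (xi ord0 j) j.
  move=> Qk; apply: eq_bigr => j Qj; rewrite mxE; case: eqP => // jk.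
  by move: Qk; rewrite -jk Qj.
have flipS (F : R -> 'I_d -> R) : \sum_(j < d | (k.+1 <= j)%N) F (flip k0 xi ord0 j) j = \sum_(j < d | (k.+1 <= j)%N) F (xi ord0 j) j.
  apply: eq_bigr => j Qj; rewrite mxE; case: eqP => // jk.
  by move: Qj; rewrite jk ltnn.
have flipn : \sum_(j < d) `|flip k0 xi ord0 j| `^ alpha = \sum_(j < d) `|xi ord0 j| `^ alpha.
  by apply: eq_bigr => j _; rewrite mxE; case: eqP => // _; rewrite normrN.
have step w : partial k.+1 xi b bb w = 2^-1 * (partial k xi (b + c) bb w + partial k (flip k0 xi) (b - c) bb w).
  rewrite /partial pk !sk flipk.
  rewrite (flipP (fun j => (j < k)%N) (fun a j => cos (a * Z j w - bb j))) ?ltnn//.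
  rewrite (flipS (fun a j => a * Y w ord0 j)).
  set S := \sum_(j < d | _) _; set Q := \prod_(j < d | _) _; rewrite -mulrDr.
  have -> : xi ord0 k0 * Y w ord0 k0 + S - (b + c) = (xi ord0 k0 * Z k0 w - bb k0) + (S - b).
    by rewrite /c /Z; ring.
  have -> : - xi ord0 k0 * Y w ord0 k0 + S - (b - c) = (S - b) - (xi ord0 k0 * Z k0 w - bb k0).
    by rewrite /c /Z; ring.
  move: (S - b) (xi ord0 k0 * Z k0 w - bb k0) => v u.
  by rewrite (cosD u v) (cosB v u); field.
have ip kk xx bbb : P.-integrable setT (EFin \o partial kk xx bbb bb).
  exact: (@integrable_bounded _ _ _ _ _ 1).
under eq_Rintegral do rewrite step.
rewrite RintegralZl//; last first.
  have := integrableD measurableT (ip k xi (b + c)) (ip k (flip k0 xi) (b - c)).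
  exact: eq_integrable.
rewrite RintegralD// !IH ?(ltnW kd)// flipn pk.
rewrite (flipP (fun j => (j < k)%N) (fun a j => cos (a * x ord0 j - bb j))) ?ltnn//.
have -> : xi ord0 k0 * x ord0 k0 - bb k0 = - c by rewrite /c; ring.
by rewrite cosN cosD cosB; set Q := \prod_(j < d | _) _; field.
Qed.

Lemma Rintegral_prod_cos (xi : 'rV[R]_d) (bb : 'I_d -> R) :
  \int[P]_w (\prod_(j < d) cos (xi ord0 j * (x ord0 j + Y w ord0 j) - bb j)) =
  \prod_(j < d) (expR (- (t * `|xi ord0 j| `^ alpha)) * cos (xi ord0 j * x ord0 j - bb j)).
Proof.
have := Rintegral_partial_cos xi 0 bb (leqnn d).
rewrite cos0 mulr1 big_split/= mulrC -expR_sum mulr_sumr.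
have all_lt (F : 'I_d -> R) : \prod_(j < d | (j < d)%N) F j = \prod_(j < d) F j.
  by apply: eq_bigl => j; rewrite ltn_ord.
rewrite all_lt -sumrN => <-; apply: eq_Rintegral => w _.
rewrite /partial all_lt [X in cos (X - _)]big_pred0 ?subr0 ?cos0 ?mulr1// => j.
by apply/negbTE; rewrite -ltnNge.
Qed.

End cosine_products.

(** * Cauchy kernels and the law of one coordinate *)

Section cauchy_kernel.
Context {R : realType}.
Local Notation mu := (@lebesgue_measure R).
Local Notation half := `[(0:R), +oo[%classic.

Lemma ft_expRN (e y : R) : 0 < e ->
  ft (fun xi => expR (- (e * xi))) y = pi^-1 * (e / (e ^+ 2 + y ^+ 2)).
Proof. by move=> e0; rewrite /ft laplace_cos. Qed.

Let den_gt0 (e z : R) : 0 < e -> 0 < e ^+ 2 + z ^+ 2.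
Proof. by move=> e0; rewrite ltr_pwDl ?sqr_ge0 ?exprn_gt0. Qed.

Lemma continuous_cauchy (e y : R) : 0 < e ->
  continuous (fun u : R => pi^-1 * (e / (e ^+ 2 + (y - u) ^+ 2))).
Proof.
move=> e0 u; apply: cvgMr; apply: cvgMr; apply: cvgV.
  by rewrite gt_eqF// den_gt0.
apply: cvgD; first exact: cvg_cst.
rewrite expr2; under eq_fun do rewrite expr2.
by apply: cvgM; apply: cvgB; (exact: cvg_cst || exact: cvg_id).
Qed.

Lemma Rintegral_cauchy (e y a b : R) : 0 < e -> a < b ->
  \int[mu]_(u in `[a, b]) (pi^-1 * (e / (e ^+ 2 + (y - u) ^+ 2))) =
  pi^-1 * (atan ((b - y) / e) - atan ((a - y) / e)).
Proof.
move=> e0 ab.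
have dF (u : R) : is_derive u 1 (fun u : R => pi^-1 * atan ((u - y) / e)) (pi^-1 * (e / (e ^+ 2 + (y - u) ^+ 2))).
  have h : is_derive u 1 (fun u : R => (u - y) / e) e^-1.
    by apply: is_derive_eq; rewrite /GRing.scale/=; ring.
  have h2 := @is_derive1_comp R atan (fun u : R => (u - y) / e) u _ _ (is_derive1_atan _) h.
  have h3 : is_derive u 1 (fun u : R => pi^-1 * atan ((u - y) / e)) (pi^-1 * ((1 + ((u - y) / e) ^+ 2)^-1 * e^-1)).
    by apply: is_derive_eq; rewrite /GRing.scale/=; ring.
  apply: (is_derive_eq h3); congr (_ * _).
  have := den_gt0 (y - u) e0; have : 0 < 1 + ((u - y) / e) ^+ 2.
    by rewrite ltr_pwDl ?sqr_ge0.
  rewrite expr_div_n => p1 p2; field.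
  by rewrite !gt_eqF.
have cF : continuous (fun u : R => pi^-1 * atan ((u - y) / e)).
  move=> u; have /derivable1_diffP : derivable (fun u : R => pi^-1 * atan ((u - y) / e)) u 1 by case: (dF u).
  exact: differentiable_continuous.
rewrite /Rintegral (@continuous_FTC2 _ _ (fun u : R => pi^-1 * atan ((u - y) / e)))//.
- by rewrite -EFinB/= mulrBr.
- by apply: continuous_subspaceT; exact: continuous_cauchy.
- split.
  + by move=> u _; case: (dF u).
  + by apply: cvg_at_right_filter; exact: cF.
  + by apply: cvg_at_left_filter; exact: cF.
- by move=> u _; rewrite derive1E; exact: (@derive_val _ _ _ _ _ _ _ (dF u)).
Qed.

End cauchy_kernel.

Lemma lipschitz_continuous {R : realType} (f : R -> R) (K : R) :
  (forall x y, `|f x - f y| <= K * `|x - y|) -> continuous f.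
Proof.
move=> fK x; apply/cvgrPdist_lt => e e0; near=> y.
have K1 : 0 < `|K| + 1 by rewrite ltr_wpDl.
apply: (le_lt_trans (fK x y)); apply: (@le_lt_trans _ _ ((`|K| + 1) * `|x - y|)).
  by rewrite ler_wpM2r// (le_trans (ler_norm _))// lerDl.
rewrite -ltr_pdivlMl//; near: y; apply: (@cvgr_dist_lt _ R^o) => //.
by rewrite mulr_gt0// invr_gt0.
Unshelve. all: by end_near. Qed.

Section interval_approximation.
Context {R : realType}.
Variables a b : R.
Hypothesis ab : a < b.

Let arg n (c : R) : R := n.+1%:R * (n.+1%:R * c - 1).

(* The endpoints move inwards by [1/(n+1)], which dominates the width
   [1/(n+1)^2], so that the limit vanishes at [a] and [b]. *)
Definition itv_approx n (y : R) : R :=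
  pi^-1 * (atan ((b - n.+1%:R^-1 - y) / (n.+1%:R ^+ 2)^-1) -
           atan ((a + n.+1%:R^-1 - y) / (n.+1%:R ^+ 2)^-1)).

Let itv_approxE n y :
  itv_approx n y = pi^-1 * (atan (arg n (b - y)) + atan (arg n (y - a))).
Proof.
rewrite /itv_approx -[in RHS](opprK (atan (arg n (y - a)))) -(atanN (arg n (y - a))).
have n0 : n.+1%:R != 0 :> R by [].
by congr (_ * (atan _ - atan _)); rewrite /arg; field.
Qed.

Let cvg_atan_arg c : atan (arg n c) @[n --> \oo] --> (if 0 < c then pi / 2 else - (pi / 2)).
Proof.
have cvgn : (fun n : nat => n.+1%:R : R) @ \oo --> +oo%R.
  apply/cvgryPge => A; near=> n.
  rewrite (@le_trans _ _ n%:R) ?ler_nat//; near: n; exact: nbhs_infty_ger.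
case: ifPn => c0.
  apply: (cvg_comp (fun n => arg n c) atan); last exact: cvgy_atan.
  apply/cvgryPge => A; near=> n.
  have n1 : 1 <= n.+1%:R :> R by rewrite ler1n.
  have hA : (`|A| + 1) / c <= n.+1%:R by near: n; move/cvgryPge : cvgn; exact.
  rewrite ler_pdivrMr// in hA.
  have A0 := ler_norm A; have A1 := normr_ge0 A.
  apply: (@le_trans _ _ (n.+1%:R * c - 1)); first by lra.
  by rewrite /arg ler_peMl//; lra.
have -> : (fun n => atan (arg n c)) = (fun n => - atan (- arg n c)).
  by apply/funext => n; rewrite atanN opprK.
apply: cvgN; apply: (cvg_comp (fun n => - arg n c) atan); last exact: cvgy_atan.
apply/cvgryPge => A; near=> n.
have n1 : 1 <= n.+1%:R :> R by rewrite ler1n.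
have hA : A <= n.+1%:R by near: n; move/cvgryPge : cvgn; exact.
by rewrite /arg; rewrite -leNgt in c0; nra.
Unshelve. all: by end_near. Qed.

Lemma cvg_itv_approx y : itv_approx n y @[n --> \oo] --> (\1_(`]a, b[%classic) y : R).
Proof.
rewrite (_ : (\1_(`]a, b[%classic) y : R) = pi^-1 * ((if 0 < b - y then pi / 2 else - (pi / 2)) + (if 0 < y - a then pi / 2 else - (pi / 2)))); last first.
  have p0 := @pi_gt0 R.
  rewrite !subr_gt0 indicE; have [ya|ay] := leP y a.
    rewrite (le_lt_trans ya ab) subrr mulr0 memNset//= in_itv/= => /andP[].
    by rewrite ltNge ya.
  have [yb|yb] := ltP y b.
    rewrite mem_set/=; last by rewrite in_itv/= ay.
    by rewrite -splitr mulVf// gt_eqF.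
  rewrite addNr mulr0 memNset//= in_itv/= => /andP[_].
  by rewrite ltNge yb.
under eq_fun do rewrite itv_approxE.
by apply: cvgMr; apply: cvgD; exact: cvg_atan_arg.
Qed.

Lemma itv_approx_le1 n y : `|itv_approx n y| <= 1.
Proof.
have p0 := @pi_gt0 R.
rewrite /itv_approx normrM gtr0_norm ?invr_gt0// ler_pdivrMl// mulr1.
set u := atan _; set v := atan _.
have := atan_gtNpi2 ((b - n.+1%:R^-1 - y) / (n.+1%:R ^+ 2)^-1).
have := atan_ltpi2 ((b - n.+1%:R^-1 - y) / (n.+1%:R ^+ 2)^-1).
have := atan_gtNpi2 ((a + n.+1%:R^-1 - y) / (n.+1%:R ^+ 2)^-1).
have := atan_ltpi2 ((a + n.+1%:R^-1 - y) / (n.+1%:R ^+ 2)^-1).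
rewrite -/u -/v ler_norml => *; lra.
Qed.

Lemma measurable_itv_approx n : measurable_fun setT (itv_approx n).
Proof.
have ma : measurable_fun setT (@atan R).
  by apply: continuous_measurable_fun; exact: continuous_atan.
apply: measurable_funM => //; apply: measurable_funB.
  apply: measurableT_comp => //; apply: measurable_funM => //; exact: measurable_funB.
apply: measurableT_comp => //; apply: measurable_funM => //; exact: measurable_funB.
Qed.

End interval_approximation.

Section coordinate_law.
Context {R : realType} {disp : measure_display}
  {Omega : measurableType disp} (P : probability Omega R).
Local Notation mu := (@lebesgue_measure R).
Local Notation half := `[(0:R), +oo[%classic.
Variables (alpha t : R) (V : Omega -> R) (x0 : R).
Hypotheses (alpha_gt0 : 0 < alpha) (t_gt0 : 0 < t).
Hypothesis mV : measurable_fun setT V.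

Let mhalf : measurable (half : set (measurableTypeR R)).
Proof. exact: measurable_itv. Qed.

(** Against the factor [G], later a product over the other coordinates, [V] has the cosine moments
    of a stable variable started at [x0], with [c] in the place of the expectation of [G]. The free
    phase [b] covers sines as well. *)
Definition cos_transform (G : Omega -> R) (c : R) :=
  [/\ measurable_fun setT G, (exists K, forall w, `|G w| <= K) &
      forall xi b, 0 <= xi -> \int[P]_w (G w * cos (xi * V w - b)) =
        c * (expR (- (t * xi `^ alpha)) * cos (xi * x0 - b))].

Lemma Rintegral_ft G c (f : R -> R) u : cos_transform G c ->
  measurable_fun setT f -> mu.-integrable half (EFin \o f) ->
  \int[P]_w (G w * ft f (V w - u)) =
  c * ft (fun xi => f xi * sweight alpha t xi) (x0 - u).
Proof.
move=> [mG [K GK] GE] mf fi.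
have i1 w : mu.-integrable half (EFin \o (fun xi => f xi * cos (xi * (V w - u)))).
  exact: integrable_mul_cos.
pose F (z : Omega * measurableTypeR R) := G z.1 * pi^-1 * (f z.2 * cos (z.2 * (V z.1 - u))).
have mF : measurable_fun setT F.
  apply: measurable_funM.
    by apply: measurable_funM => //; exact: measurableT_comp.
  apply: measurable_funM; first exact: measurableT_comp.
  apply: measurableT_comp; first exact: measurable_cos.
  apply: measurable_funM => //; apply: measurable_funB => //.
  exact: measurableT_comp.
have pi0 : 0 <= pi^-1 :> R by rewrite invr_ge0 pi_ge0.
have Fle w xi : half xi -> `|F (w, xi)| <= `|K * pi^-1 * f xi|.
  move=> _; rewrite /F/= !normrM; apply: ler_pM; rewrite ?mulr_ge0//.
    by apply: ler_wpM2r => //; exact: le_trans (GK w) (ler_norm _).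
  by rewrite ler_piMr// norm_cos_le1.
have iK : mu.-integrable half (EFin \o (fun xi => `|K * pi^-1 * f xi|)).
  apply: integrable_norm; have := integrableZl mhalf (K * pi^-1) fi.
  exact: eq_integrable.
have := @Rintegral_Fubini_dominated _ _ _ _ _ P mu _ _ _ mhalf mF iK Fle.
rewrite /F/= => FubE.
transitivity (\int[P]_w \int[mu]_(xi in half) (G w * pi^-1 * (f xi * cos (xi * (V w - u))))).
  by apply: eq_Rintegral => w _; rewrite RintegralZl// /ft mulrA.
rewrite FubE /ft mulrA -RintegralZl//; last first.
  apply: integrable_mul_cos; apply: le_integrable (fi) => //.
    apply/measurable_EFinP; apply: measurable_funM; apply: measurable_funTS => //.
    exact: measurable_sweight.
  move=> xi _; rewrite /= lee_fin normrM ler_piMr// ger0_norm ?sweight_ge0//.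
  exact/sweight_le1/ltW.
apply: eq_Rintegral => xi; rewrite inE/= in_itv/= andbT => xi0.
transitivity (pi^-1 * f xi * \int[P]_w (G w * cos (xi * V w - xi * u))).
  rewrite -RintegralZl//; last first.
    apply: (@integrable_bounded _ _ _ _ _ K).
      apply: measurable_funM => //; apply: measurableT_comp; first exact: measurable_cos.
      by apply: measurable_funB => //; exact: measurable_funM.
    by move=> w; rewrite normrM (le_trans _ (GK w))// ler_piMr// norm_cos_le1.
  by apply: eq_Rintegral => w _; rewrite mulrBr; ring.
by rewrite GE// /sweight mulrBr; ring.
Qed.

Lemma Rintegral_itv_law G c a b : a < b -> cos_transform G c ->
  \int[P]_w (G w * \1_(`]a, b[%classic) (V w)) =
  c * \int[mu]_(u in `]a, b[) sdens alpha t (u - x0).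
Proof.
move=> ab Gc; have [mG [K GK] GE] := Gc.
have [C [N [C0 CN]]] := sdens_bound alpha_gt0.
have [i1 i2] := integrable_sweight alpha_gt0 t_gt0.
pose e n : R := (n.+1%:R ^+ 2)^-1.
have e0 n : 0 < e n by rewrite invr_gt0 exprn_gt0.
pose I n : set (measurableTypeR R) := `[a + n.+1%:R^-1, b - n.+1%:R^-1]%classic.
have mI n : measurable (I n) by exact: measurable_itv.
pose sw n xi := expR (- (e n * xi)) * sweight alpha t xi.
have msw n : measurable_fun setT (sw n).
  apply: measurable_funM; last exact: measurable_sweight.
  apply: measurableT_comp => //; apply: measurableT_comp => //; exact: measurable_funM.
have sw1 n xi : half xi -> `|sw n xi| <= sweight alpha t xi.
  rewrite /= in_itv/= andbT => xi0; rewrite normrM (ger0_norm (expR_ge0 _)).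
  rewrite ger0_norm ?sweight_ge0// ler_piMl ?sweight_ge0//.
  by rewrite expR_le1 oppr_le0 mulr_ge0// ltW.
have isw n : mu.-integrable half (EFin \o sw n).
  apply: le_integrable (i1) => //.
    by apply/measurable_EFinP; exact: measurable_funTS (msw n).
  move=> xi h; rewrite /= lee_fin (le_trans (sw1 n xi h))// ler_norm//.
pose B := pi^-1 * \int[mu]_(xi in half) sweight alpha t xi.
have ftB n z : `|ft (sw n) z| <= B.
  apply: (le_trans (ft_le _ (isw n))); rewrite ler_wpM2l ?invr_ge0 ?pi_ge0//.
  apply: le_Rintegral => //; last by move=> xi h; exact: sw1.
  exact: integrable_norm.
have ixsw n : mu.-integrable half (EFin \o (fun xi => xi * sw n xi)).
  apply: le_integrable (i2) => //.
    by apply/measurable_EFinP; apply: measurable_funM => //; exact: measurable_funTS (msw n).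
  move=> xi h; rewrite /= lee_fin !normrM ler_wpM2l//.
  by rewrite -normrM (le_trans (sw1 n xi h))// ler_norm.
have continuous_ftsw n : continuous (ft (sw n)).
  by apply: lipschitz_continuous => y z; exact: ft_lipschitz.
have continuous_sdens : continuous (sdens alpha t).
  by apply: lipschitz_continuous => y z; exact: ft_lipschitz.
(* Fubini between [P] and the window [I n]. Integrated over the window, the Cauchy kernel of width
   [e n] is the arctangent difference [itv_approx]; its expectation at a fixed [u] is, by
   [Rintegral_ft], the stable transform damped by [e^(- e n xi)]. Both sides then converge under
   bounds uniform in [n]. *)
have stepn n : a + n.+1%:R^-1 < b - n.+1%:R^-1 ->
  \int[P]_w (G w * itv_approx a b n (V w)) = c * \int[mu]_(u in I n) ft (sw n) (u - x0).
  move=> abn.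
  pose F (z : Omega * measurableTypeR R) := G z.1 * (pi^-1 * (e n / (e n ^+ 2 + (V z.1 - z.2) ^+ 2))).
  have den0 z : 0 < e n ^+ 2 + z ^+ 2 by rewrite ltr_pwDl ?sqr_ge0 ?exprn_gt0.
  have mF : measurable_fun setT F.
    apply: measurable_funM; first exact: measurableT_comp.
    rewrite (_ : (fun z => _) = (fun u : R => pi^-1 * (e n / (e n ^+ 2 + (0 - u) ^+ 2))) \o (fun z : Omega * measurableTypeR R => z.2 - V z.1)); last first.
      by apply/funext => z /=; rewrite sub0r opprB.
    apply: measurableT_comp.
      by apply: continuous_measurable_fun; exact: continuous_cauchy.
    by apply: measurable_funB => //; exact: measurableT_comp.
  have Fle w u : I n u -> `|F (w, u)| <= cst (K * (pi^-1 * (e n / e n ^+ 2))) u.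
    move=> _; rewrite /F/= normrM ler_pM//.
    rewrite normrM (ger0_norm (ltW _)) ?invr_gt0 ?pi_gt0// ler_wpM2l ?invr_ge0 ?pi_ge0//.
    rewrite gtr0_norm ?divr_gt0// ler_wpM2l ?(ltW (e0 n))// lef_pV2 ?posrE ?exprn_gt0//.
    by rewrite lerDl sqr_ge0.
  have iK : mu.-integrable (I n) (EFin \o cst (K * (pi^-1 * (e n / e n ^+ 2)))).
    apply: (@continuous_compact_integrable R); first exact: segment_compact.
    by apply: continuous_subspaceT => x; exact: cvg_cst.
  have := @Rintegral_Fubini_dominated _ _ _ _ _ P mu _ _ _ (mI n) mF iK Fle.
  rewrite /F/= => FubE.
  transitivity (\int[P]_w \int[mu]_(u in I n) (G w * (pi^-1 * (e n / (e n ^+ 2 + (V w - u) ^+ 2))))).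
    apply: eq_Rintegral => w _; rewrite RintegralZl//; last first.
      apply: (@continuous_compact_integrable R); first exact: segment_compact.
      by apply: continuous_subspaceT; exact: continuous_cauchy.
    by rewrite Rintegral_cauchy.
  rewrite FubE -RintegralZl//; last first.
    apply: (@continuous_compact_integrable R); first exact: segment_compact.
    apply: continuous_subspaceT => u.
    apply: (continuous_comp (f := fun u : R => u - x0) (g := ft (sw n))).
      by apply: cvgB; [exact: cvg_id|exact: cvg_cst].
    exact: continuous_ftsw.
  apply: eq_Rintegral => u _.
  under eq_Rintegral do rewrite -ft_expRN//.
  rewrite (Rintegral_ft _ Gc)//.
  - by rewrite -ftN opprB.
  - apply: measurableT_comp => //; apply: measurableT_comp => //; exact: measurable_funM.
  - exact: integrable_expRN.
have lhs_cvg : \int[P]_w (G w * itv_approx a b n (V w)) @[n --> \oo] -->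
    \int[P]_w (G w * \1_(`]a, b[%classic) (V w)).
  apply: (@Rintegral_dominated_cvg _ _ _ _ _ _ _ (cst K)) => //.
  - move=> n; apply: measurable_funM => //; apply: measurableT_comp => //.
    exact: measurable_itv_approx.
  - apply: measurable_funM => //; apply: measurableT_comp => //.
  - by move=> w _; apply: cvgMr; exact: cvg_itv_approx.
  - exact: finite_measure_integrable_cst.
  - by move=> n w _; rewrite normrM (le_trans _ (GK w))// ler_piMr// itv_approx_le1.
have cvgn : (fun n : nat => n.+1%:R : R) @ \oo --> +oo%R.
  apply/cvgryPge => A; near=> n.
  rewrite (@le_trans _ _ n%:R) ?ler_nat//; near: n; exact: nbhs_infty_ger.
have cvgV : (fun n : nat => n.+1%:R^-1 : R) @ \oo --> (0 : R) by exact: cvg_harmonic.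
have cvge : e @ \oo --> (0 : R).
  rewrite /e (_ : (fun n => _) = (fun n : nat => n.+1%:R^-1 * n.+1%:R^-1)); last first.
    by apply/funext => n; rewrite -exprVn expr2.
  by rewrite -[X in _ --> X](mulr0 0); exact: cvgM.
have ft_cvg z : ft (sw n) z @[n --> \oo] --> sdens alpha t z.
  rewrite /sdens /ft; apply: cvgMr.
  apply: (@Rintegral_dominated_cvg _ _ _ mu half (fun n xi => sw n xi * cos (xi * z)) (fun xi => sweight alpha t xi * cos (xi * z)) (sweight alpha t)) => //.
  - move=> n; apply: measurable_funTS; apply: measurable_funM; first exact: msw.
    apply: measurableT_comp; first exact: measurable_cos.
    exact: measurable_funM.
  - apply: measurable_funTS; apply: measurable_funM; first exact: measurable_sweight.
    apply: measurableT_comp; first exact: measurable_cos.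
    exact: measurable_funM.
  - move=> xi _; apply: cvgMl; rewrite -[X in _ --> X]mul1r; apply: cvgMl.
    rewrite -(@expR0 R); apply: continuous_cvg; first exact: continuous_expR.
    rewrite -oppr0 -(mul0r xi); apply: cvgN; exact: cvgMl.
  - by move=> n xi h; rewrite normrM (le_trans _ (sw1 n xi h))// ler_piMr// norm_cos_le1.
have II n : I n = `]a, b[%classic `&` I n.
  apply/esym/setIidr => u; rewrite /I/= !in_itv/= => /andP[h1 h2].
  by rewrite (lt_le_trans _ h1) ?(le_lt_trans h2)// ?ltrBlDr ltrDl.
have rhs_cvg : c * \int[mu]_(u in I n) ft (sw n) (u - x0) @[n --> \oo] -->
    c * \int[mu]_(u in `]a, b[) sdens alpha t (u - x0).
  apply: cvgMr; under eq_fun do rewrite II Rintegral_mkcondr.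
  apply: (@Rintegral_dominated_cvg _ _ _ _ _ _ _ (cst B)) => //.
  - move=> n; apply/measurable_restrict => //; apply: measurable_funTS.
    apply: measurableT_comp; first exact: continuous_measurable_fun (@continuous_ftsw n).
    exact: measurable_funB.
  - apply: measurable_funTS; apply: measurableT_comp; first exact: continuous_measurable_fun.
    exact: measurable_funB.
  - move=> u /=; rewrite in_itv/= => /andP[au ub].
    apply: cvg_trans (ft_cvg (u - x0)); apply: near_eq_cvg; near=> n.
    rewrite patchE mem_set// /I/= in_itv/=; apply/andP; split.
    + rewrite -lerBrDl ltW//; near: n.
      have := @cvgr_lt R _ _ _ _ _ cvgV; apply; by rewrite subr_gt0.
    + rewrite lerBrDr -lerBrDl ltW//; near: n.
      have := @cvgr_lt R _ _ _ _ _ cvgV; apply; by rewrite subr_gt0.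
  - apply: (@integrableS _ (measurableTypeR R) R mu `[a, b]%classic) => //.
      by move=> u /=; rewrite !in_itv/= => /andP[/ltW -> /ltW ->].
    apply: (@continuous_compact_integrable R); first exact: segment_compact.
    by apply: continuous_subspaceT => x; exact: cvg_cst.
  - move=> n u _; rewrite patchE; case: ifP => _; first exact: ftB.
    by rewrite normr0 (le_trans _ (ftB n 0)).
apply: (cvg_unique _ _ rhs_cvg) => //.
apply: (cvg_trans _ lhs_cvg); apply: near_eq_cvg; near=> n; apply: stepn.
have h : n.+1%:R^-1 < (b - a) / 2.
  near: n; have := @cvgr_lt R _ _ _ _ _ cvgV; apply; by rewrite divr_gt0 ?subr_gt0.
by rewrite ltrBrDr -addrA -ltrBrDl (splitr (b - a)) ltrD.
Unshelve. all: by end_near. Qed.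

Lemma cos_transform1 : (forall xi b, 0 <= xi -> \int[P]_w cos (xi * V w - b) =
    expR (- (t * xi `^ alpha)) * cos (xi * x0 - b)) ->
  cos_transform (cst 1) 1.
Proof.
move=> h; split => //; first by exists 1 => w; rewrite normr1.
by move=> xi b xi0; under eq_Rintegral do rewrite mul1r; rewrite mul1r h.
Qed.

End coordinate_law.

Lemma continuous_sdens {R : realType} (alpha t : R) : 0 < alpha -> 0 < t ->
  continuous (sdens alpha t).
Proof.
move=> a0 t0; have [C [N [C0 CN]]] := sdens_bound a0.
by have [_ sL] := CN t t0; exact: lipschitz_continuous sL.
Qed.

Lemma measurable_sdens {R : realType} (alpha t : R) : 0 < alpha -> 0 < t ->
  measurable_fun setT (sdens alpha t).
Proof. by move=> a0 t0; apply: continuous_measurable_fun; exact: continuous_sdens. Qed.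

(** * Joint law of the coordinates of an increment *)

Section product_law.
Context {R : realType} {d : nat} {disp : measure_display}
  {Omega : measurableType disp} (P : probability Omega R).
Local Notation mu := (@lebesgue_measure R).
Local Notation half := `[(0:R), +oo[%classic.
Variables (alpha t : R) (Y : Omega -> 'rV[R]_d).
Hypotheses (alpha_gt0 : 0 < alpha) (t_gt0 : 0 < t).
Hypothesis mY : forall j, measurable_fun setT (fun w => Y w ord0 j).
Hypothesis Ecos : forall xi : 'rV[R]_d,
  \int[P]_w cos (dotv xi (Y w)) = expR (- (t * \sum_(j < d) `|xi ord0 j| `^ alpha)).
Hypothesis Esin : forall xi : 'rV[R]_d, \int[P]_w sin (dotv xi (Y w)) = 0.
Variable x : 'rV[R]_d.

Let Z j w := x ord0 j + Y w ord0 j.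

Let mZ j : measurable_fun setT (Z j).
Proof. exact: measurable_funD. Qed.

Let mhalf : measurable (half : set (measurableTypeR R)).
Proof. exact: measurable_itv. Qed.

(** [I] is the integral of [f] against the law of coordinate [j], in a form that tolerates any
    factor [G] with the right cosine moments. This is what allows cosines to be exchanged for [f]
    while the other coordinates are present. *)
Definition coord_test (j : 'I_d) (f : R -> R) (I : R) :=
  [/\ measurable_fun setT f, (exists K, forall u, `|f u| <= K) &
    forall G c, cos_transform P alpha t (Z j) (x ord0 j) G c ->
      \int[P]_w (G w * f (Z j w)) = c * I].

(** Induction on the number [k] of coordinates whose cosine has been replaced by its test function.
    The product [G] over all coordinates but [k0] satisfies [cos_transform] by the induction
    hypothesis, taken with a new frequency and phase at [k0]; hence the quantification over [xi] and
    [b]. *)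
Lemma Rintegral_prod_tests (f : 'I_d -> R -> R) (I : 'I_d -> R) :
  (forall j, coord_test j (f j) (I j)) ->
  \int[P]_w (\prod_(j < d) f j (Z j w)) = \prod_(j < d) I j.
Proof.
move=> fI.
pose F k (xi b : 'I_d -> R) (j : 'I_d) u := if (j < k)%N then f j u else cos (xi j * u - b j).
pose J k (xi b : 'I_d -> R) (j : 'I_d) := if (j < k)%N then I j else
  expR (- (t * xi j `^ alpha)) * cos (xi j * x ord0 j - b j).
have mF k xi b j : measurable_fun setT (F k xi b j).
  rewrite /F; case: (j < k)%N; first by case: (fI j).
  apply: measurableT_comp; first exact: measurable_cos.
  by apply: measurable_funB => //; exact: measurable_funM.
have /choice[K fK] j : exists K, forall u, `|f j u| <= K by case: (fI j).
have FK k xi b j u : `|F k xi b j u| <= Num.max 1 (K j).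
  by rewrite /F le_max; case: ifP => _; rewrite ?fK ?orbT// norm_cos_le1.
suff main k : (k <= d)%N -> forall xi b, (forall j, 0 <= xi j) ->
    \int[P]_w (\prod_(j < d) F k xi b j (Z j w)) = \prod_(j < d) J k xi b j.
  have := main d (leqnn d) (fun=> 0) (fun=> 0) (fun=> lexx 0).
  rewrite /F /J; under eq_Rintegral do under eq_bigr do rewrite ltn_ord.
  by under [in RHS]eq_bigr do rewrite ltn_ord.
elim: k => [_ xi b xi0|k IH kd xi b xi0].
  have := Rintegral_prod_cos mY Ecos Esin x (\row_j xi j) b.
  rewrite /F /J /=; under eq_Rintegral do under eq_bigr do rewrite mxE.
  by under [in RHS]eq_bigr do rewrite mxE ger0_norm//.
pose k0 := Ordinal kd.
pose G w := \prod_(j < d | j != k0) F k.+1 xi b j (Z j w).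
pose c := \prod_(j < d | j != k0) J k.+1 xi b j.
have [_ _ ftest] := fI k0.
have k0k : (k0 < k.+1)%N by [].
transitivity (\int[P]_w (G w * f k0 (Z k0 w))).
  by apply: eq_Rintegral => w _; rewrite (bigD1 k0)//= mulrC /F k0k.
rewrite (ftest G c); first by rewrite [RHS](bigD1 k0)//= mulrC /J k0k.
split.
- rewrite /G; rewrite [X in measurable_fun _ X](_ : _ = fun w => \prod_(j <- enum 'I_d) (if j != k0 then F k.+1 xi b j (Z j w) else 1)).
    apply: measurable_prod => j _; case: (j != k0) => //.
    exact: measurableT_comp.
  by apply/funext => w; rewrite big_mkcond/= big_enum.
- exists (\prod_(j < d | j != k0) Num.max 1 (K j)) => w.
  by rewrite /G normr_prod; apply: ler_prod => j _; rewrite normr_ge0 FK.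
move=> xi1 b1 xi10.
pose xi' j := if j == k0 then xi1 else xi j.
pose b' j := if j == k0 then b1 else b j.
have xi'0 j : 0 <= xi' j by rewrite /xi'; case: ifP.
have ltk (j : 'I_d) : j != k0 -> (j < k.+1)%N = (j < k)%N.
  by move=> jk; rewrite ltnS leq_eqVlt (_ : (j == k :> nat) = false)//; exact/negbTE.
transitivity (\int[P]_w (\prod_(j < d) F k xi' b' j (Z j w))).
  apply: eq_Rintegral => w _; rewrite [RHS](bigD1 k0)//= mulrC /F ltnn /xi' /b' eqxx; congr (_ * _).
  by apply: eq_bigr => j jk; rewrite /F ltk// (negbTE jk).
rewrite IH ?(ltnW kd)// (bigD1 k0)//= mulrC /J ltnn /xi' /b' eqxx; congr (_ * _).
by apply: eq_bigr => j jk; rewrite /J ltk// (negbTE jk).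
Qed.

Lemma cos_transform_coord j : cos_transform P alpha t (Z j) (x ord0 j) (cst 1) 1.
Proof.
apply: cos_transform1 => xi b xi0.
have := Rintegral_prod_cos mY Ecos Esin x (\row_i (if i == j then xi else 0)) (fun i => if i == j then b else 0).
have one (g : 'I_d -> R) : (forall i, i != j -> g i = 1) -> \prod_(i < d) g i = g j.
  by move=> g1; rewrite (bigD1 j)//= big1 ?mulr1.
rewrite one.
  rewrite !mxE eqxx ger0_norm// => <-; apply: eq_Rintegral => w _; rewrite one.
    by rewrite !mxE eqxx.
  by move=> i ij; rewrite mxE (negbTE ij) mul0r subr0 cos0.
move=> i ij; rewrite mxE (negbTE ij) mul0r subr0 cos0 normr0 powR0 ?gt_eqF//.
by rewrite mulr0 oppr0 expR0 mulr1.
Qed.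

Lemma Rintegral_prod_itv (a b : 'I_d -> R) : (forall j, a j < b j) ->
  \int[P]_w (\prod_(j < d) \1_(`]a j, b j[%classic) (Z j w)) =
  \prod_(j < d) \int[mu]_(u in `]a j, b j[) sdens alpha t (u - x ord0 j).
Proof.
move=> ab; apply: (@Rintegral_prod_tests (fun j => \1_(`]a j, b j[%classic))) => j; split.
- exact: measurable_indic.
- by exists 1 => u; rewrite indicE; case: (_ \in _); rewrite ?normr1// normr0.
- by move=> G c Gc; exact: Rintegral_itv_law.
Qed.

Lemma Rintegral_prod_sdens s y : 0 < s ->
  \int[P]_w (\prod_(j < d) sdens alpha s (Z j w - y j)) =
  \prod_(j < d) sdens alpha (s + t) (x ord0 j - y j).
Proof.
move=> s0; have [C [N [C0 CN]]] := sdens_bound alpha_gt0.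
have [sB sL] := CN s s0; have [i1 i2] := integrable_sweight alpha_gt0 s0.
apply: (@Rintegral_prod_tests (fun j u => sdens alpha s (u - y j))) => j; split.
- apply: measurableT_comp; last exact: measurable_funB.
  exact: measurable_sdens.
- by exists (C * (1 + s^-1 ^+ N)).
- move=> G c Gc; rewrite (Rintegral_ft t_gt0 (mZ j) _ Gc)//; last exact: measurable_sweight.
  congr (_ * ft _ _); apply/funext => xi.
  by rewrite /sweight -expRD mulrDl opprD.
Qed.

(** The cosine integral shows no sign. But [sdens] is continuous, and its integrals over intervals
    are probabilities; near a negative value one of them would be negative. *)
Lemma sdens_ge0_of_law (j : 'I_d) z : 0 <= sdens alpha t z.
Proof.
rewrite leNgt; apply/negP => z0.
have [C [N [C0 CN]]] := sdens_bound alpha_gt0.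
have [sB sL] := CN t t_gt0.
have cs : continuous (sdens alpha t) by exact: continuous_sdens.
have /cvgrPdist_lt/(_ (- sdens alpha t z / 2)) := cs z.
rewrite divr_gt0 ?oppr_gt0// => /(_ isT)/nbhs_ballP[e /= e0 eP].
pose a := z - e / 2 + x ord0 j; pose b := z + e / 2 + x ord0 j.
have ab : a < b by rewrite /a /b ltrD2r ltrBlDr -addrA ltrDl; lra.
have /= := Rintegral_itv_law alpha_gt0 t_gt0 (mZ j) ab (cos_transform_coord j).
have : 0 <= \int[P]_w (1 * \1_(`]a, b[%classic) (Z j w)).
  by apply: Rintegral_ge0 => w _; rewrite mul1r indicE; case: (_ \in _).
move=> /[swap] ->; rewrite mul1r leNgt => /negP; apply.
have iC k : mu.-integrable `]a, b[ (EFin \o cst k).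
  apply: (@integrableS _ (measurableTypeR R) R mu `[a, b]%classic) => //.
    by move=> u /=; rewrite !in_itv/= => /andP[/ltW -> /ltW ->].
  apply: (@continuous_compact_integrable R); first exact: segment_compact.
  by apply: continuous_subspaceT => ?; exact: cvg_cst.
apply: (@le_lt_trans _ _ (\int[mu]_(u in `]a, b[) (sdens alpha t z / 2))).
  apply: le_Rintegral => //.
  - apply: le_integrable (iC (C * (1 + t^-1 ^+ N))) => //.
      apply/measurable_EFinP/measurable_funTS/measurableT_comp; last exact: measurable_funB.
      exact: continuous_measurable_fun.
    by move=> u _; rewrite /= lee_fin (le_trans (sB _))// ler_norm.
  - exact: iC.
  - move=> u /=; rewrite in_itv/= => /andP[au ub].
    have /eP : ball z e (u - x ord0 j).
      rewrite /ball/= ltr_norml; rewrite /a /b in au ub; apply/andP; split; lra.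
    by rewrite ltr_norml => /andP[h _]; lra.
rewrite Rintegral_cst//.
have /= -> : mu `]a, b[%classic = (b - a)%:E.
  by rewrite lebesgue_measure_itv/= lte_fin ab EFinB.
by rewrite pmulr_llt0 ?subr_gt0//; lra.
Qed.

(** Tested against the Cauchy kernel of width [u], the law gives [E [u / (u^2 + Y^2)]] as the
    integral of [e^(- u xi) e^(- t xi^alpha)]. Hence [E [Y^2 / (u^2 + Y^2)]], which is at least half
    of the tail, equals [u] times the integral of [e^(- u xi) (1 - e^(- t xi^alpha))]. With
    [v = u xi], use [1 - e^(-a) <= a], [v^alpha <= 1 + v^2] (from [alpha < 2]) and
    [v^2 e^(-v) <= 8 e^(-v/2)]: the integrals [1/u] and [8 * 2/u] add up to [17/u], and
    [34 = 2 * 17]. *)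
Lemma coord_tail j (u : R) : alpha < 2 -> 0 < u ->
  (P [set w | (u <= `|Y w ord0 j|)%R] <= (34 * t * u `^ (- alpha))%:E)%E.
Proof.
move=> alpha_lt2 u0.
have u2 : 0 < u ^+ 2 by rewrite exprn_gt0.
have den0 v : 0 < u ^+ 2 + v ^+ 2 by rewrite ltr_pwDl ?sqr_ge0.
have := Rintegral_ft t_gt0 (mZ j) (x ord0 j) (cos_transform_coord j) _ (integrable_expRN u0).
have mexp : measurable_fun setT (fun xi : R => expR (- (u * xi))).
  by apply: measurableT_comp => //; apply: measurableT_comp => //; exact: measurable_funM.
move=> /(_ mexp); rewrite mul1r subrr.
under eq_Rintegral do rewrite ft_expRN// mul1r /Z addrAC subrr add0r.
rewrite /ft; under [in RHS]eq_Rintegral do rewrite mulr0 cos0 mulr1.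
pose h w := u / (u ^+ 2 + Y w ord0 j ^+ 2).
have mh : measurable_fun setT h.
  rewrite /h; apply: measurable_funM => //.
  apply: (@measurableT_comp _ _ _ _ _ _ (fun v : R => (u ^+ 2 + v ^+ 2)^-1) _ (fun w => Y w ord0 j)) => //.
  apply: continuous_measurable_fun => v; apply: cvgV; first by rewrite gt_eqF.
  by apply: cvgD; [exact: cvg_cst|exact: exprn_continuous].
have hle w : `|h w| <= u^-1.
  rewrite /h gtr0_norm ?divr_gt0// ler_pdivrMr// expr2 mulrDr mulKf ?gt_eqF//.
  by rewrite lerDl mulr_ge0 ?sqr_ge0// invr_ge0 ltW.
have ih : P.-integrable setT (EFin \o h) by exact: integrable_bounded hle.
rewrite RintegralZl//.
have pi1 : pi^-1 != 0 :> R by rewrite invr_eq0 gt_eqF ?pi_gt0.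
move=> /(mulfI pi1) Eh.
have := ge0_integral_expRN u0; have := ge0_integral_expRN (_ : 0 < u / 2).
rewrite divr_gt0// => /(_ isT) I2 I1.
have iu := integrable_expRN u0; have iu2 := integrable_expRN (_ : 0 < u / 2).
have {}iu2 : mu.-integrable half (EFin \o (fun x => expR (- (u / 2 * x)))) by apply: iu2; rewrite divr_gt0.
have isw : mu.-integrable half (EFin \o (fun xi => expR (- (u * xi)) * sweight alpha t xi)).
  apply: le_integrable (iu) => //.
    apply/measurable_EFinP/measurable_funTS/measurable_funM => //; exact: measurable_sweight.
  move=> xi _; rewrite /= lee_fin normrM ler_piMr// ger0_norm ?sweight_ge0//.
  exact/sweight_le1/ltW.
have key : u^-1 - \int[mu]_(xi in half) (expR (- (u * xi)) * sweight alpha t xi) <= 17 * t * u `^ (- alpha) * u^-1.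
  have -> : u^-1 = \int[mu]_(xi in half) expR (- (u * xi)) by rewrite /Rintegral I1.
  rewrite -RintegralB//.
  have ub : \int[mu]_(xi in half) (t * u `^ (- alpha) * (expR (- (u * xi)) + 8 * expR (- (u / 2 * xi)))) = 17 * t * u `^ (- alpha) * u^-1.
    rewrite RintegralZl//; last first.
      have := integrableD mhalf iu (integrableZl mhalf 8 iu2); exact: eq_integrable.
    rewrite RintegralD//; last by have := integrableZl mhalf 8 iu2; exact: eq_integrable.
    rewrite RintegralZl// /Rintegral I1 I2/=; field; by rewrite gt_eqF.
  have -> : \int[mu]_(xi in half) expR (- (u * xi)) = u^-1 by rewrite /Rintegral I1.
  rewrite -ub; apply: le_Rintegral => //.
  - have := integrableB mhalf iu isw; exact: eq_integrable.
  - have := integrableZl mhalf (t * u `^ (- alpha)) (integrableD mhalf iu (integrableZl mhalf 8 iu2)).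
    by apply: eq_integrable => // xi _; rewrite /= -EFinM -EFinD -EFinM.
  move=> xi; rewrite /= in_itv/= andbT => xi0.
  have e0 : 0 <= expR (- (u * xi)) by exact: expR_ge0.
  apply: (@le_trans _ _ (expR (- (u * xi)) * (t * xi `^ alpha))).
    rewrite -[X in X - _]mulr1 -mulrBr ler_wpM2l//.
    by rewrite lerBlDl -lerBlDr; have := expR_ge1Dx (- (t * xi `^ alpha)); rewrite /sweight.
  rewrite mulrCA -[leRHS]mulrA ler_wpM2l ?(ltW t_gt0)//.
  have -> : xi `^ alpha = u `^ (- alpha) * (u * xi) `^ alpha.
    by rewrite powRM ?(ltW u0)// mulrA powRN mulVf ?mul1r// gt_eqF ?powR_gt0.
  rewrite mulrCA ler_wpM2l ?powR_ge0//.
  have v0 : 0 <= u * xi by rewrite mulr_ge0// ltW.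
  have va : (u * xi) `^ alpha <= 1 + (u * xi) ^+ 2.
    have [v1|v1] := leP (u * xi) 1.
      apply: (@le_trans _ _ 1); last by rewrite lerDl sqr_ge0.
      apply: (@le_trans _ _ (1 `^ alpha)); last by rewrite powR1.
      by rewrite ge0_ler_powR ?nnegrE// ltW.
    apply: (@le_trans _ _ ((u * xi) ^+ 2)); last by rewrite lerDr.
    by rewrite -powR_mulrn// ler_powR ?ltW.
  apply: (@le_trans _ _ (expR (- (u * xi)) * (1 + (u * xi) ^+ 2))); first by rewrite ler_wpM2l.
  rewrite mulrDr mulr1 lerD2l.
  pose v := u / 2 * xi; rewrite -/v.
  have uv : u * xi = v + v by rewrite /v; field.
  have h1 : 1 + v ^+ 2 / 2`!%:R <= expR v.
    by apply: expR_ge1Dxn; rewrite /v !mulr_ge0 ?(ltW u0).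
  rewrite uv opprD expRD -mulrA [leRHS]mulrC ler_wpM2l ?expR_ge0//.
  rewrite expRN mulrC ler_pdivrMr ?expR_gt0//.
  have -> : (v + v) ^+ 2 = 8 * (v ^+ 2 / 2`!%:R) by rewrite (_ : 2`! = 2)%N; [field|].
  by rewrite ler_wpM2l//; lra.
pose A := [set w | u <= `|Y w ord0 j|].
have mA : measurable A.
  rewrite /A -[X in measurable X]setTI.
  rewrite (_ : [set w | _] = (fun w => `|Y w ord0 j|) @^-1` `[u, +oo[%classic); last first.
    by apply/seteqP; split => w /=; rewrite in_itv/= andbT.
  have mn : measurable_fun setT (fun w => `|Y w ord0 j|) by exact: measurableT_comp.
  by apply: mn => //; exact: measurable_itv.
have -> : P A = (\int[P]_w \1_A w)%:E.
  rewrite /Rintegral integral_indic// setIT fineK//.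
  by apply: fin_num_measure.
rewrite lee_fin; apply: (@le_trans _ _ (\int[P]_w (2 * (1 - u * h w)))).
  apply: le_Rintegral => //.
  - apply: (@integrable_bounded _ _ _ _ _ 1); first exact: measurable_indic.
    by move=> w; rewrite indicE; case: (_ \in _); rewrite ?normr1 ?normr0.
  - apply: (@integrable_bounded _ _ _ _ _ (2 * (1 + u * u^-1))).
      by apply: measurable_funM => //; apply: measurable_funB => //; exact: measurable_funM.
    move=> w; rewrite normrM ger0_norm// ler_wpM2l// (le_trans (ler_normB _ _))// normr1 lerD2l.
    by rewrite normrM gtr0_norm// ler_wpM2l// ltW.
  move=> w _.
  have -> : 1 - u * h w = Y w ord0 j ^+ 2 / (u ^+ 2 + Y w ord0 j ^+ 2).
    by rewrite /h; field; rewrite gt_eqF.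
  rewrite indicE; case: (boolP (w \in A)) => [|_]; last first.
    by rewrite mulr_ge0// divr_ge0 ?sqr_ge0// ltW.
  rewrite inE /A/= => uY; rewrite mulrA ler_pdivlMr// mul1r.
  suff : u ^+ 2 <= Y w ord0 j ^+ 2 by rewrite mulr_natl mulr2n lerD2r.
  by rewrite -(real_normK (num_real (Y w ord0 j))) lerXn2r// nnegrE ltW.
have iuh : P.-integrable setT (EFin \o (fun w => u * h w)).
  have := integrableZl measurableT u ih; exact: eq_integrable.
have i1 : P.-integrable setT (EFin \o (fun=> 1 : R)) by exact: finite_measure_integrable_cst.
have i1uh : P.-integrable setT (EFin \o (fun w => 1 - u * h w)).
  have := integrableB measurableT i1 iuh; exact: eq_integrable.
rewrite RintegralZl// RintegralB// RintegralZl// Eh.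
have -> : \int[P]_w 1 = 1.
  by rewrite Rintegral_cst// (_ : fine _ = 1) ?mulr1//; have /= -> := @probability_setT _ _ _ P.
have := ler_wpM2l (ltW u0) key.
set E := \int[_]_(_ in _) _; rewrite mulrBr mulfV ?gt_eqF//.
rewrite [X in _ <= X](_ : _ = 17 * t * u `^ (- alpha)); first by lra.
by field; rewrite gt_eqF.
Qed.

End product_law.

(** * Borel sets and integration on row vectors *)

Section borel_rV.
Context {R : realType} {n : nat}.

Lemma open_measurable_rV (U : set 'rV[R]_n) : open U -> measurable U.
Proof. by move=> oU; apply: sub_sigma_algebra. Qed.

Lemma measurable_coord (i : 'I_n) : measurable_fun setT (fun v : 'rV[R]_n => v ord0 i).
Proof.
apply: (measurability _ (RGenOInfty.measurableE R)) => _ [_ [x ->] <-].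
rewrite setTI; apply: open_measurable_rV.
apply: open_comp; last exact: interval_open.
by move=> v _; exact: coord_continuous.
Qed.

Definition box (a b : 'I_n -> R) : set 'rV[R]_n :=
  [set v | forall i, `]a i, b i[%classic (v ord0 i)].

Lemma measurable_box a b : measurable (box a b).
Proof.
rewrite (_ : box a b = \bigcap_i ((fun v : 'rV[R]_n => v ord0 i) @^-1` `]a i, b i[%classic)).
  apply: fin_bigcap_measurable => // i _.
  by rewrite -[X in measurable X]setTI; apply: measurable_coord => //; exact: measurable_itv.
by apply/seteqP; split=> v /= h i; [move=> _|]; exact: h.
Qed.

Let cube (q : 'rV[rat]_n * nat) :=
  box (fun i => ratr (q.1 ord0 i) - q.2.+1%:R^-1) (fun i => ratr (q.1 ord0 i) + q.2.+1%:R^-1).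

Let open_cover (U : set 'rV[R]_n) : open U ->
  U = \bigcup_(q in [set q | cube q `<=` U]) cube q.
Proof.
move=> oU; apply/seteqP; split=> [t Ut|t [q Pq] /Pq//].
have /nbhs_ballP[e /= e0 eU] := open_nbhs_nbhs (conj oU Ut).
have [//|k] := @ltr_add_invr R 0 (e / 2); first by rewrite divr_gt0.
rewrite add0r => ke.
have /choice[q hq] (i : 'I_n) : exists q : rat,
    ball (ratr q : R) k.+1%:R^-1 (t ord0 i).
  have [||x [tx [q _ qx]]] := @dense_rat R (ball (t ord0 i) k.+1%:R^-1).
  - by exists (t ord0 i); exact: ballxx.
  - exact: ball_open.
  - by exists q; apply: ball_sym; rewrite qx.
have cubeE v : cube (\row_i q i, k) v <-> forall i, ball (ratr (q i) : R) k.+1%:R^-1 (v ord0 i).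
  by rewrite /cube /box/=; split => h i; have := h i; rewrite ball_itv /= mxE.
exists (\row_i q i, k); last exact/cubeE.
move=> s /cubeE hs; apply: eU; split=> // i j.
rewrite (ord1 i); apply: (@ball_splitr _ _ (ratr (q j) : R)).
  exact: (le_ball (ltW ke)).
exact: (le_ball (ltW ke)).
Qed.

Lemma measurable_rV d (T : measurableType d) (f : T -> 'rV[R]_n) :
  (forall i, measurable_fun setT (fun w => f w ord0 i)) -> measurable_fun setT f.
Proof.
move=> mf; apply: (@measurability _ _ _ _ setT f (@open 'rV[R]_n)) => //.
move=> _ [U oU <-]; rewrite setTI (open_cover oU) preimage_bigcup bigcup_mkcond.
apply: countable_bigcupT_measurable => // q; case: ifPn => // _.
rewrite (_ : _ @^-1` _ = \bigcap_i ((fun w => f w ord0 i) @^-1` `](ratr (q.1 ord0 i) - q.2.+1%:R^-1), (ratr (q.1 ord0 i) + q.2.+1%:R^-1)[%classic)).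
  apply: fin_bigcap_measurable => // i _.
  by rewrite -[X in measurable X]setTI; apply: mf => //; exact: measurable_itv.
by apply/seteqP; split=> t /= h i; [move=> _|]; exact: h.
Qed.

Lemma measurable_box_generated :
  @measurable _ 'rV[R]_n = <<s [set A | exists a b, A = box a b] >>.
Proof.
apply/seteqP; split.
  apply: smallest_sub; first exact: smallest_sigma_algebra.
  move=> U oU; rewrite (open_cover oU) bigcup_mkcond.
  apply: (@countable_bigcupT_measurable _ (g_sigma_algebraType [set A | exists a b, A = box a b])) => // q.
  case: ifPn => // _; apply: sub_sigma_algebra.
  by eexists; eexists.
apply: smallest_sub; first exact: sigma_algebra_measurable.
by move=> _ [a [b ->]]; exact: measurable_box.
Qed.

Lemma setI_closed_box : setI_closed [set A | exists a b, A = box a b].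
Proof.
move=> _ _ [a [b ->]] [a' [b' ->]].
exists (fun i => Num.max (a i) (a' i)), (fun i => Num.min (b i) (b' i)).
apply/seteqP; split => v /=.
  move=> [h h'] i; have := h i; have := h' i.
  by rewrite /= !in_itv/= gt_max lt_min => /andP[-> ->] /andP[-> ->].
move=> h; split => i; have := h i;
  by rewrite /= !in_itv/= gt_max lt_min => /andP[/andP[? ?] /andP[? ?]]; apply/andP.
Qed.

Lemma norm_coord_le (v : 'rV[R]_n) i : `|v ord0 i| <= `|v|.
Proof.
rewrite [leRHS]mx_normrE.
exact: (@le_bigmax _ _ _ 0 (fun ij : 'I_1 * 'I_n => `|v ij.1 ij.2|) (ord0, i)).
Qed.

Lemma bigcup_box : \bigcup_k box (fun=> - k%:R) (fun=> k%:R) = setT.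
Proof.
apply/seteqP; split => // v _.
exists (Num.truncn `|v|).+1 => // i; rewrite /= in_itv/= -ltr_norml.
by apply: le_lt_trans (truncnS_gt _); exact: norm_coord_le.
Qed.

Lemma nondecreasing_box : {homo (fun k => box (fun=> - k%:R) (fun=> k%:R)) : k m / (k <= m)%N >-> (k <= m)%O}.
Proof.
move=> k m km; apply/subsetPset => v h i; have := h i; rewrite /= !in_itv/= => /andP[h1 h2].
by rewrite (le_lt_trans _ h1) ?(lt_le_trans h2)// ?lerN2 ler_nat.
Qed.

Let lebesgue_rV_sigma_finite : sigma_finite setT (@lebesgue_rV R n).
Proof.
exists (fun k => box (fun=> - k%:R) (fun=> k%:R)); first by rewrite bigcup_box.
move=> k; split; first exact: measurable_box.
have E := @lebesgue_rV_prod R n (fun=> `](- k%:R), k%:R[%classic) (fun=> measurable_itv _).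
rewrite [X in (X < _)%E]E.
rewrite (eq_bigr (fun=> (2 * k%:R)%:E)); last first.
  move=> i _; rewrite lebesgue_measure_itv/= lte_fin; case: ltP => kk.
    by rewrite -EFinD opprK mulrDl mul1r.
  have -> : k%:R = 0 :> R by apply/eqP; rewrite eq_le ler0n andbT; move: kk; rewrite lerNr; lra.
  by rewrite mulr0.
by rewrite prodEFin ltry.
Qed.

HB.instance Definition _ := Measure_isSigmaFinite.Build _ _ _ (@lebesgue_rV R n)
  lebesgue_rV_sigma_finite.

End borel_rV.

Lemma ge0_integral_tlebesgue {R : realType} n (f : 'I_n -> R -> R) :
  (forall i, measurable_fun setT (f i)) -> (forall i u, 0 <= f i u) ->
  (\int[tlebesgue n]_t (\prod_(i < n) f i (tnth t i))%:E =
   \prod_(i < n) \int[@lebesgue_measure R]_u (f i u)%:E)%E.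
Proof.
elim: n f => [f _ _|n IH f mf f0].
  under eq_integral do rewrite big_ord0.
  by rewrite /= integral_dirac// diracT mul1e big_ord0.
have mprod m (g : 'I_m -> R -> R) : (forall i, measurable_fun setT (g i)) ->
  measurable_fun setT (fun t : m.-tuple (measurableTypeR R) => \prod_(i < m) g i (tnth t i)).
  move=> mg; rewrite [X in measurable_fun _ X](_ : _ = fun t => \prod_(i <- enum 'I_m) g i (tnth t i)).
    apply: measurable_prod => i _; apply: measurableT_comp => //; exact: measurable_tnth.
  by apply/funext => t; rewrite big_enum.
have g0 m (g : 'I_m -> R -> R) (t : m.-tuple (measurableTypeR R)) : (forall i u, 0 <= g i u) -> 0 <= \prod_(i < m) g i (tnth t i).
  by move=> h; apply: prodr_ge0.
have mtcons : measurable_fun setT (@tcons R n) by exact: measurable_cons.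
rewrite /= ge0_integral_pushforward//; last 2 first.
- by apply/measurable_EFinP; exact: mprod.
- by move=> t _; rewrite lee_fin; exact: g0.
have mF : measurable_fun setT ((fun t : n.+1.-tuple (measurableTypeR R) => (\prod_(i < n.+1) f i (tnth t i))%:E) \o @tcons R n).
  by apply: measurableT_comp => //; apply/measurable_EFinP; exact: mprod.
rewrite preimage_setT fubini_tonelli1//; last by move=> t; rewrite lee_fin; exact: g0.
rewrite big_ord_recl -IH//.
have I0 : (0 <= \int[tlebesgue n]_t (\prod_(i < n) f (lift ord0 i) (tnth t i))%:E)%E.
  by apply: integral_ge0 => t _; rewrite lee_fin; apply: prodr_ge0.
rewrite -ge0_integralZr//; last 2 first.
- by apply/measurable_EFinP; exact: mf.
- by move=> u _; rewrite lee_fin.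
apply: eq_integral => u _; rewrite /fubini_F/=.
rewrite -ge0_integralZl//; last 3 first.
- by apply/measurable_EFinP; apply: (mprod n (fun i => f (lift ord0 i))).
- by move=> t _; rewrite lee_fin; apply: prodr_ge0.
- by rewrite lee_fin.
apply: eq_integral => t _; rewrite -EFinM big_ord_recl; congr (_ * _)%:E.
by apply: eq_bigr => i _; rewrite tnthS.
Qed.

Lemma ge0_integral_rV_prod {R : realType} n (f : 'I_n -> R -> R) :
  (forall i, measurable_fun setT (f i)) -> (forall i u, 0 <= f i u) ->
  (\int[@lebesgue_rV R n]_v (\prod_(i < n) f i (v ord0 i))%:E =
   \prod_(i < n) \int[@lebesgue_measure R]_u (f i u)%:E)%E.
Proof.
move=> mf f0; rewrite -ge0_integral_tlebesgue//.
rewrite ge0_integral_pushforward//; last 3 first.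
- apply: measurable_rV => i.
  by under eq_fun do rewrite mxE; exact: measurable_tnth.
- apply/measurable_EFinP; rewrite [X in measurable_fun _ X](_ : _ = fun v : 'rV[R]_n => \prod_(i <- enum 'I_n) f i (v ord0 i)).
    apply: measurable_prod => i _; apply: measurableT_comp => //; exact: measurable_coord.
  by apply/funext => t; rewrite big_enum.
- by move=> v _; rewrite lee_fin; apply: prodr_ge0.
by rewrite preimage_setT; apply: eq_integral => t _ /=; under eq_bigr do rewrite mxE.
Qed.

(** * Stable densities in dimension d *)

Section density.
Local Open Scope ereal_scope.
Context d1 d2 (S : measurableType d1) (T : measurableType d2) (R : realType).
Variables (m : {measure set S -> \bar R}) (l : {measure set T -> \bar R}).
Variables (A : set S) (Z : S -> T) (g : T -> \bar R).
Hypotheses (mA : measurable A) (mZ : measurable_fun setT Z).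
Hypotheses (mg : measurable_fun setT g) (g0 : forall y, 0 <= g y).
Hypothesis gfin : forall y, g y \is a fin_num.
Hypothesis law : forall B, measurable B -> m (A `&` Z @^-1` B) = \int[l]_(y in B) g y.

Import HBNNSimple.

Let mpre B : measurable B -> measurable (Z @^-1` B).
Proof. by move=> mB; rewrite -[X in measurable X]setTI; exact: mZ. Qed.

Let integral_density_nnsfun (f : {nnsfun T >-> R}) :
  \int[m]_(s in A) (f (Z s))%:E = \int[l]_y ((f y)%:E * g y).
Proof.
have mi k : measurable (f @^-1` [set k]) by [].
have mind k : measurable_fun setT (fun y => (\1_(f @^-1` [set k]) y)%:E : \bar R).
  by apply/measurable_EFinP; exact: measurable_indic.
have fE y : (f y)%:E = \sum_(k \in range f) k%:E * (\1_(f @^-1` [set k]) y)%:E.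
  by rewrite fsumEFin //= fimfunE.
transitivity (\sum_(k \in range f) k%:E * \int[l]_(y in f @^-1` [set k]) g y).
  under eq_integral do rewrite fE.
  rewrite ge0_integral_fsum//; last 2 first.
  - by move=> k; apply: measurable_funeM; apply: measurable_funTS; exact: (measurableT_comp (mind k) mZ).
  - by move=> k s _; exact: nnfun_muleindic_ge0.
  apply: eq_fsbigr => k; rewrite inE => -[y _ <-].
  rewrite ge0_integralZl//; last 2 first.
  - by apply: measurable_funTS; exact: (measurableT_comp (mind _) mZ).
  - by rewrite lee_fin.
  congr (_ * _); rewrite -law// setIC -integral_indic//; last exact: mpre.
transitivity (\int[l]_y \sum_(k \in range f) (k%:E * (\1_(f @^-1` [set k]) y)%:E * g y)).
  rewrite ge0_integral_fsum//; last 2 first.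
  - by move=> k; apply: emeasurable_funM => //; exact: measurable_funeM.
  - by move=> k y _; rewrite mule_ge0// nnfun_muleindic_ge0.
  apply: eq_fsbigr => k; rewrite inE => -[y _ <-].
  under [RHS]eq_integral do rewrite -muleA.
  rewrite ge0_integralZl//; last 3 first.
  - exact: emeasurable_funM.
  - by move=> z _; rewrite mule_ge0// lee_fin.
  - by rewrite lee_fin.
  congr (_ * _); rewrite integral_mkcond; apply: eq_integral => z _.
  by rewrite patchE indicE; case: (_ \in _); rewrite ?mul1e ?mul0e.
apply: eq_integral => y _; rewrite fE ge0_mule_fsuml// => k.
exact: nnfun_muleindic_ge0.
Qed.

(** [A] is kept as a restriction because the laws met later are those of a position on a survival
    event, with mass at most 1. *)
Lemma ge0_integral_density (f : T -> \bar R) :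
  measurable_fun setT f -> (forall y, 0 <= f y) ->
  \int[m]_(s in A) f (Z s) = \int[l]_y (f y * g y).
Proof.
move=> mf f0; pose f_ := nnsfun_approx measurableT mf.
have mfn n : measurable_fun setT (fun y => (f_ n y)%:E : \bar R) by exact/measurable_EFinP.
have fnf y : (f_ n y)%:E @[n --> \oo] --> f y.
  exact: cvg_nnsfun_approx.
have ndf y : {homo (fun n => (f_ n y)%:E : \bar R) : a b / (a <= b)%N >-> a <= b}.
  by move=> a b ab; rewrite lee_fin; exact/lefP/nd_nnsfun_approx.
transitivity (limn (fun n => \int[m]_(s in A) (f_ n (Z s))%:E)).
  rewrite -monotone_convergence//.
  - by apply: eq_integral => s _; apply/esym/cvg_lim => //; exact: fnf.
  - by move=> n; apply: measurable_funTS; exact: (measurableT_comp (mfn n) mZ).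
  by move=> n s _; rewrite lee_fin.
under eq_fun do rewrite integral_density_nnsfun.
rewrite -monotone_convergence//.
- apply: eq_integral => y _; apply/cvg_lim => //.
  by apply: cvgeZr => //; exact: fnf.
- by move=> n; exact: emeasurable_funM.
- by move=> n y _; rewrite mule_ge0// lee_fin.
- by move=> y _ a b ab; rewrite lee_wpmul2r//; exact: ndf.
Qed.

End density.

Definition pdens {R : realType} {d : nat} (alpha t : R) (x y : 'rV[R]_d) : R :=
  \prod_(j < d) sdens alpha t (y ord0 j - x ord0 j).

Definition stable_increment {R : realType} {d : nat} {disp : measure_display}
    {Omega : measurableType disp} (P : probability Omega R)
    (alpha t : R) (Y : Omega -> 'rV[R]_d) : Prop :=
  [/\ measurable_fun setT Y,
      forall xi : 'rV[R]_d, \int[P]_w cos (dotv xi (Y w)) =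
        expR (- (t * \sum_(j < d) `|xi ord0 j| `^ alpha)) &
      forall xi : 'rV[R]_d, \int[P]_w sin (dotv xi (Y w)) = 0].

Lemma measurable_fun_prod {R : realType} {dT : measure_display} (T : measurableType dT)
    (n : nat) (f : 'I_n -> T -> R) :
  (forall i, measurable_fun setT (f i)) -> measurable_fun setT (fun w => \prod_(i < n) f i w).
Proof.
move=> mf; rewrite [X in measurable_fun _ X](_ : _ = fun w => \prod_(i <- enum 'I_n) f i w).
  by apply: measurable_prod => i _.
by apply/funext => t; rewrite big_enum.
Qed.

Definition norm_ball {R : realType} {d : nat} (x : 'rV[R]_d) (r : R) : set 'rV[R]_d :=
  [set y | `|y - x| < r].

Lemma measurable_norm_rV {R : realType} {d : nat} :
  measurable_fun setT (fun v : 'rV[R]_d => `|v|).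
Proof.
apply: (measurability _ (RGenOInfty.measurableE R)) => _ [_ [x ->] <-].
rewrite setTI; apply: open_measurable_rV.
apply: open_comp; last exact: interval_open.
by move=> v _; exact: norm_continuous.
Qed.

Section pdens_theory.
Context {R : realType} {d : nat} {disp : measure_display}
  {Omega : measurableType disp} (P : probability Omega R).
Local Notation lam := (@lebesgue_rV R d).
Variables (alpha : R) (Y : R -> Omega -> 'rV[R]_d).
Hypotheses (alpha_gt0 : 0 < alpha) (alpha_lt2 : alpha < 2).
Hypothesis hY : forall t, 0 < t -> stable_increment P alpha t (Y t).

Let mYj t j : 0 < t -> measurable_fun setT (fun w => Y t w ord0 j).
Proof.
by move=> t0; have [mY _ _] := hY t0; exact: (measurableT_comp (measurable_coord j) mY).
Qed.

Lemma sdens_ge0 t z : 0 < t -> (0 < d)%N -> 0 <= sdens alpha t z.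
Proof.
move=> t0 d0; have [mY Ec Es] := hY t0.
exact: (sdens_ge0_of_law alpha_gt0 t0 (fun j => mYj j t0) Ec Es 0 (Ordinal d0)).
Qed.

Lemma pdens_ge0 t (x y : 'rV[R]_d) : 0 < t -> 0 <= pdens alpha t x y.
Proof.
by move=> t0; apply: prodr_ge0 => j _; apply: sdens_ge0 => //; case: j => i; exact: leq_trans.
Qed.

Lemma pdensC t (x y : 'rV[R]_d) : pdens alpha t x y = pdens alpha t y x.
Proof. by apply: eq_bigr => j _; rewrite -[LHS]ftN opprB. Qed.

Lemma measurable_pdens t : 0 < t ->
  measurable_fun setT (fun z : 'rV[R]_d * 'rV[R]_d => pdens alpha t z.1 z.2).
Proof.
move=> t0; apply: measurable_fun_prod => j.
apply: measurableT_comp; first exact: measurable_sdens.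
apply: measurable_funB.
  exact: (measurableT_comp (measurable_coord j) measurable_snd).
exact: (measurableT_comp (measurable_coord j) measurable_fst).
Qed.

Lemma measurable_pdensr t (x : 'rV[R]_d) : 0 < t -> measurable_fun setT (pdens alpha t x).
Proof.
move=> t0; apply: measurable_fun_prod => j.
apply: measurableT_comp; first exact: measurable_sdens.
by apply: measurable_funB => //; exact: measurable_coord.
Qed.

Let mbox t x (a b : 'I_d -> R) : 0 < t ->
  P ((fun w => x + Y t w) @^-1` box a b) = (\int[lam]_(y in box a b) (pdens alpha t x y)%:E)%E.
Proof.
move=> t0; have [mY Ec Es] := hY t0.
have indE (w : 'rV[R]_d) : (\1_(box a b) w : R) = \prod_(j < d) \1_(`]a j, b j[%classic) (w ord0 j).
  rewrite indicE; case: (boolP (w \in box a b)) => wab.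
    rewrite big1// => j _; rewrite indicE mem_set//.
    by move: wab; rewrite inE => /(_ j).
  have [j hj] : exists j, ~ `]a j, b j[%classic (w ord0 j).
    apply/not_existsP => h; move: wab; rewrite notin_setE; apply => j.
    by have := h j; rewrite notK.
  by rewrite (bigD1 j)//= indicE memNset// mul0r.
have intE : (\int[lam]_(y in box a b) (pdens alpha t x y)%:E =
    \prod_(j < d) \int[@lebesgue_measure R]_(u in `]a j, b j[) (sdens alpha t (u - x ord0 j))%:E)%E.
  rewrite integral_mkcond.
  transitivity (\int[lam]_y (\prod_(j < d) (\1_(`]a j, b j[%classic) (y ord0 j) * sdens alpha t (y ord0 j - x ord0 j)))%:E)%E.
    apply: eq_integral => y _; rewrite patchE big_split/= -indE indicE.
    by case: (_ \in _); rewrite ?mul1r ?mul0r.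
  rewrite (ge0_integral_rV_prod (f := fun j u => \1_(`]a j, b j[%classic) u * sdens alpha t (u - x ord0 j))); last 2 first.
  - move=> j; apply: measurable_funM.
      by apply: measurable_indic; exact: measurable_itv.
    apply: measurableT_comp; first exact: measurable_sdens.
    exact: measurable_funB.
  - move=> j u; rewrite mulr_ge0// sdens_ge0//; case: j => i; exact: leq_trans.
  apply: eq_bigr => j _; rewrite [RHS]integral_mkcond; apply: eq_integral => u _.
  by rewrite patchE indicE; case: (_ \in _); rewrite ?mul1r ?mul0r.
have mbx : measurable ((fun w => x + Y t w) @^-1` box a b).
  rewrite -[X in measurable X]setTI.
  have mxY : measurable_fun setT (fun w => x + Y t w).
    apply: measurable_rV => i; under eq_fun do rewrite mxE.
    by apply: measurable_funD => //; exact: mYj.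
  by apply: mxY => //; exact: measurable_box.
case: (pselect (forall j, a j < b j)) => [ab|/existsNP[j /negP]].
  have := Rintegral_prod_itv alpha_gt0 t0 (fun j => mYj j t0) Ec Es x ab.
  have indxY w : \prod_(j < d) \1_(`]a j, b j[%classic) (x ord0 j + Y t w ord0 j) = \1_(box a b) (x + Y t w) :> R.
    by rewrite indE; apply: eq_bigr => j _; rewrite mxE.
  under eq_Rintegral do rewrite indxY.
  move=> E; rewrite intE.
  have -> : P ((fun w => x + Y t w) @^-1` box a b) = (\int[P]_w \1_(box a b) (x + Y t w))%:E.
    rewrite /Rintegral.
    rewrite (_ : (fun w => (\1_(box a b) (x + Y t w))%:E) = (fun w => (\1_((fun w => x + Y t w) @^-1` box a b) w)%:E)).
      rewrite integral_indic// setIT fineK//; exact: fin_num_measure.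
    by [].
  rewrite E -prodEFin; apply: eq_bigr => j _.
  rewrite /Rintegral fineK//; apply: integrable_fin_num => //.
  apply: (@integrableS _ (measurableTypeR R) R lebesgue_measure `[a j, b j]%classic) => //.
    by move=> u /=; rewrite !in_itv/= => /andP[/ltW -> /ltW ->].
  apply: (@continuous_compact_integrable R); first exact: segment_compact.
  apply: continuous_subspaceT => u.
  apply: (continuous_comp (f := fun u : R => u - x ord0 j) (g := sdens alpha t)).
    by apply: cvgB; [exact: cvg_id|exact: cvg_cst].
  exact: continuous_sdens.
rewrite -leNgt => ba.
rewrite (_ : box a b = set0); first by rewrite preimage_set0 measure0 integral_set0.
apply/seteqP; split => // v /(_ j) /=; rewrite in_itv/= => /andP[h1 h2].
by have := lt_trans h1 h2; rewrite ltNge ba.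
Qed.

Lemma pdens_law t x (B : set 'rV[R]_d) : 0 < t -> measurable B ->
  P ((fun w => x + Y t w) @^-1` B) = (\int[lam]_(y in B) (pdens alpha t x y)%:E)%E.
Proof.
move=> t0 mB.
have mxY : measurable_fun setT (fun w => x + Y t w).
  apply: measurable_rV => i; under eq_fun do rewrite mxE.
  by apply: measurable_funD => //; exact: mYj.
have mpre S : measurable S -> measurable ((fun w => x + Y t w) @^-1` S).
  by move=> mS; rewrite -[X in measurable X]setTI; exact: mxY.
have mp : measurable_fun setT (fun y => (pdens alpha t x y)%:E).
  by apply/measurable_EFinP; exact: measurable_pdensr.
have p0 y : (0 <= (pdens alpha t x y)%:E)%E by rewrite lee_fin pdens_ge0.
(* The total mass is not computed but read off from the boxes []-k, k[] that exhaust the space. The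
   complement step of the Dynkin induction needs it. *)
have PT : P ((fun w => x + Y t w) @^-1` setT) = (\int[lam]_y (pdens alpha t x y)%:E)%E.
  rewrite -bigcup_box.
  have h1 := @ge0_nondecreasing_set_cvg_integral _ _ _ _ (fun y => (pdens alpha t x y)%:E) lam (@nondecreasing_box R d) (fun k => measurable_box _ _) (fun k => measurable_funTS mp) (fun k y _ => p0 y).
  rewrite preimage_bigcup.
  have h2 : P ((fun w => x + Y t w) @^-1` box (fun=> - k%:R) (fun=> k%:R)) @[k --> \oo] --> P (\bigcup_k ((fun w => x + Y t w) @^-1` box (fun=> - k%:R) (fun=> k%:R))).
    apply: (@nondecreasing_cvg_mu _ _ _ P (fun k => (fun w => x + Y t w) @^-1` box (fun=> - k%:R) (fun=> k%:R))).
    - by move=> k; apply: mpre; exact: measurable_box.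
    - by apply: bigcup_measurable => k _; apply: mpre; exact: measurable_box.
    - move=> k m km; have /subsetPset kmB := @nondecreasing_box R d k m km.
      by apply/subsetPset => w; exact: kmB.
  apply: (cvg_unique _ h2) => //; apply: cvg_trans h1.
  by under eq_fun do rewrite (mbox x _ _ t0).
move: mB; rewrite measurable_box_generated.
apply: (dynkin_induction (P := fun B => P ((fun w => x + Y t w) @^-1` B) = (\int[lam]_(y in B) (pdens alpha t x y)%:E)%E)).
- exact: measurable_box_generated.
- exact: setI_closed_box.
- exact: PT.
- by move=> _ [a [b ->]]; exact: mbox.
- move=> S mS IH.
  have fS : (\int[lam]_(y in S) (pdens alpha t x y)%:E)%E \is a fin_num.
    by rewrite -IH; apply: fin_num_measure; exact: mpre.
  have := @ge0_integral_setU _ _ _ lam S (~` S) mS (measurableC mS) (fun y => (pdens alpha t x y)%:E).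
  rewrite setUv => /(_ mp (fun y _ => p0 y) _).
  rewrite -PT preimage_setT.
  have /= -> : P setT = 1%E by exact: probability_setT.
  move=> E; rewrite preimage_setC probability_setC; last exact: mpre.
  rewrite IH E; last by apply/disj_setPCl.
  by rewrite addeAC subee// add0e.
- move=> F mF tF IH; rewrite preimage_bigcup measure_bigcup//; last 2 first.
  - by move=> k _; exact: mpre.
  - by apply/trivIsetP => i j _ _ ij; rewrite -preimage_setI; move/trivIsetP : tF => /(_ i j Logic.I Logic.I ij) ->; rewrite preimage_set0.
  rewrite ge0_integral_bigcup//; last by apply: measurable_funTS.
  by under eq_eseriesl do rewrite in_setT; apply: eq_eseriesr => i _; exact: IH.
Qed.

End pdens_theory.

Lemma prod_dist_le {R : realType} n (a b : 'I_n -> R) (B e : R) :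
  1 <= B -> 0 <= e -> (forall i, `|a i| <= B) -> (forall i, `|b i| <= B) ->
  (forall i, `|a i - b i| <= B * e) ->
  `|\prod_(i < n) a i - \prod_(i < n) b i| <= n%:R * B ^+ n * e.
Proof.
move=> B1 e0; have B0 : 0 <= B by exact: le_trans B1.
elim: n a b => [a b _ _ _|n IH a b aB bB abB].
  by rewrite !big_ord0 subrr normr0 !mul0r.
rewrite !big_ord_recl.
set A := \prod_(i < n) a (lift ord0 i); set A' := \prod_(i < n) b (lift ord0 i).
have AB : `|A| <= B ^+ n.
  rewrite /A normr_prod -[X in _ ^+ X]card_ord -prodr_const.
  by apply: ler_prod => i _; rewrite normr_ge0 aB.
have -> : a ord0 * A - b ord0 * A' = (a ord0 - b ord0) * A + b ord0 * (A - A') by ring.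
apply: (le_trans (ler_normD _ _)); rewrite !normrM.
apply: (@le_trans _ _ (B * e * B ^+ n + B * (n%:R * B ^+ n * e))).
  apply: lerD; apply: ler_pM => //.
  by apply: IH => i; [exact: aB|exact: bB|exact: abB].
by rewrite -natr1 exprS le_eqVlt; apply/orP; left; apply/eqP; ring.
Qed.

(** * Bounds on the stable density in dimension d *)

Section pdens_estimates.
Context {R : realType} {d : nat} {disp : measure_display}
  {Omega : measurableType disp} (P : probability Omega R).
Local Notation lam := (@lebesgue_rV R d).
Variables (alpha : R) (Y : R -> Omega -> 'rV[R]_d).
Hypotheses (alpha_gt0 : 0 < alpha) (alpha_lt2 : alpha < 2).
Hypothesis hY : forall t, 0 < t -> stable_increment P alpha t (Y t).

Let mYj t j : 0 < t -> measurable_fun setT (fun w => Y t w ord0 j).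
Proof.
by move=> t0; have [mY _ _] := hY t0; exact: (measurableT_comp (measurable_coord j) mY).
Qed.

Let mxY t (x : 'rV[R]_d) : 0 < t -> measurable_fun setT (fun w => x + Y t w).
Proof.
move=> t0; apply: measurable_rV => i; under eq_fun do rewrite mxE.
by apply: measurable_funD => //; exact: mYj.
Qed.

Lemma pdens_bound : exists C m, 0 < C /\ forall t, 0 < t ->
  (forall x y : 'rV[R]_d, pdens alpha t x y <= C * (1 + t^-1) ^+ m) /\
  (forall x x' y : 'rV[R]_d, `|pdens alpha t x y - pdens alpha t x' y| <=
     C * (1 + t^-1) ^+ m * `|x - x'|).
Proof.
have [C [N [C0 CN]]] := sdens_bound alpha_gt0.
exists ((1 + d%:R) * (1 + 2 * C) ^+ d), (N * d)%N.
have C1 : 0 < 1 + 2 * C by rewrite ltr_pwDl// mulr_ge0.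
split=> [|t t0]; first by rewrite mulr_gt0 ?exprn_gt0// ltr_pwDl.
have [sB sL] := CN t t0.
have t1 : 0 <= t^-1 by rewrite invr_ge0 ltW.
have t1N : 1 <= (1 + t^-1) ^+ N by rewrite exprn_ege1// lerDl.
(* [B] bounds each one-dimensional factor and its Lipschitz constant; since [B >= 1], the single
   power [B^d] serves both estimates. *)
pose B := (1 + 2 * C) * (1 + t^-1) ^+ N.
have B1 : 1 <= B by rewrite /B; apply: mulr_ege1 => //; rewrite lerDl mulr_ge0.
have B0 : 0 <= B by exact: le_trans B1.
have CB : C * (1 + t^-1 ^+ N) <= B.
  have tN : t^-1 ^+ N <= (1 + t^-1) ^+ N by rewrite lerXn2r ?nnegrE ?addr_ge0// lerDr.
  apply: (@le_trans _ _ (C * (2 * (1 + t^-1) ^+ N))).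
    by rewrite ler_wpM2l// mulr_natl mulr2n lerD.
  rewrite mulrA (mulrC C) /B ler_wpM2r ?lerDr//.
  exact: le_trans t1N.
have sBB z : `|sdens alpha t z| <= B by exact: le_trans (sB z) CB.
have BE : (1 + d%:R) * (1 + 2 * C) ^+ d * (1 + t^-1) ^+ (N * d) = (1 + d%:R) * B ^+ d.
  by rewrite /B exprMn exprM mulrA.
have Bd : 0 <= B ^+ d by rewrite exprn_ge0.
split=> [x y|x x' y]; rewrite BE.
  apply: (le_trans (ler_norm _)); rewrite normr_prod.
  apply: (@le_trans _ _ (B ^+ d)); last by rewrite ler_peMl// lerDl.
  rewrite -[X in _ ^+ X]card_ord -prodr_const.
  by apply: ler_prod => i _; rewrite normr_ge0 sBB.
apply: (@le_trans _ _ (d%:R * B ^+ d * `|x - x'|)); last first.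
  by rewrite ler_wpM2r// ler_wpM2r// lerDr.
apply: prod_dist_le => // i; apply: (le_trans (sL _ _)); apply: ler_pM => //.
  by rewrite mulr_ge0// addr_ge0// exprn_ge0.
have -> : y ord0 i - x ord0 i - (y ord0 i - x' ord0 i) = - ((x - x') ord0 i).
  by rewrite !mxE; ring.
by rewrite normrN norm_coord_le.
Qed.

Lemma pdens_mass t (x : 'rV[R]_d) : 0 < t -> (\int[lam]_y (pdens alpha t x y)%:E = 1)%E.
Proof.
move=> t0; rewrite -(pdens_law alpha_gt0 hY x t0)// preimage_setT.
exact: probability_setT.
Qed.

Lemma pdens_CK s t (x y : 'rV[R]_d) : 0 < s -> 0 < t ->
  (\int[lam]_z ((pdens alpha t x z)%:E * (pdens alpha s z y)%:E) =
   (pdens alpha (s + t) x y)%:E)%E.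
Proof.
move=> s0 t0; have [mY Ec Es] := hY t0.
have := Rintegral_prod_sdens alpha_gt0 t0 (fun j => mYj j t0) Ec Es x (fun j => y ord0 j) s0.
have -> : \prod_(j < d) sdens alpha (s + t) (x ord0 j - y ord0 j) = pdens alpha (s + t) x y.
  by rewrite pdensC.
have sE w : \prod_(j < d) sdens alpha s (x ord0 j + Y t w ord0 j - y ord0 j) = pdens alpha s (x + Y t w) y.
  by rewrite pdensC; apply: eq_bigr => j _; rewrite !mxE.
under eq_Rintegral do rewrite sE.
move=> <-; have [C [m [C0 Cm]]] := pdens_bound.
have [pB _] := Cm s s0.
have mf : measurable_fun setT (fun w => pdens alpha s (x + Y t w) y).
  under eq_fun do rewrite pdensC.
  exact: (measurableT_comp (measurable_pdensr alpha_gt0 y s0) (mxY x t0)).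
rewrite /Rintegral fineK; last first.
  apply: integrable_fin_num => //; apply: (@integrable_bounded _ _ _ _ _ (C * (1 + s^-1) ^+ m)) => // w.
  by rewrite ger0_norm// (pdens_ge0 alpha_gt0 hY).
have mp : measurable_fun setT (fun z => (pdens alpha t x z)%:E).
  by apply/measurable_EFinP; exact: measurable_pdensr.
have ms : measurable_fun setT (fun z => (pdens alpha s z y)%:E).
  apply/measurable_EFinP; under eq_fun do rewrite pdensC.
  exact: measurable_pdensr.
have p0 z : (0 <= (pdens alpha t x z)%:E)%E by rewrite lee_fin (pdens_ge0 alpha_gt0 hY).
have s0' z : (0 <= (pdens alpha s z y)%:E)%E by rewrite lee_fin (pdens_ge0 alpha_gt0 hY).
have law B : measurable B -> P (setT `&` (fun w => x + Y t w) @^-1` B) = (\int[lam]_(z in B) (pdens alpha t x z)%:E)%E.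
  by move=> mB; rewrite setTI; exact: pdens_law.
have pfin z : (pdens alpha t x z)%:E \is a fin_num by [].
have E := ge0_integral_density measurableT (mxY x t0) mp p0 pfin law ms s0'.
by rewrite [RHS]E; apply: eq_integral => z _; rewrite muleC.
Qed.

Lemma measure_bigsetU_le {dT} {T : measurableType dT} (m : {measure set T -> \bar R}) (A : 'I_d -> set T) :
  (forall j, measurable (A j)) ->
  (m (\big[setU/set0]_(j < d) A j) <= \sum_(j < d) m (A j))%E.
Proof.
move=> mA; suff : measurable (\big[setU/set0]_(j < d) A j) /\ (m (\big[setU/set0]_(j < d) A j) <= \sum_(j < d) m (A j))%E by case.
elim/big_rec2 : _ => [|j x B _ [mB Bx]]; first by rewrite measure0.
split; first exact: measurableU.
by apply: (le_trans (measureU2 m (mA j) mB)); rewrite leeD2l.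
Qed.

Lemma increment_tail t (r : R) : 0 < t -> 0 < r ->
  (P [set w | (r <= `|Y t w|)%R] <= (d%:R * (34 * t * r `^ (- alpha)))%:E)%E.
Proof.
move=> t0 r0; have [mY Ec Es] := hY t0.
pose A (j : 'I_d) := [set w | (r <= `|Y t w ord0 j|)%R].
have mA j : measurable (A j).
  rewrite /A -[X in measurable X]setTI.
  rewrite (_ : [set w | _] = (fun w => `|Y t w ord0 j|) @^-1` `[r, +oo[%classic); last first.
    by apply/seteqP; split => w /=; rewrite in_itv/= andbT.
  have mn : measurable_fun setT (fun w => `|Y t w ord0 j|).
    by apply: measurableT_comp => //; exact: mYj.
  by apply: mn => //; exact: measurable_itv.
have sub : [set w | (r <= `|Y t w|)%R] `<=` \big[setU/set0]_(j < d) A j.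
  move=> w /= rY.
  have [[i j] /= h] : exists ij : 'I_1 * 'I_d, mx_norm (Y t w) = `|Y t w ij.1 ij.2|.
    apply: mx_norm_neq0; apply/eqP => h; move: rY; rewrite /Num.norm/= h leNgt.
    by rewrite r0.
  rewrite (bigD1 j)//=; left; rewrite /A/=; move: rY; rewrite /Num.norm/= h.
  by rewrite (ord1 i).
apply: (@le_trans _ _ (P (\big[setU/set0]_(j < d) A j))).
  rewrite le_measure// inE; last by apply: bigsetU_measurable.
  rewrite -[X in measurable X]setTI.
  rewrite (_ : [set w | _] = (fun w => `|Y t w|) @^-1` `[r, +oo[%classic); last first.
    by apply/seteqP; split => w /=; rewrite in_itv/= andbT.
  have mn : measurable_fun setT (fun w => `|Y t w|) by exact: (measurableT_comp measurable_norm_rV mY).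
  by apply: mn => //; exact: measurable_itv.
apply: (le_trans (measure_bigsetU_le P mA)).
apply: (@le_trans _ _ (\sum_(j < d) (34 * t * r `^ (- alpha))%:E)%E).
  apply: lee_sum => j _.
  exact: (coord_tail alpha_gt0 t0 (fun j => mYj j t0) Ec Es 0 j alpha_lt2 r0).
by rewrite sumEFin sumr_const card_ord lee_fin -[leLHS]mulr_natl.
Qed.

Lemma measurable_norm_ball (x : 'rV[R]_d) (r : R) : measurable (norm_ball x r).
Proof.
rewrite /norm_ball.
have mB : measurable_fun setT (fun y : 'rV[R]_d => y - x).
  apply: measurable_rV => i; under eq_fun do rewrite !mxE.
  by apply: measurable_funB => //; exact: measurable_coord.
rewrite -[X in measurable X]setTI.
rewrite (_ : [set y | _] = (fun y => `|y - x|) @^-1` `]-oo, r[%classic); last first.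
  by apply/seteqP; split => w /=; rewrite in_itv.
have mn : measurable_fun setT (fun y : 'rV[R]_d => `|y - x|) by exact: (measurableT_comp measurable_norm_rV mB).
by apply: mn => //; exact: measurable_itv.
Qed.

Lemma pdens_tail t (x : 'rV[R]_d) (r : R) : 0 < t -> 0 < r ->
  (\int[lam]_(y in ~` norm_ball x r) (pdens alpha t x y)%:E <=
   (d%:R * (34 * t * r `^ (- alpha)))%:E)%E.
Proof.
move=> t0 r0; rewrite -(pdens_law alpha_gt0 hY)//; last by apply: measurableC; exact: measurable_norm_ball.
apply: le_trans (increment_tail t0 r0); rewrite le_eqVlt; apply/orP; left; apply/eqP.
congr (P _); apply/seteqP; split => w; rewrite /norm_ball/= addrC addKr => h.
  by rewrite leNgt; exact/negP.
by apply/negP; rewrite -leNgt.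
Qed.

Lemma lebesgue_rV_ball (x : 'rV[R]_d) (r : R) : 0 <= r ->
  (lam (norm_ball x r) <= ((2 * r) ^+ d)%:E)%E.
Proof.
move=> r0; pose B i : set R := `](x ord0 i - r), (x ord0 i + r)[%classic.
have mB i : measurable (B i : set (measurableTypeR R)) by exact: measurable_itv.
have sub : norm_ball x r `<=` [set y | forall i, B i (y ord0 i)].
  move=> y /= yx i; rewrite /B/= in_itv/= -ltr_distl; apply: le_lt_trans yx.
  by have := norm_coord_le (y - x) i; rewrite !mxE.
have mBox : measurable [set y : 'rV[R]_d | forall i, B i (y ord0 i)].
  exact: (measurable_box (fun i => x ord0 i - r) (fun i => x ord0 i + r)).
apply: (@le_trans _ _ (lam [set y | forall i, B i (y ord0 i)])).
  by apply: le_measure; rewrite ?inE//; exact: measurable_norm_ball.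
rewrite lebesgue_rV_prod// (eq_bigr (fun=> (2 * r)%:E)); last first.
  move=> i _; rewrite lebesgue_measure_itv/= lte_fin; case: ifPn => h.
    by rewrite -EFinB; congr EFin; ring.
  have -> : r = 0 by apply/eqP; rewrite eq_le r0 andbT; lra.
  by rewrite mulr0.
by rewrite prodEFin prodr_const card_ord.
Qed.

(** Lipschitz bound on the ball of radius [2 r] about [x], whose volume is at most [(4 r)^d], and
    tails outside it. Because [|x - x'| <= r], the outside also avoids the ball of radius [r] about
    [x'], so two tails with constant 34 give 68. *)
Lemma pdens_L1_le : exists C m, 0 < C /\ forall t (x x' : 'rV[R]_d) (r : R), 0 < t -> 0 < r ->
  `|x - x'| <= r ->
  (\int[lam]_y `|pdens alpha t x y - pdens alpha t x' y|%:E <=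
   (C * ((1 + t^-1) ^+ m * r ^+ d * `|x - x'| + t * r `^ (- alpha)))%:E)%E.
Proof.
have [C [m [C0 CE]]] := pdens_bound.
exists (C * 4 ^+ d + 68 * d%:R), m; split.
  by rewrite ltr_pwDl ?mulr_ge0 ?mulr_gt0 ?exprn_gt0.
move=> t x x' r t0 r0 xx'; have [pB pL] := CE t t0.
pose N := norm_ball x (2 * r).
have mN : measurable N by exact: measurable_norm_ball.
have mp z : measurable_fun setT (pdens alpha t z : 'rV[R]_d -> R) by exact: measurable_pdensr.
have p0 (z y : 'rV[R]_d) : 0 <= pdens alpha t z y by exact: (pdens_ge0 alpha_gt0 hY).
have mD : measurable_fun setT (fun y => `|pdens alpha t x y - pdens alpha t x' y|%:E).
  by apply/measurable_EFinP; apply: measurableT_comp => //; exact: measurable_funB.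
rewrite -(setUv N) ge0_integral_setU//; last 3 first.
- exact: measurableC.
- by rewrite setUv.
- exact/disj_setPCl.
pose K := C * (1 + t^-1) ^+ m.
have K0 : 0 <= K by rewrite mulr_ge0 ?(ltW C0)// exprn_ge0// addr_ge0// invr_ge0 ltW.
have r2 : 0 <= 2 * r by rewrite mulr_ge0// ltW.
have I1 : (\int[lam]_(y in N) `|pdens alpha t x y - pdens alpha t x' y|%:E <= (K * `|x - x'| * (2 * (2 * r)) ^+ d)%:E)%E.
  apply: (@le_trans _ _ (\int[lam]_(y in N) (K * `|x - x'|)%:E)%E).
    apply: ge0_le_integral => //.
    - exact: measurable_funTS.
    - by move=> y _; rewrite lee_fin pL.
  rewrite integral_cst// [leRHS]EFinM lee_wpmul2l ?lee_fin ?(mulr_ge0 K0)//.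
  exact: lebesgue_rV_ball.
pose N' := norm_ball x' r.
have NN' : ~` N `<=` ~` N'.
  move=> y /=; apply: contra_not; rewrite /N'/N/norm_ball/= => h.
  have -> : y - x = (y - x') - (x - x') by rewrite opprB addrA subrK.
  by rewrite (le_lt_trans (ler_normB _ _))// mulr_natl mulr2n ltr_leD.
have I2 : (\int[lam]_(y in ~` N) `|pdens alpha t x y - pdens alpha t x' y|%:E <= (68 * d%:R * (t * r `^ (- alpha)))%:E)%E.
  apply: (@le_trans _ _ (\int[lam]_(y in ~` N) ((pdens alpha t x y)%:E + (pdens alpha t x' y)%:E))%E).
    apply: ge0_le_integral => //.
    - exact: measurableC.
    - exact: measurable_funTS.
    - by apply: emeasurable_funD; apply: measurable_funTS; apply/measurable_EFinP.
    - by move=> y _; rewrite -EFinD lee_fin (le_trans (ler_normB _ _))// !ger0_norm.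
  rewrite ge0_integralD//; try (by move=> y _; rewrite lee_fin); try (by apply: measurable_funTS; apply/measurable_EFinP); last exact: measurableC.
  have -> : 68 * d%:R * (t * r `^ (- alpha)) = d%:R * (34 * t * r `^ (- alpha)) + d%:R * (34 * t * r `^ (- alpha)) by ring.
  rewrite EFinD; apply: leeD.
    have r2' : 0 < 2 * r by rewrite mulr_gt0.
    apply: (le_trans (pdens_tail x t0 r2')); rewrite lee_fin ler_wpM2l// ler_wpM2l ?mulr_ge0 ?(ltW t0)//.
    rewrite !powRN lef_pV2 ?posrE ?powR_gt0// ge0_ler_powR ?nnegrE ?(ltW alpha_gt0) ?(ltW r0)//.
    by rewrite mulr_natl mulr2n lerDl ltW.
  apply: le_trans (pdens_tail x' t0 r0); apply: ge0_subset_integral => //; try (by apply: measurableC; exact: measurable_norm_ball); last by move=> y _; rewrite lee_fin.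
  by apply: measurable_funTS; apply/measurable_EFinP.
apply: (le_trans (leeD I1 I2)); rewrite -EFinD lee_fin mulrDr lerD//.
  rewrite (_ : 2 * (2 * r) = 4 * r); last by ring.
  rewrite exprMn /K (_ : _ * (4 ^+ d * r ^+ d) = C * 4 ^+ d * ((1 + t^-1) ^+ m * r ^+ d * `|x - x'|)); last by ring.
  rewrite ler_wpM2r ?lerDl ?mulr_ge0// ?exprn_ge0 ?(ltW r0)// addr_ge0// invr_ge0 ltW//.
by rewrite ler_wpM2r ?lerDr ?mulr_ge0 ?powR_ge0 ?exprn_ge0 ?(ltW t0) ?(ltW C0).
Qed.

End pdens_estimates.

(** * The Markov property *)

Section restricted_law.
Context d1 d2 (S : measurableType d1) (T : measurableType d2) (R : realType).
Variables (P : probability S R) (A : set S) (Z : S -> T).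

Definition restricted_law (mA : measurable A) of measurable_fun setT Z : set T -> \bar R :=
  pushforward (mrestr P mA) Z.

Hypotheses (mA : measurable A) (mZ : measurable_fun setT Z).

Local Notation m := (restricted_law mA mZ).

HB.instance Definition _ := Measure.copy m
  (measure_function_pushforward__canonical__measure_function_Measure (mrestr P mA) mZ).

Let restricted_law_fin : fin_num_fun m.
Proof.
move=> B mB; rewrite /restricted_law /pushforward /mrestr/=.
apply: fin_num_measure; apply: measurableI => //.
by rewrite -[X in measurable X]setTI; exact: mZ.
Qed.

HB.instance Definition _ := Measure_isFinite.Build _ _ _ m restricted_law_fin.

Lemma restricted_lawE B : m B = P (A `&` Z @^-1` B).
Proof. by rewrite /restricted_law /pushforward /mrestr setIC. Qed.

End restricted_law.

Section markov_step.
Context {R : realType} {d : nat} {disp : measure_display}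
  {Omega : measurableType disp} (P : probability Omega R).
Local Notation lam := (@lebesgue_rV R d).
Local Notation E := ('rV[R]_d).
Variables (A : set Omega) (U V : Omega -> E) (g : E -> \bar R) (p : E -> E -> R).
Hypotheses (mA : measurable A) (mU : measurable_fun setT U) (mV : measurable_fun setT V).
Hypotheses (mg : measurable_fun setT g) (g0 : forall y, (0 <= g y)%E).
Hypothesis gfin : forall y, g y \is a fin_num.
Hypothesis mp : measurable_fun setT (fun z : E * E => p z.1 z.2).
Hypothesis p0 : forall x y, 0 <= p x y.
Hypothesis lawU : forall B, measurable B ->
  P (A `&` U @^-1` B) = (\int[lam]_(y in B) g y)%E.
Hypothesis lawV : forall z B, measurable B ->
  P ((fun w => z + V w) @^-1` B) = (\int[lam]_(y in B) (p z y)%:E)%E.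
Hypothesis UV : forall B C, measurable B -> measurable C ->
  P (A `&` U @^-1` B `&` V @^-1` C) = (P (A `&` U @^-1` B) * P (V @^-1` C))%E.

(** On [A], the pair [(U, V)] has the product of the sub-probability law of [U] on [A] and the law
    of [V]: the two measures agree on rectangles by [UV]. Tonelli then integrates out the
    increment. *)
Lemma markov_step B : measurable B ->
  P (A `&` (fun w => U w + V w) @^-1` B) =
  (\int[lam]_(y in B) \int[lam]_u (g u * (p u y)%:E))%E.
Proof.
move=> mB.
have mUV : measurable_fun setT (fun w => (U w, V w)) by exact: measurable_fun_pair.
pose m1 := restricted_law P mA mU; pose m2 := restricted_law P measurableT mV.
pose m' := restricted_law P mA mUV.
have m1E C : m1 C = P (A `&` U @^-1` C) by exact: restricted_lawE.
have m2E C : m2 C = P (setT `&` V @^-1` C) by exact: restricted_lawE.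
have m'E C : m' C = P (A `&` (fun w => (U w, V w)) @^-1` C) by exact: restricted_lawE.
pose W := [set z : E * E | B (z.1 + z.2)].
have madd : measurable_fun setT (fun z : E * E => z.1 + z.2).
  apply: measurable_rV => i; under eq_fun do rewrite mxE.
  apply: measurable_funD.
    exact: (measurableT_comp (measurable_coord i) measurable_fst).
  exact: (measurableT_comp (measurable_coord i) measurable_snd).
have mW : measurable W by rewrite -[X in measurable X]setTI; exact: madd.
have prodE : (m1 \x m2)%E W = m' W.
  apply: product_measure_unique => // B1 B2 mB1 mB2.
  rewrite -[LHS]/(m' (B1 `*` B2)) -[RHS]/(m1 B1 * m2 B2)%E.
  by rewrite m1E m2E m'E setTI -UV// -setIA.
have -> : P (A `&` (fun w => U w + V w) @^-1` B) = m' W by rewrite m'E.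
rewrite -prodE /product_measure1.
have m2W u : m2 (xsection W u) = (\int[lam]_(y in B) (p u y)%:E)%E.
  rewrite m2E setTI -lawV//; congr (P _).
  by apply/seteqP; split => w; rewrite /= /xsection/= inE.
have mpB : measurable_fun setT (fun z : E * E => (p z.1 z.2 * \1_B z.2)%:E).
  apply/measurable_EFinP; apply: measurable_funM => //.
  by apply: measurableT_comp => //; exact: measurable_indic.
have pBE u : (\int[lam]_(y in B) (p u y)%:E = \int[lam]_y (p u y * \1_B y)%:E)%E.
  rewrite integral_mkcond; apply: eq_integral => y _; rewrite patchE indicE.
  by case: (_ \in _); rewrite ?mulr1 ?mulr0.
transitivity (\int[m1]_u \int[lam]_y (p u y * \1_B y)%:E)%E.
  by apply: eq_integral => u _; rewrite -pBE -m2W.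
have mI : measurable_fun setT (fun u => \int[lam]_y (p u y * \1_B y)%:E)%E.
  apply: (measurable_fun_fubini_tonelli_F (m2 := lam) _ mpB) => z.
  by rewrite lee_fin mulr_ge0// indicE.
have I0 u : (0 <= \int[lam]_y (p u y * \1_B y)%:E)%E.
  by apply: integral_ge0 => y _; rewrite lee_fin mulr_ge0// indicE.
have m1g C : measurable C -> m1 (setT `&` id @^-1` C) = (\int[lam]_(y in C) g y)%E.
  by move=> mC; rewrite m1E setTI lawU.
rewrite (ge0_integral_density measurableT (@measurable_id _ _ setT) mg g0 gfin m1g mI I0).
transitivity (\int[lam]_u \int[lam]_y ((p u y * \1_B y)%:E * g u))%E.
  apply: eq_integral => u _; rewrite ge0_integralZr//.
  - by move: mpB => /measurable_EFinP mpB; apply/measurable_EFinP; exact: (measurableT_comp mpB (measurable_fun_pair (measurable_cst u) (@measurable_id _ _ setT))).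
  - by move=> y _; rewrite lee_fin mulr_ge0// indicE.
rewrite (fubini_tonelli (m1 := lam) (m2 := lam) (fun z : E * E => (p z.1 z.2 * \1_B z.2)%:E * g z.1)%E)/=; last 2 first.
- by apply: emeasurable_funM => //; exact: measurableT_comp.
- by move=> z; rewrite mule_ge0// lee_fin mulr_ge0// indicE.
rewrite [RHS]integral_mkcond; apply: eq_integral => y _; rewrite patchE indicE.
case: (_ \in _); first by apply: eq_integral => u _; rewrite mulr1 muleC.
by rewrite integral0_eq// => u _; rewrite mulr0 mul0e.
Qed.

End markov_step.

Section independence.
Context {R : realType} {d : nat} {disp : measure_display}
  {Omega : measurableType disp} (P : probability Omega R).
Local Notation E := ('rV[R]_d).
Variables (V : Omega -> E) (S : nat -> Omega -> E) (n : nat).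
Hypotheses (mV : measurable_fun setT V) (mS : forall k, measurable_fun setT (S k)).

Definition cylinders : set (set Omega) :=
  [set A | exists C : nat -> set E, (forall k, measurable (C k)) /\
    A = \bigcap_(k in `I_n) [set w | C k (S k w)]].

Hypothesis indep : forall A B, cylinders A -> measurable B ->
  P (A `&` V @^-1` B) = (P A * P (V @^-1` B))%E.

Let mpre (Z : Omega -> E) B : measurable_fun setT Z -> measurable B -> measurable (Z @^-1` B).
Proof. by move=> mZ mB; rewrite -[X in measurable X]setTI; exact: mZ. Qed.

Lemma indep_cylinders A B : <<s cylinders >> A -> measurable B ->
  measurable A /\ P (A `&` V @^-1` B) = (P A * P (V @^-1` B))%E.
Proof.
move=> sA mB.
have mVB := mpre mV mB.
have fVB : P (V @^-1` B) \is a fin_num by exact: fin_num_measure.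
move: A sA.
apply: (@dynkin_induction _ (g_sigma_algebraType cylinders) cylinders
  (fun A => disp.-measurable A /\ P (A `&` V @^-1` B) = (P A * P (V @^-1` B))%E)).
- by [].
- move=> _ _ [C [mC ->]] [C' [mC' ->]].
  exists (fun k => C k `&` C' k); split; first by move=> k; exact: measurableI.
  by rewrite -bigcapI.
- by split => //; rewrite setTI (_ : P setT = 1%E) ?mul1e//; exact: probability_setT.
- move=> A cA; split; last exact: indep.
  have [C [mC ->]] := cA; apply: bigcap_measurableType => k _; exact: (mpre (mS k) (mC k)).
- move=> A _ [mA AE]; split; first exact: measurableC.
  rewrite setIC -setDE measureD//; last first.
    by rewrite ltey_eq fVB.
  transitivity (P (V @^-1` B) - P (A `&` V @^-1` B))%E.
    by congr (_ - P _)%E; exact: setIC.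
  rewrite AE.
  rewrite probability_setC// muleBl ?mul1e//.
- move=> F _; move: (F : nat -> set Omega) => {}F tF IH.
  have mF k : disp.-measurable (F k) by case: (IH k).
  split; first by apply: bigcup_measurable.
  rewrite setI_bigcupl measure_bigcup//; last 2 first.
  + by move=> k _; exact: measurableI.
  + apply/trivIsetP => i j _ _ ij; rewrite setIACA setIid.
    by move/trivIsetP : tF => /(_ i j Logic.I Logic.I ij) ->; rewrite set0I.
  rewrite measure_bigcup// muleC -(fineK fVB) -nneseriesZl//; apply: eq_eseriesr => i _.
  by rewrite fineK// muleC; case: (IH i).
Qed.

End independence.

Section levy_past.
Context {R : realType} {d : nat} {disp : measure_display}
  {Omega : measurableType disp} (P : probability Omega R).
Local Notation lam := (@lebesgue_rV R d).
Local Notation E := ('rV[R]_d).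
Variables (alpha : R) (X : R -> Omega -> E) (x : E).
Hypotheses (alpha_gt0 : 0 < alpha) (alpha_lt2 : alpha < 2).
Hypothesis hX : rectilinear_stable alpha P X.

Let levyX : levy_process P X. Proof. by case: hX. Qed.

Let mX t : 0 <= t -> measurable_fun setT (X t).
Proof. exact: (levy_measurable levyX). Qed.

Let measurable_sub (U V : Omega -> E) : measurable_fun setT U -> measurable_fun setT V ->
  measurable_fun setT (fun w => U w - V w).
Proof.
move=> mU mV; apply: measurable_rV => i; under eq_fun do rewrite !mxE.
apply: measurable_funB; first exact: (measurableT_comp (measurable_coord i) mU).
exact: (measurableT_comp (measurable_coord i) mV).
Qed.

(* [X] translated so as to start exactly, and not only almost surely, at [x] *)
Definition started t w : E := x + (X t w - X 0 w).

Lemma measurable_started t : 0 <= t -> measurable_fun setT (started t).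
Proof.
move=> t0; apply: measurable_rV => i; under eq_fun do rewrite mxE.
apply: measurable_funD => //.
by apply: (measurableT_comp (measurable_coord i)); apply: measurable_sub; exact: mX.
Qed.

Let mpre (Z : Omega -> E) B : measurable_fun setT Z -> measurable B -> measurable (Z @^-1` B).
Proof. by move=> mZ mB; rewrite -[X in measurable X]setTI; exact: mZ. Qed.

Lemma increment_stable t : 0 <= t -> stable_increment P alpha t (fun w => X t w - X 0 w).
Proof.
move=> t0; have [_ cf] := hX; split.
- by apply: measurable_sub; exact: mX.
- by move=> xi; have := cf t xi t0; rewrite /char_fun => -[].
- by move=> xi; have := cf t xi t0; rewrite /char_fun => -[].
Qed.

Lemma increment_law s t z B : 0 <= s -> 0 < t -> measurable B ->
  P ((fun w => z + (X (s + t) w - X s w)) @^-1` B) =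
  (\int[lam]_(y in B) (pdens alpha t z y)%:E)%E.
Proof.
move=> s0 t0 mB.
have madd : measurable_fun setT (fun u : E => z + u).
  apply: measurable_rV => i; under eq_fun do rewrite mxE.
  by apply: measurable_funD => //; exact: measurable_coord.
have mB' : measurable ((fun u : E => z + u) @^-1` B) by rewrite -[X in measurable X]setTI; exact: madd.
have := levy_stationary levyX s0 (ltW t0) mB' => /= ->.
exact: (pdens_law alpha_gt0 (Y := fun t w => X t w - X 0 w) (fun t t0 => increment_stable (ltW t0))).
Qed.

(** Events generated by finitely many increments along some partition of [[0, s]]. The partition is
    existential since [levy_process] states independence for finite sequences of times, and grid
    events involve no more than that. *)
Definition past (s : R) (A : set Omega) := exists (t : nat -> R) (n : nat),
  [/\ t 0%N = 0, (forall k, t k <= t k.+1), t n = s &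
      <<s cylinders (fun k w => X (t k.+1) w - X (t k) w) n >> A].

Let mono0 (t : nat -> R) : t 0%N = 0 -> (forall k, t k <= t k.+1) -> forall k, 0 <= t k.
Proof. by move=> t0 tk; elim => [|k IH]; [rewrite t0|exact: le_trans (tk k)]. Qed.

Let mS (t : nat -> R) : t 0%N = 0 -> (forall k, t k <= t k.+1) ->
  forall k, measurable_fun setT (fun w => X (t k.+1) w - X (t k) w).
Proof. by move=> t0 tk k; apply: measurable_sub; apply: mX; exact: mono0. Qed.

Lemma past_ge0 s A : past s A -> 0 <= s.
Proof. by move=> [t [n [t0 tk <- _]]]; exact: mono0. Qed.

Lemma pastT : past 0 setT.
Proof.
exists (fun=> 0), 0%N; split => //; apply: sub_sigma_algebra.
by exists (fun=> setT); split => //; apply/seteqP; split.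
Qed.

Let extend (t : nat -> R) n s k := if (k <= n)%N then t k else s.

Let extendP t n s : t 0%N = 0 -> (forall k, t k <= t k.+1) -> t n <= s ->
  extend t n s 0%N = 0 /\ (forall k, extend t n s k <= extend t n s k.+1).
Proof.
move=> t0 tk tns; split=> [|k]; first by rewrite /extend leq0n.
rewrite /extend; case: (leqP k n) => kn; last by rewrite leqNgt ltnW// ltnS.
case: (leqP k.+1 n) => // nk; have -> : k = n by apply/eqP; rewrite eqn_leq kn.
exact: tns.
Qed.

Lemma past_le s s' A : past s A -> s <= s' -> past s' A.
Proof.
move=> [t [n [t0 tk tn sA]]] ss'.
have ts' : t n <= s' by rewrite tn.
have [e0 ek] := extendP t0 tk ts'.
exists (extend t n s'), n.+1; split => //.
- by rewrite /extend ltnn.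
move: A sA; apply: sub_sigma_algebra2 => _ [C [mC ->]].
exists (fun k => if (k < n)%N then C k else setT); split.
  by move=> k; case: ifP.
apply/seteqP; split => w /= h k /= kn.
  case: ifPn => // kn'; rewrite /extend kn' (ltnW kn'); exact: (h k kn').
by have := h k (ltnW kn : (k < n.+1)%N); rewrite kn /extend kn (ltnW kn).
Qed.

(** [started s] is a telescoping sum of the increments of a partition that ends at [s], hence
    measurable for them; [X s] would involve [X 0] too. *)
Lemma past_event s A B : past s A -> measurable B -> past s (A `&` started s @^-1` B).
Proof.
move=> [t [n [t0 tk tn sA]]] mB; exists t, n; split => //.
set G := cylinders _ _ in sA *.
have mSk k : (k < n)%N -> measurable_fun (T := g_sigma_algebraType G) setT (fun w => X (t k.+1) w - X (t k) w).
  move=> kn _ C mC; rewrite setTI; apply: sub_sigma_algebra.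
  exists (fun j => if j == k then C else setT); split; first by move=> j; case: ifP.
  apply/seteqP; split => w /= h.
    by move=> j /= jn; case: eqP => // ->.
  by have := h k kn; rewrite eqxx.
have mst : measurable_fun (T := g_sigma_algebraType G) setT (started s).
  have sE w : started s w = x + \sum_(k < n) (X (t k.+1) w - X (t k) w).
    rewrite /started -tn -t0; congr (_ + _).
    by rewrite -(big_mkord xpredT (fun k => X (t k.+1) w - X (t k) w)) telescope_sumr.
  apply: measurable_rV => i.
  under eq_fun do rewrite sE mxE summxE.
  apply: measurable_funD => //.
  rewrite [X in measurable_fun _ X](_ : _ = fun w => \sum_(k <- enum 'I_n) (X (t k.+1) w - X (t k) w) ord0 i).
    apply: measurable_sum => k.
    exact: (measurableT_comp (measurable_coord i) (mSk k (ltn_ord k))).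
  by apply/funext => w; rewrite big_enum.
have mB' : (G.-sigma).-measurable ((started s : g_sigma_algebraType G -> E) @^-1` B).
  by rewrite -[X in measurable X]setTI; exact: mst.
exact: (@measurableI _ (g_sigma_algebraType G)).
Qed.

Lemma past_indep s A u B : past s A -> 0 <= u -> measurable B ->
  measurable A /\
  P (A `&` [set w | B (X (s + u) w - X s w)]) = (P A * P [set w | B (X u w - X 0 w)%R])%E.
Proof.
move=> [t [n [t0 tk tn sA]]] u0 mB.
have [e0 ek] : extend t n (s + u) 0%N = 0 /\ (forall k, extend t n (s + u) k <= extend t n (s + u) k.+1).
  by apply: extendP => //; rewrite tn lerDl.
set t' := extend t n (s + u) in e0 ek.
have s0 : 0 <= s by rewrite -tn; exact: mono0.
rewrite -(levy_stationary levyX s0 u0 mB).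
have t'n : t' n = s by rewrite /t' /extend leqnn.
have t'Sn : t' n.+1 = s + u by rewrite /t' /extend ltnn.
rewrite -t'Sn -t'n.
pose S k w := X (t' k.+1) w - X (t' k) w.
have cylE : cylinders (fun k w => X (t k.+1) w - X (t k) w) n = cylinders S n.
  apply/seteqP; split => A' [C [mC ->]]; exists C; split => //; apply: eq_bigcapr => k /= kn;
    by rewrite /S /t' /extend kn (ltnW kn).
rewrite cylE in sA.
apply: (indep_cylinders (V := S n) _ _ _ sA mB).
- exact: mS.
- exact: mS.
move=> _ C [D [mD ->]] mC.
have := levy_independent levyX n.+1 (t := t') (B := fun k => if (k < n)%N then D k else C).
rewrite e0 => /(_ (lexx 0) ek).
have mDC k : measurable (if (k < n)%N then D k else C) by case: ifP.
move=> /(_ mDC); rewrite big_ord_recr/= ltnn => E1.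
have := levy_independent levyX n (t := t') (B := D).
rewrite e0 => /(_ (lexx 0) ek mD) => E2.
rewrite [X in (X * _)%E]E2.
rewrite [X in (X * _)%E](eq_bigr (fun k : 'I_n => P [set w | (if (k < n)%N then D k else C) (X (t' k.+1) w - X (t' k) w)%R])); last first.
  by move=> k _; rewrite ltn_ord.
rewrite -E1; congr (P _); apply/seteqP; split => w /=.
  move=> [h1 h2] k /= kn1; case: ifPn => kn; first exact: h1.
  by have -> : k = n by apply/eqP; rewrite eqn_leq -ltnS kn1 leqNgt kn.
move=> h; split => [k /= kn|]; first by have := h k (ltnW kn : (k < n.+1)%N); rewrite kn.
by have := h n (ltnSn n); rewrite ltnn.
Qed.

End levy_past.

(** * Composition of kernels *)

Section kernels.
Local Open Scope ereal_scope.
Context {R : realType} {dT : measure_display} {T : measurableType dT}.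
Variable l : {sigma_finite_measure set T -> \bar R}.
Variable C : set T.
Hypothesis mC : measurable C.
Implicit Types a b c : T -> T -> \bar R.

Definition is_kernel a :=
  measurable_fun setT (fun z : T * T => a z.1 z.2) /\ forall x y, 0 <= a x y.

Lemma kernel_measurabler a x : is_kernel a -> measurable_fun setT (a x).
Proof.
by move=> [ma _]; exact: (measurableT_comp ma (measurable_fun_pair (measurable_cst x) (@measurable_id _ _ setT))).
Qed.

Lemma kernel_measurablel a y : is_kernel a -> measurable_fun setT (a^~ y).
Proof.
by move=> [ma _]; exact: (measurableT_comp ma (measurable_fun_pair (@measurable_id _ _ setT) (measurable_cst y))).
Qed.

(** Only the intermediate point is confined to [C]. With both ends free, reversing the arguments
    reverses the order of composition and nothing else. *)
Definition kcomp a b x y := \int[l]_z (a x z * (\1_C z)%:E * b z y).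

Let mind : measurable_fun setT (fun z => (\1_C z)%:E : \bar R).
Proof. by apply/measurable_EFinP; exact: measurable_indic. Qed.

Let ind0 (z : T) : 0 <= (\1_C z)%:E :> \bar R.
Proof. by rewrite lee_fin indicE. Qed.

Lemma kcomp_integrand_ge0 a b x y z : is_kernel a -> is_kernel b ->
  0 <= a x z * (\1_C z)%:E * b z y.
Proof. by move=> [_ a0] [_ b0]; rewrite !mule_ge0. Qed.

Lemma measurable_kcomp_integrand a b x y : is_kernel a -> is_kernel b ->
  measurable_fun setT (fun z => a x z * (\1_C z)%:E * b z y).
Proof.
move=> ka kb; apply: emeasurable_funM; last exact: kernel_measurablel.
by apply: emeasurable_funM => //; exact: kernel_measurabler.
Qed.

Let comp_fun (d1 d2 d3 : measure_display) (T1 : measurableType d1) (T2 : measurableType d2) (T3 : measurableType d3)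
  (f : T2 * T3 -> \bar R) (g : T1 -> T2) (h : T1 -> T3) :
  measurable_fun setT f -> measurable_fun setT g -> measurable_fun setT h ->
  measurable_fun setT (fun z => f (g z, h z)).
Proof. by move=> mf mg mh; exact: (measurableT_comp mf (measurable_fun_pair mg mh)). Qed.

Lemma is_kernel_kcomp a b : is_kernel a -> is_kernel b -> is_kernel (kcomp a b).
Proof.
move=> ka kb; have [ma a0] := ka; have [mb b0] := kb; split; last first.
  by move=> x y; apply: integral_ge0 => z _; exact: kcomp_integrand_ge0.
pose F (u : (T * T) * T) := a u.1.1 u.2 * (\1_C u.2)%:E * b u.2 u.1.2.
apply: (measurable_fun_fubini_tonelli_F (m2 := l) F).
  apply: emeasurable_funM; first apply: emeasurable_funM.
  - apply: (@comp_fun _ _ _ _ _ _ (fun z : T * T => a z.1 z.2) (fun u : (T * T) * T => u.1.1) snd) => //.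
    by apply: measurableT_comp.
  - exact: (measurableT_comp mind measurable_snd).
  - apply: (@comp_fun _ _ _ _ _ _ (fun z : T * T => b z.1 z.2) snd (fun u : (T * T) * T => u.1.2)) => //.
    by apply: measurableT_comp.
by move=> u; exact: kcomp_integrand_ge0.
Qed.

Lemma kcompA a b c : is_kernel a -> is_kernel b -> is_kernel c ->
  kcomp (kcomp a b) c = kcomp a (kcomp b c).
Proof.
move=> ka kb kc; have [ma a0] := ka; have [mb b0] := kb; have [mc c0] := kc.
apply/funext => x; apply/funext => y; rewrite /kcomp.
transitivity (\int[l]_z \int[l]_u (a x u * (\1_C u)%:E * b u z * ((\1_C z)%:E * c z y))).
  apply: eq_integral => z _; rewrite -muleA ge0_integralZr//.
  - exact: measurable_kcomp_integrand.
  - by move=> u _; exact: kcomp_integrand_ge0.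
  - by rewrite mule_ge0.
rewrite (fubini_tonelli (m1 := l) (m2 := l) (fun v : T * T => a x v.2 * (\1_C v.2)%:E * b v.2 v.1 * ((\1_C v.1)%:E * c v.1 y))); last 2 first.
- apply: emeasurable_funM; first apply: emeasurable_funM.
  + apply: (@measurableT_comp _ _ _ _ _ _ (fun z => a x z * (\1_C z)%:E) _ snd) => //.
    by apply: emeasurable_funM => //; exact: kernel_measurabler.
  + exact: (@comp_fun _ _ _ _ _ _ (fun z : T * T => b z.1 z.2) snd fst).
  + apply: (@measurableT_comp _ _ _ _ _ _ (fun z => (\1_C z)%:E * c z y) _ fst) => //.
    by apply: emeasurable_funM => //; exact: kernel_measurablel.
- by move=> v; rewrite !mule_ge0.
apply: eq_integral => u _; rewrite -ge0_integralZl//.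
- by apply: eq_integral => z _; rewrite !muleA.
- exact: measurable_kcomp_integrand.
- by move=> z _; exact: kcomp_integrand_ge0.
- by rewrite mule_ge0.
Qed.

Lemma kcomp_sym a b x y : kcomp a b x y = kcomp (fun u v => b v u) (fun u v => a v u) y x.
Proof. by apply: eq_integral => z _; rewrite -muleA muleC (muleC _ (b z y)) . Qed.

Lemma le_kcomp a b a' b' : is_kernel a -> is_kernel b -> is_kernel a' -> is_kernel b' ->
  (forall x y, a x y <= a' x y) -> (forall x y, b x y <= b' x y) ->
  forall x y, kcomp a b x y <= kcomp a' b' x y.
Proof.
move=> ka kb ka' kb' aa' bb' x y; have [ma a0] := ka; have [mb b0] := kb.
apply: ge0_le_integral => //.
- by move=> z _; exact: kcomp_integrand_ge0.
- exact: measurable_kcomp_integrand.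
- exact: measurable_kcomp_integrand.
- by move=> z _; rewrite lee_pmul ?mule_ge0// lee_wpmul2r.
Qed.

(** [kpow a n] has [n + 1] factors: exponent 0 is [a] itself, the identity kernel being no
    function. *)
Fixpoint kpow a n := if n is m.+1 then kcomp (kpow a m) a else a.

Lemma is_kernel_kpow a n : is_kernel a -> is_kernel (kpow a n).
Proof. by move=> ka; elim: n => //= n IH; exact: is_kernel_kcomp. Qed.

Lemma kcomp_kpow a m n : is_kernel a ->
  kcomp (kpow a m) (kpow a n) = kpow a (m + n).+1.
Proof.
move=> ka; elim: n => [|n IH]; first by rewrite addn0.
by rewrite /= -kcompA ?IH ?addnS//; exact: is_kernel_kpow.
Qed.

Lemma kpow_kcomp a n : is_kernel a -> kpow (kcomp a a) n = kpow a (n.*2).+1.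
Proof.
move=> ka; elim: n => // n IH.
transitivity (kcomp (kpow a n.*2.+1) (kpow a 1)); first by rewrite -IH.
have -> : (n.+1.*2.+1 = (n.*2.+1 + 1).+1)%N by rewrite addn1 doubleS.
exact: kcomp_kpow.
Qed.

Lemma le_kpow a b n : is_kernel a -> is_kernel b -> (forall x y, a x y <= b x y) ->
  forall x y, kpow a n x y <= kpow b n x y.
Proof.
by move=> ka kb ab; elim: n => //= n IH; apply: le_kcomp => //; exact: is_kernel_kpow.
Qed.

(** Reversing the arguments moves the last factor to the front, and [kcomp_kpow] identifies the two
    products. *)
Lemma kpow_sym a n : is_kernel a -> (forall x y, a x y = a y x) ->
  forall x y, kpow a n x y = kpow a n y x.
Proof.
move=> ka asym; elim: n => // n IH x y.
rewrite [LHS]/= kcomp_sym.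
have -> : (fun u v => a v u) = kpow a 0 by apply/funext => u; apply/funext => v; rewrite asym.
have -> : (fun u v => kpow a n v u) = kpow a n by apply/funext => u; apply/funext => v; rewrite IH.
by rewrite kcomp_kpow.
Qed.

End kernels.

(** * Kernels over dyadic grids and their limit *)

Section dyadic_kernels.
Local Open Scope ereal_scope.
Context {R : realType} {dT : measure_display} {T : measurableType dT}.
Variable l : {sigma_finite_measure set T -> \bar R}.
Variable C : set T.
Hypothesis mC : measurable C.
Variable p : R -> T -> T -> R.
Variable M : R -> R.
Hypothesis p_kernel : forall t, (0 < t)%R -> is_kernel (fun x y => (p t x y)%:E).
Hypothesis p_sym : forall t x y, p t x y = p t y x.
Hypothesis p_CK : forall s t x y, (0 < s)%R -> (0 < t)%R ->
  \int[l]_z ((p s x z)%:E * (p t z y)%:E) = (p (s + t)%R x y)%:E.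
Hypothesis p_mass : forall t x, (0 < t)%R -> \int[l]_y (p t x y)%:E = 1.
Hypothesis p_bound : forall t x y, (0 < t)%R -> (p t x y <= M t)%R.

Let pE t x y := (p t x y)%:E.

(** [2^k] steps of duration [t / 2^k], that is exponent [2^k - 1] of [kpow], with as many
    intermediate points in [C]. *)
Definition dyadic t k := kpow l C (pE (t / 2 ^+ k)) (2 ^ k).-1.

Let step_gt0 (t : R) k : (0 < t -> 0 < t / 2 ^+ k)%R.
Proof. by move=> t0; rewrite divr_gt0// exprn_gt0. Qed.

Lemma is_kernel_dyadic t k : (0 < t)%R -> is_kernel (dyadic t k).
Proof. by move=> t0; apply: is_kernel_kpow => //; exact/p_kernel/step_gt0. Qed.

Lemma dyadic_sym t k x y : (0 < t)%R -> dyadic t k x y = dyadic t k y x.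
Proof.
move=> t0; apply: kpow_sym => //; first exact/p_kernel/step_gt0.
by move=> u v; rewrite /pE p_sym.
Qed.

Let pE_ge0 t x y : (0 < t)%R -> 0 <= pE t x y.
Proof. by move=> t0; have [_] := p_kernel t0; exact. Qed.

Let pred2k k : ((2 ^ k).-1.*2.+1 = (2 ^ k.+1).-1)%N.
Proof.
have : (0 < 2 ^ k)%N by rewrite expn_gt0.
by case: (2 ^ k)%N (expnS 2 k) => // n ->; rewrite mul2n doubleS.
Qed.

(** Refining the grid halves every step and confines its midpoint to [C]; without that constraint
    the two halves would compose to the old step by Chapman-Kolmogorov. *)
Lemma dyadicS_le t k x y : (0 < t)%R -> dyadic t k.+1 x y <= dyadic t k x y.
Proof.
move=> t0; have h0 := step_gt0 k.+1 t0; have kp := p_kernel h0.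
rewrite /dyadic -pred2k -kpow_kcomp//.
apply: le_kpow => //; first exact: is_kernel_kcomp; first exact/p_kernel/step_gt0.
move=> u v.
have -> : pE (t / 2 ^+ k) u v = \int[l]_z (pE (t / 2 ^+ k.+1) u z * pE (t / 2 ^+ k.+1) z v).
  rewrite p_CK// /pE; congr (p _ _ _)%:E.
  by rewrite exprS; field; rewrite expf_neq0.
apply: ge0_le_integral => //.
- by move=> z _; exact: kcomp_integrand_ge0.
- exact: measurable_kcomp_integrand.
- by apply: emeasurable_funM; [exact: kernel_measurabler|exact: kernel_measurablel].
- move=> z _; rewrite lee_wpmul2r ?pE_ge0// -[leRHS]mule1 lee_wpmul2l ?pE_ge0//.
  by rewrite lee_fin indicE; case: (_ \in _).
Qed.

Lemma dyadic_le t k x y : (0 < t)%R -> dyadic t k x y <= pE t x y.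
Proof.
move=> t0; elim: k => [|k IH]; first by rewrite /dyadic expr0 divr1.
exact: le_trans (dyadicS_le _ _ _ t0) IH.
Qed.

Lemma dyadic_ge0 t k x y : (0 < t)%R -> 0 <= dyadic t k x y.
Proof. by move=> t0; have [_] := is_kernel_dyadic k t0; exact. Qed.

Lemma dyadic_nonincreasing t x y : (0 < t)%R -> nonincreasing_seq (fun k => dyadic t k x y).
Proof. by move=> t0; apply/nonincreasing_seqP => k; exact: dyadicS_le. Qed.

Definition killed_kernel t x y := limn (fun k => dyadic t k x y).

Lemma cvg_dyadic t x y : (0 < t)%R -> dyadic t k x y @[k --> \oo] --> killed_kernel t x y.
Proof. by move=> t0; exact/ereal_nonincreasing_is_cvgn/dyadic_nonincreasing. Qed.

Lemma killed_kernel_sym t x y : (0 < t)%R -> killed_kernel t x y = killed_kernel t y x.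
Proof. by move=> t0; rewrite /killed_kernel; under eq_fun do rewrite dyadic_sym//. Qed.

Lemma killed_kernel_ge0 t x y : (0 < t)%R -> 0 <= killed_kernel t x y.
Proof.
move=> t0; apply: lime_ge; first by apply/cvg_ex; eexists; exact: cvg_dyadic.
by apply: nearW => k; exact: dyadic_ge0.
Qed.

Lemma killed_kernel_le_dyadic t k x y : (0 < t)%R -> killed_kernel t x y <= dyadic t k x y.
Proof.
move=> t0; apply: lime_le; first by apply/cvg_ex; eexists; exact: cvg_dyadic.
by exists k => // n /= kn; exact: dyadic_nonincreasing.
Qed.

Lemma killed_kernel_le t x y : (0 < t)%R -> killed_kernel t x y <= pE t x y.
Proof.
by move=> t0; apply: le_trans (killed_kernel_le_dyadic 0 x y t0) _; exact: dyadic_le.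
Qed.

Lemma is_kernel_killed t : (0 < t)%R -> is_kernel (killed_kernel t).
Proof.
move=> t0; split; last by move=> x y; exact: killed_kernel_ge0.
apply: (emeasurable_fun_cvg (fun k (z : T * T) => dyadic t k z.1 z.2)).
  by move=> k; case: (is_kernel_dyadic k t0).
by move=> z _; exact: cvg_dyadic.
Qed.

Lemma integrable_pE t x : (0 < t)%R -> l.-integrable setT (pE t x).
Proof.
move=> t0; apply/integrableP; split; first exact/kernel_measurabler/p_kernel.
under eq_integral do rewrite gee0_abs ?pE_ge0//.
by rewrite p_mass// ltry.
Qed.

(** The sequences decrease, so an integrable majorant is required: [M t] bounds the second factor,
    and [p s x] has mass 1. *)
Lemma cvg_kcomp_dyadic s t x y : (0 < s)%R -> (0 < t)%R ->
  kcomp l C (dyadic s k) (dyadic t k) x y @[k --> \oo] -->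
  kcomp l C (killed_kernel s) (killed_kernel t) x y.
Proof.
move=> s0 t0.
have p0 u v : 0 <= pE s u v by exact: pE_ge0.
have kfin u v r : (0 < r)%R -> killed_kernel r u v \is a fin_num.
  move=> r0; rewrite ge0_fin_numE ?killed_kernel_ge0//.
  by rewrite (le_lt_trans (killed_kernel_le _ _ r0))// ltry.
have [|||||_ _ h] := @dominated_convergence _ _ _ l setT measurableT
  (fun k z => dyadic s k x z * (\1_C z)%:E * dyadic t k z y)
  (fun z => killed_kernel s x z * (\1_C z)%:E * killed_kernel t z y)
  (fun z => (M t)%:E * pE s x z).
- by move=> k; apply: measurable_kcomp_integrand => //; exact: is_kernel_dyadic.
- by apply: measurable_kcomp_integrand => //; exact: is_kernel_killed.
- apply/aeW => z _; apply: cvgeM; last exact: cvg_dyadic.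
    by rewrite mule_def_fin// ?kfin// fin_numM ?kfin.
  by apply: cvgeZr => //; exact: cvg_dyadic.
- exact/integrableZl/integrable_pE.
- apply/aeW => z k _; rewrite gee0_abs; last by apply: kcomp_integrand_ge0; exact: is_kernel_dyadic.
  rewrite muleC lee_pmul ?mule_ge0 ?dyadic_ge0 ?lee_fin ?indicE//.
  + by apply: (le_trans (dyadic_le _ _ _ t0)); rewrite lee_fin p_bound.
  + apply: le_trans (dyadic_le k x z s0); rewrite -[leRHS]mule1 lee_wpmul2l ?dyadic_ge0//.
    by rewrite lee_fin; case: (_ \in _).
exact: h.
Qed.

(** For equal durations the [k]-th grids of the two halves glue exactly into the grid of order
    [k + 1] of the whole, and the identity is algebraic. For unequal durations the grids do not
    match, and the comparison has to go through paths. *)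
Lemma kcomp_killed_half t x y : (0 < t)%R ->
  kcomp l C (killed_kernel t) (killed_kernel t) x y = killed_kernel (2 * t)%R x y.
Proof.
move=> t0; have t20 : (0 < 2 * t)%R by rewrite mulr_gt0.
have h1 := @cvg_kcomp_dyadic t t x y t0 t0.
have h2 : dyadic (2 * t) k.+1 x y @[k --> \oo] --> killed_kernel (2 * t) x y.
  by rewrite (cvg_shiftS (fun k => dyadic (2 * t) k x y)); exact: cvg_dyadic.
have E k : kcomp l C (dyadic t k) (dyadic t k) x y = dyadic (2 * t) k.+1 x y.
  have tk : (2 * t / 2 ^+ k.+1 = t / 2 ^+ k)%R.
    by rewrite exprS; field; rewrite expf_neq0.
  have nk : ((2 ^ k).-1 + (2 ^ k).-1).+1 = (2 ^ k.+1).-1 by rewrite -pred2k addnn.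
  rewrite /dyadic kcomp_kpow//; last exact/p_kernel/step_gt0.
  by rewrite nk tk.
apply: (cvg_unique _ h1) => //; rewrite /=.
by under eq_fun do rewrite E.
Qed.

End dyadic_kernels.

(** * Killing outside a closed set *)

Section past_density.
Context {R : realType} {d : nat} {disp : measure_display}
  {Omega : measurableType disp} (P : probability Omega R).
Local Notation lam := (@lebesgue_rV R d).
Local Notation E := ('rV[R]_d).
Variables (alpha : R) (X : R -> Omega -> E).
Hypotheses (alpha_gt0 : 0 < alpha).
Hypothesis hX : rectilinear_stable alpha P X.

Let hY t : 0 < t -> stable_increment P alpha t (fun w => X t w - X 0 w).
Proof. by move=> t0; apply: increment_stable; [exact: hX|exact: ltW]. Qed.

Lemma is_kernel_pdens t : 0 < t -> is_kernel (fun x y : E => (pdens alpha t x y)%:E).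
Proof.
move=> t0; split; first by apply/measurable_EFinP; exact: (measurable_pdens alpha_gt0).
by move=> x y; rewrite lee_fin (pdens_ge0 alpha_gt0 hY).
Qed.

Lemma pdens_CKE s t (x y : E) : 0 < s -> 0 < t ->
  (\int[lam]_z ((pdens alpha s x z)%:E * (pdens alpha t z y)%:E) = (pdens alpha (s + t) x y)%:E)%E.
Proof. by move=> s0 t0; rewrite addrC (pdens_CK alpha_gt0 hY). Qed.

Variables (C : set E) (x : E).
Hypothesis mC : measurable C.

Definition past_density s (A : set Omega) (g : E -> \bar R) :=
  past X s A /\ forall B, measurable B -> P (A `&` started X x s @^-1` B) = (\int[lam]_(y in B) g y)%E.

Lemma past_density0 h : 0 < h -> past_density h setT (fun y => (pdens alpha h x y)%:E).
Proof.
move=> h0; split; first by apply: past_le (pastT X) (ltW h0).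
move=> B mB; rewrite setTI -(increment_law alpha_gt0 hX x (lexx 0) h0 mB); congr (P _).
by apply/seteqP; split => w; rewrite /started/= add0r.
Qed.

Lemma past_density_step s h A g : 0 < h -> past_density s A g ->
  measurable_fun setT g -> (forall y, (0 <= g y)%E) -> (forall y, g y \is a fin_num) ->
  past_density (s + h) (A `&` started X x s @^-1` C)
    (fun y => \int[lam]_u (g u * (\1_C u)%:E * (pdens alpha h u y)%:E))%E.
Proof.
move=> h0 [pA gA] mg g0 gfin.
have s0 := past_ge0 pA.
have pAC : past X s (A `&` started X x s @^-1` C) by exact: past_event.
split; first by apply: past_le pAC _; rewrite lerDl ltW.
move=> B mB.
have mS r : 0 <= r -> measurable_fun setT (started X x r) by move=> r0; exact: (measurable_started x hX r0).
have mX r : 0 <= r -> measurable_fun setT (X r) by case: hX => -[mX _ _ _] _; exact: mX.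
have mV : measurable_fun setT (fun w => X (s + h) w - X s w).
  apply: measurable_rV => i; under eq_fun do rewrite !mxE.
  apply: measurable_funB; apply: (measurableT_comp (measurable_coord i)); apply: mX => //.
  by rewrite addr_ge0 // ltW.
have mgC : measurable_fun setT (fun u => g u * (\1_C u)%:E)%E.
  by apply: emeasurable_funM => //; apply/measurable_EFinP; exact: measurable_indic.
have gC0 u : (0 <= g u * (\1_C u)%:E)%E by rewrite mule_ge0// lee_fin indicE.
have gCfin u : (g u * (\1_C u)%:E)%E \is a fin_num by rewrite fin_numM.
have [mA0 _] := past_indep hX pAC (lexx 0) mC.
have lawU B' : measurable B' -> P (A `&` started X x s @^-1` C `&` started X x s @^-1` B') =
    (\int[lam]_(y in B') (g y * (\1_C y)%:E))%E.
  move=> mB'; rewrite -setIA -preimage_setI gA; last exact: measurableI.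
  rewrite integral_mkcond [RHS]integral_mkcond; apply: eq_integral => y _.
  rewrite !patchE indicE in_setI; case: (y \in C); case: (y \in B'); rewrite //= ?mule1 ?mule0//.
have lawV z B' : measurable B' -> P ((fun w => z + (X (s + h) w - X s w)) @^-1` B') =
    (\int[lam]_(y in B') (pdens alpha h z y)%:E)%E.
  by move=> mB'; exact: (increment_law alpha_gt0 hX z s0 h0 mB').
have UV B1 B2 : measurable B1 -> measurable B2 ->
    P (A `&` started X x s @^-1` C `&` started X x s @^-1` B1 `&` (fun w => X (s + h) w - X s w)%R @^-1` B2) =
    (P (A `&` started X x s @^-1` C `&` started X x s @^-1` B1) * P ((fun w => X (s + h) w - X s w)%R @^-1` B2))%E.
  move=> mB1 mB2.
  have [_ ->] := past_indep hX (past_event x pAC mB1) (ltW h0) mB2.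
  by case: hX => lX _; rewrite -(levy_stationary lX s0 (ltW h0) mB2).
have p0 (u y : E) : 0 <= pdens alpha h u y by exact: (pdens_ge0 alpha_gt0 hY).
have mph := @measurable_pdens R d alpha alpha_gt0 h h0.
rewrite -(markov_step mA0 (mS _ s0) mV mgC gC0 gCfin mph p0 lawU lawV UV mB).
congr (P (_ `&` _)).
suff -> : started X x (s + h) = fun w => started X x s w + (X (s + h) w - X s w) by [].
by apply/funext => w; rewrite /started -addrA; congr (_ + _); rewrite addrC subrKA.
Qed.

Let pE h (u v : E) := (pdens alpha h u v)%:E.

Lemma kcomp_pdens_le a b s t : 0 < s -> 0 < t -> is_kernel a -> is_kernel b ->
  (forall u v, (a u v <= pE s u v)%E) -> (forall u v, (b u v <= pE t u v)%E) ->
  forall u v, (kcomp lam C a b u v <= pE (s + t) u v)%E.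
Proof.
move=> s0 t0 ka kb ab bb u v.
have ks := is_kernel_pdens s0; have kt := is_kernel_pdens t0.
have := le_kcomp lam mC ka kb ks kt ab bb u v => /le_trans; apply.
rewrite -[leRHS]pdens_CKE//; apply: ge0_le_integral => //.
- by move=> z _; exact: (kcomp_integrand_ge0 C u v z ks kt).
- exact: (measurable_kcomp_integrand mC u v ks kt).
- by apply: emeasurable_funM; [exact: (kernel_measurabler u ks)|exact: (kernel_measurablel v kt)].
- have [_ s0'] := ks; have [_ t0'] := kt.
  move=> z _; have h1 := s0' u z; have h2 := t0' z v; rewrite lee_wpmul2r// -[leRHS]mule1 lee_wpmul2l//.
  by rewrite lee_fin indicE; case: (_ \in _).
Qed.

Lemma kpow_pdens_le h m u v : 0 < h -> (kpow lam C (pE h) m u v <= pE (m.+1%:R * h) u v)%E.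
Proof.
move=> h0; elim: m u v => [|m IH] u v; first by rewrite /= mul1r.
have -> : m.+2%:R * h = m.+1%:R * h + h by rewrite -(natr1 m.+1) mulrDl mul1r.
apply: (kcomp_pdens_le _ h0 _ (is_kernel_pdens h0) IH (fun u v => lexx _)).
  by rewrite mulr_gt0.
by apply: is_kernel_kpow => //; exact: is_kernel_pdens.
Qed.

(** The times are [a + h, ..., a + m h]. For [h = t / 2^k] and [m = 2^k - 1] they are the grid
    points strictly between [a] and [a + t], which matches the free ends of [kcomp]. *)
Definition grid_event a h m : set Omega :=
  \bigcap_(j in `I_m) (started X x (a + j.+1%:R * h) @^-1` C).

Lemma grid_eventS a h m :
  grid_event a h m.+1 = grid_event a h m `&` started X x (a + m.+1%:R * h) @^-1` C.
Proof.
apply/seteqP; split => w /=.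
  move=> hw; split; last exact: (hw m (ltnSn m)).
  by move=> j /= jm; exact: (hw j (ltnW jm : (j < m.+1)%N)).
move=> [hw hm] j /=; rewrite ltnS leq_eqVlt => /predU1P[-> //|]; exact: hw.
Qed.

Lemma grid_event0 a h : grid_event a h 0 = setT.
Proof. by apply/seteqP; split => // w _ j. Qed.

Let kernel_fin a t u v : is_kernel a -> (forall u v, (a u v <= pE t u v)%E) -> a u v \is a fin_num.
Proof. by move=> [_ a0] ab; rewrite ge0_fin_numE// (le_lt_trans (ab _ _))// ltry. Qed.

Lemma past_density_grid h m : 0 < h ->
  past_density (m.+1%:R * h) (grid_event 0 h m) (kpow lam C (pE h) m x).
Proof.
move=> h0; elim: m => [|m IH].
  by rewrite mul1r grid_event0; exact: past_density0.
have kp := is_kernel_pdens h0; have km := is_kernel_kpow lam mC m kp.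
have -> : m.+2%:R * h = m.+1%:R * h + h by rewrite -(natr1 m.+1) mulrDl mul1r.
rewrite grid_eventS add0r; apply: past_density_step => //.
- exact: kernel_measurabler km.
- by move=> y; case: km.
- by move=> y; apply: kernel_fin km _ => u v; exact: kpow_pdens_le.
Qed.

Lemma past_density_mixed_grid t A a h m : 0 < t -> 0 < h -> is_kernel a ->
  (forall u v, (a u v <= pE t u v)%E) -> past_density t A (a x) ->
  past_density (t + m.+1%:R * h) (A `&` started X x t @^-1` C `&` grid_event t h m)
    (kcomp lam C a (kpow lam C (pE h) m) x).
Proof.
move=> t0 h0 ka ale pA; have kp := is_kernel_pdens h0.
elim: m => [|m IH].
  rewrite mul1r grid_event0 setIT; apply: past_density_step => //.
  - exact: kernel_measurabler ka.
  - by move=> y; case: ka.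
  - by move=> y; exact: kernel_fin ka ale.
have km := is_kernel_kpow lam mC m kp.
have -> : t + m.+2%:R * h = t + m.+1%:R * h + h by rewrite -(natr1 m.+1) mulrDl mul1r addrA.
rewrite grid_eventS setIA /= -kcompA//.
have kam := is_kernel_kcomp lam mC ka km.
have mh0 : 0 < m.+1%:R * h by rewrite mulr_gt0.
apply: past_density_step => //.
- exact: kernel_measurabler kam.
- by move=> y; case: kam.
- move=> y; apply: (kernel_fin (t := t + m.+1%:R * h) _ _ kam) => u v.
  by apply: kcomp_pdens_le => // u' v'; exact: kpow_pdens_le.
Qed.

End past_density.

Lemma exists_exp2V {R : realType} (t e : R) : 0 < t -> 0 < e -> exists k, t / 2 ^+ k < e.
Proof.
move=> t0 e0; have [|k] := @ltr_add_invr R 0 (e / t); first by rewrite divr_gt0.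
rewrite add0r => ke; exists k.
rewrite mulrC -ltr_pdivlMr//; apply: le_lt_trans ke.
rewrite lef_pV2 ?posrE ?exprn_gt0//.
by rewrite -natrX ler_nat ltn_expl.
Qed.

(** If [f r] is outside the closed set [C], right-continuity keeps [f] outside on some [[r, r + e[],
    and a grid of mesh below [e] has a point there. Taking the mesh below [a + t - r] as well makes
    that point interior to the grid. *)
Lemma dyadic_grid_dense {R : realType} {d : nat} (f : R -> 'rV[R]_d) (C : set 'rV[R]_d) (a t : R) :
  closed C -> 0 < t -> (forall r, a < r -> f s @[s --> r^'+] --> f r) ->
  (forall k j, (j < (2 ^ k).-1)%N -> C (f (a + j.+1%:R * (t / 2 ^+ k)))) ->
  forall r, a < r < a + t -> C (f r).
Proof.
move=> cC t0 rc H r /andP[ar rat]; apply: contrapT => nC.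
have : \forall s \near r^'+, ~ C (f s).
  have oC : nbhs (f r) (~` C).
    by apply: open_nbhs_nbhs; split => //; exact: closed_openC.
  exact: (rc r ar _ oC).
move=> /nbhs_ballP[e /= e0 he].
have m0 : 0 < Num.min e (a + t - r) by rewrite lt_min e0 subr_gt0.
have [k] := exists_exp2V t0 m0; rewrite lt_min => /andP[hke hkt].
set h := t / 2 ^+ k in hke hkt.
have h0 : 0 < h by rewrite divr_gt0// exprn_gt0.
have ra0 : 0 <= (r - a) / h by rewrite divr_ge0 ?ltW// subr_gt0.
pose n := Num.truncn ((r - a) / h).
have /andP[n1 n2] := truncn_itv ra0.
have nr : r - a < n.+1%:R * h by rewrite -ltr_pdivrMr.
have rn : n%:R * h <= r - a by rewrite -ler_pdivlMr.
have Sn : n.+1%:R * h = n%:R * h + h by rewrite -natr1 mulrDl mul1r.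
have nk : (n < (2 ^ k).-1)%N.
  rewrite -subn1 ltn_subRL add1n -(ltr_nat R) natrX -(ltr_pM2r h0).
  have -> : 2 ^+ k * h = t by rewrite /h mulrCA mulfV ?mulr1// expf_neq0.
  by rewrite Sn; lra.
apply: (he _ _ _ (H _ _ nk)); rewrite -/h.
  by rewrite /ball/= ltr_distlC; apply/andP; split; lra.
lra.
Qed.

(** * The semigroup identity at every point *)

Section semigroup.
Context {R : realType} {dT : measure_display} {T : measurableType dT}.
Variable l : {sigma_finite_measure set T -> \bar R}.
Variable C : set T.
Hypothesis mC : measurable C.
Variable K : R -> T -> T -> \bar R.
Hypothesis K_kernel : forall t, 0 < t -> is_kernel (K t).
Hypothesis K_sym : forall t x y, 0 < t -> K t x y = K t y x.
Hypothesis K_half : forall t x y, 0 < t -> kcomp l C (K t) (K t) x y = K (2 * t) x y.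
Hypothesis K_ae : forall t s x, 0 < t -> 0 < s ->
  {ae l, forall y, kcomp l C (K t) (K s) x y = K (t + s) x y}.

Let kcomp_ae (a b b' : T -> T -> \bar R) x y : is_kernel a -> is_kernel b -> is_kernel b' ->
  {ae l, forall z, b z y = b' z y} -> kcomp l C a b x y = kcomp l C a b' x y.
Proof.
move=> ka kb kb' bb'; apply: ae_eq_integral => //.
- exact: (measurable_kcomp_integrand mC x y ka kb).
- exact: (measurable_kcomp_integrand mC x y ka kb').
by apply: filterS bb' => z -> _.
Qed.

Let kcomp_flip t s x y : 0 < t -> 0 < s -> kcomp l C (K t) (K s) x y = kcomp l C (K s) (K t) y x.
Proof.
move=> t0 s0; have flip r : 0 < r -> (fun u v => K r v u) = K r.
  by move=> r0; apply/funext => u; apply/funext => v; rewrite K_sym.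
by rewrite [LHS]kcomp_sym (flip _ t0) (flip _ s0).
Qed.

(* The identity holds for almost every [y]; to reach every [y] both sides are
   written as a composition with the kernel at the midpoint of [s] and [t]. *)
Lemma kcomp_semigroup t s x y : 0 < t -> 0 < s -> kcomp l C (K t) (K s) x y = K (t + s) x y.
Proof.
wlog st : t s x y / s <= t.
  move=> H t0 s0; have [st|/ltW ts] := leP s t; first exact: H.
  by rewrite kcomp_flip// H// addrC K_sym// addr_gt0.
move=> t0 s0.
have [->|ns] := eqVneq s t; first by rewrite K_half// mulr2n mulrDl mul1r.
have {ns}st : s < t by rewrite lt_neqAle ns.
have [u [u0 tu0 tsE suE tE]] : exists u, [/\ 0 < u, 0 < t - u, t + s = 2 * u, s + (t - u) = u & u + (t - u) = t].
  by exists ((t + s) / 2); split; first [lra|field].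
have kt := K_kernel t0; have ks := K_kernel s0; have ku := K_kernel u0; have ktu := K_kernel tu0.
have kc := is_kernel_kcomp l mC ktu ks; have kc' := is_kernel_kcomp l mC ku ktu.
have kfl : is_kernel (fun v w => kcomp l C (K u) (K (t - u)) w v).
  split; last by move=> v w; have [_ k0] := kc'; exact: k0.
  have [mk _] := kc'.
  exact: (measurableT_comp mk (measurable_fun_pair measurable_snd measurable_fst)).
(* Both [u = s + (t - u)] and [t = u + (t - u)]. The resulting identities hold for almost every
   middle point, which is all that a composition sees; associativity links the two uses. *)
rewrite tsE -K_half// (kcomp_ae _ ku ku kc); last first.
  apply: filterS (K_ae y s0 tu0) => z; rewrite suE K_sym// => <-; exact: kcomp_flip.
rewrite -kcompA// (kcomp_flip _ _ t0 s0) [RHS]kcomp_sym.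
have flip : (fun u v => K s v u) = K s by apply/funext => v; apply/funext => w; rewrite K_sym.
rewrite flip; apply: kcomp_ae => //.
by have := K_ae x u0 tu0; rewrite tE; apply: filterS => z /= ->; rewrite K_sym.
Qed.

End semigroup.

Section killed_law.
Context {R : realType} {d : nat} {disp : measure_display}
  {Omega : measurableType disp} (P : probability Omega R).
Local Notation lam := (@lebesgue_rV R d).
Local Notation E := ('rV[R]_d).
Variables (alpha : R) (X : R -> Omega -> E).
Hypotheses (alpha_gt0 : 0 < alpha).
Hypothesis hX : rectilinear_stable alpha P X.

Let hY t : 0 < t -> stable_increment P alpha t (fun w => X t w - X 0 w).
Proof. by move=> t0; apply: increment_stable; [exact: hX|exact: ltW]. Qed.

Variables (C : set E).
Hypothesis mC : measurable C.

Lemma past_measurable s A : past X s A -> measurable A.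
Proof. by move=> pA; have [] := past_indep hX pA (lexx 0) mC. Qed.

Lemma past_density_limit x s (A : nat -> set Omega) (g : nat -> E -> \bar R) (f G : E -> \bar R) :
  (forall k, past_density P X x s (A k) (g k)) -> (forall k, A k.+1 `<=` A k) ->
  (forall k, measurable_fun setT (g k)) -> measurable_fun setT f ->
  (forall k y, (0 <= g k y)%E) -> (forall k y, (g k y <= G y)%E) ->
  lam.-integrable setT G -> (forall y, g k y @[k --> \oo] --> f y) ->
  forall B, measurable B -> P (\bigcap_k A k `&` started X x s @^-1` B) = (\int[lam]_(y in B) f y)%E.
Proof.
move=> pA Adec mg mf g0 gG iG gf B mB.
have s0 : 0 <= s by have [h _] := pA 0%N; exact: past_ge0 h.
have mZ : measurable (started X x s @^-1` B).
  by rewrite -[X in measurable X]setTI; exact: (measurable_started x hX s0).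
have mA k : measurable (A k) by have [h _] := pA k; exact: past_measurable h.
have mAZ k : measurable (A k `&` started X x s @^-1` B) by exact: measurableI.
have c1 : P (A k `&` started X x s @^-1` B) @[k --> \oo] --> P (\bigcap_k (A k `&` started X x s @^-1` B)).
  apply: nonincreasing_cvg_mu => //.
  - by rewrite (le_lt_trans (probability_le1 P _))// ltry.
  - exact: bigcap_measurableType.
  - by apply/nonincreasing_seqP => k; apply/subsetPset; exact: setSI.
have c2 : (\int[lam]_(y in B) g k y)%E @[k --> \oo] --> (\int[lam]_(y in B) f y)%E.
  have [|||||_ _ h] := @dominated_convergence _ _ _ lam B mB g f G.
  - by move=> k; exact: measurable_funTS.
  - exact: measurable_funTS.
  - by apply/aeW => y _; exact: gf.
  - exact: integrableS iG.
  - by apply/aeW => y k _; rewrite gee0_abs.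
  - exact: h.
have -> : \bigcap_k A k `&` started X x s @^-1` B = \bigcap_k (A k `&` started X x s @^-1` B).
  apply/seteqP; split => w /=; first by move=> [h1 h2] k _; split => //; exact: h1.
  by move=> h; split => [k _|]; [case: (h k)|case: (h 0%N)].
apply: (cvg_unique _ c1) => //.
suff -> : (fun k => P (A k `&` started X x s @^-1` B)) = (fun k => \int[lam]_(y in B) g k y)%E by [].
by apply/funext => k; have [_ ->] := pA k.
Qed.

Definition killed_pdens t := killed_kernel lam C (pdens alpha) t.

Let pC t (x y : E) : pdens alpha t x y = pdens alpha t y x. Proof. exact: pdensC. Qed.
Let pM t (x : E) : 0 < t -> (\int[lam]_y (pdens alpha t x y)%:E = 1)%E.
Proof. exact: (pdens_mass alpha_gt0 hY). Qed.
Let pK t : 0 < t -> is_kernel (fun x y : E => (pdens alpha t x y)%:E).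
Proof. exact: (is_kernel_pdens alpha_gt0 hX). Qed.
Let pCK s t (x y : E) : 0 < s -> 0 < t ->
  (\int[lam]_z ((pdens alpha s x z)%:E * (pdens alpha t z y)%:E) = (pdens alpha (s + t) x y)%:E)%E.
Proof. exact: (pdens_CKE alpha_gt0 hX). Qed.

Let pBound : exists M : R -> R, forall r (u v : E), 0 < r -> pdens alpha r u v <= M r.
Proof.
have [M [m [_ MP]]] := @pdens_bound R d alpha alpha_gt0.
by exists (fun r => M * (1 + r^-1) ^+ m) => r u v r0; have [+ _] := MP r r0; exact.
Qed.

Lemma is_kernel_killed_pdens t : 0 < t -> is_kernel (killed_pdens t).
Proof. exact: (is_kernel_killed mC pK pCK). Qed.

Lemma killed_pdens_sym t x y : 0 < t -> killed_pdens t x y = killed_pdens t y x.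
Proof. by move=> t0; rewrite /killed_pdens (killed_kernel_sym _ mC pK pC). Qed.

Lemma killed_pdens_le t x y : 0 < t -> (killed_pdens t x y <= (pdens alpha t x y)%:E)%E.
Proof. exact: (killed_kernel_le mC pK pCK). Qed.

Lemma integrable_pdens t (x : E) : 0 < t -> lam.-integrable setT (fun y => (pdens alpha t x y)%:E).
Proof. exact: (integrable_pE pK pM). Qed.

(** Nothing is asked at the times [0] and [t]: the condition on the final position is left to the
    event on [started X x t]. *)
Definition survival x t : set Omega :=
  \bigcap_k grid_event X C x 0 (t / 2 ^+ k) (2 ^ k).-1.

Lemma grid_event_refine x a t k :
  grid_event X C x a (t / 2 ^+ k.+1) (2 ^ k.+1).-1 `<=` grid_event X C x a (t / 2 ^+ k) (2 ^ k).-1.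
Proof.
move=> w hw j /= jk.
have jk2 : (j.*2.+1 < (2 ^ k.+1).-1)%N.
  rewrite -ltnS prednK ?expn_gt0// expnS mul2n -doubleS ltn_double.
  by move: jk; rewrite -ltnS prednK ?expn_gt0.
have := hw _ jk2; rewrite /=.
have -> : (j.*2.+1.+1%:R : R) * (t / 2 ^+ k.+1) = j.+1%:R * (t / 2 ^+ k).
  rewrite -doubleS -muln2 natrM exprS; field; rewrite expf_neq0//.
by [].
Qed.

Let fullE t k : ((2 ^ k).-1.+1%:R : R) * (t / 2 ^+ k) = t.
Proof. by rewrite prednK ?expn_gt0// natrX mulrCA mulfV ?mulr1// expf_neq0. Qed.

Lemma survival_law x t B : 0 < t -> measurable B ->
  P (survival x t `&` started X x t @^-1` B) = (\int[lam]_(y in B) killed_pdens t x y)%E.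
Proof.
move=> t0; have k0 := fun k => is_kernel_dyadic lam mC pK k t0.
apply: (past_density_limit (g := fun k => dyadic lam C (pdens alpha) t k x) (G := fun y => (pdens alpha t x y)%:E)) => //.
- move=> k; have h0 : 0 < t / 2 ^+ k by rewrite divr_gt0// exprn_gt0.
  have := past_density_grid alpha_gt0 hX x mC (2 ^ k).-1 h0.
  by rewrite fullE.
- by move=> k; exact: grid_event_refine.
- by move=> k; exact: (kernel_measurabler x (k0 k)).
- exact: (kernel_measurabler x (is_kernel_killed_pdens t0)).
- by move=> k y; have [_] := k0 k; exact.
- by move=> k y; exact: (dyadic_le mC pK pCK).
- exact: integrable_pdens.
- by move=> y; exact: (cvg_dyadic mC pK pCK).
Qed.

Lemma survival_mixed_law x t s B : 0 < t -> 0 < s -> measurable B ->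
  P (\bigcap_k (grid_event X C x 0 (t / 2 ^+ k) (2 ^ k).-1 `&` started X x t @^-1` C `&`
       grid_event X C x t (s / 2 ^+ k) (2 ^ k).-1) `&` started X x (t + s) @^-1` B) =
  (\int[lam]_(y in B) kcomp lam C (killed_pdens t) (killed_pdens s) x y)%E.
Proof.
move=> t0 s0; have kt := fun k => is_kernel_dyadic lam mC pK k t0.
have ks := fun k => is_kernel_dyadic lam mC pK k s0.
have kts := fun k => is_kernel_kcomp lam mC (kt k) (ks k).
have [M pB] := pBound.
apply: (past_density_limit (g := fun k => kcomp lam C (dyadic lam C (pdens alpha) t k) (dyadic lam C (pdens alpha) s k) x)
  (G := fun y => (pdens alpha (t + s) x y)%:E)) => //.
- move=> k; have h0 (r : R) : 0 < r -> 0 < r / 2 ^+ k by move=> r0; rewrite divr_gt0// exprn_gt0.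
  have pt := past_density_grid alpha_gt0 hX x mC (2 ^ k).-1 (h0 t t0); rewrite fullE in pt.
  have dle (u v : E) : (dyadic lam C (pdens alpha) t k u v <= (pdens alpha t u v)%:E)%E by exact: (dyadic_le mC pK pCK).
  have := past_density_mixed_grid alpha_gt0 hX mC (2 ^ k).-1 t0 (h0 s s0) (kt k) dle pt.
  by rewrite fullE.
- by move=> k w [[h1 h2] h3]; split; first split => //; exact: grid_event_refine.
- by move=> k; exact: (kernel_measurabler x (kts k)).
- by apply: (kernel_measurabler x (is_kernel_kcomp _ _ _ _)) => //; exact: is_kernel_killed_pdens.
- by move=> k y; have [_] := kts k; exact.
- move=> k y; apply: (kcomp_pdens_le alpha_gt0 hX mC t0 s0 (kt k) (ks k)) => u v;
    exact: (dyadic_le mC pK pCK).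
- by apply: integrable_pdens; exact: addr_gt0.
- by move=> y; exact: (cvg_kcomp_dyadic mC pK pCK pM pB).
Qed.

Hypothesis cC : closed C.

Lemma right_continuous_started x w r : cadlag (X^~ w) -> 0 <= r ->
  started X x s w @[s --> r^'+] --> started X x r w.
Proof.
move=> cw r0; have [h _] := cw r r0.
by apply: cvgD; [exact: cvg_cst|apply: cvgB => //; exact: cvg_cst].
Qed.

Let grid_eventP x w a t : cadlag (X^~ w) -> 0 <= a -> 0 < t ->
  (forall k, grid_event X C x a (t / 2 ^+ k) (2 ^ k).-1 w) <->
  (forall r, a < r < a + t -> C (started X x r w)).
Proof.
move=> cw a0 t0; split=> H.
  apply: (dyadic_grid_dense (f := fun r => started X x r w) cC t0) => [r ar|k j jk]; last exact: (H k j jk).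
  by apply: right_continuous_started => //; exact: le_trans (ltW ar).
move=> k j /= jk; apply: H.
have h0 : 0 < t / 2 ^+ k by rewrite divr_gt0// exprn_gt0.
rewrite ltrDl mulr_gt0//= ltrD2l -[ltRHS](fullE t k) ltr_pM2r// ltr_nat.
by rewrite ltnS.
Qed.

Lemma survivalP x w t : cadlag (X^~ w) -> 0 < t ->
  survival x t w <-> forall r, 0 < r < t -> C (started X x r w).
Proof.
move=> cw t0; have [h1 h2] := grid_eventP x cw (lexx 0) t0; split=> [H r rt|H].
  by apply: h1; [move=> k; exact: (H k Logic.I)|rewrite add0r].
by move=> k _; apply: h2 => r; rewrite add0r; exact: H.
Qed.

Lemma survival_mixedP x w t s : cadlag (X^~ w) -> 0 < t -> 0 < s ->
  (\bigcap_k (grid_event X C x 0 (t / 2 ^+ k) (2 ^ k).-1 `&` started X x t @^-1` C `&`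
       grid_event X C x t (s / 2 ^+ k) (2 ^ k).-1)) w <-> survival x (t + s) w.
Proof.
move=> cw t0 s0; have ts0 : 0 < t + s by exact: addr_gt0.
have [h1 h2] := grid_eventP x cw (lexx 0) t0.
have [h3 h4] := grid_eventP x cw (ltW t0) s0.
have [h5 h6] := survivalP x cw ts0; split=> [H|/h5 H].
  apply: h6 => r /andP[r0 rts].
  have Hk k := H k Logic.I.
  have [rt|rt|->] := ltgtP r t; last by have [[]] := Hk 0%N.
    by apply: h1; [move=> k; have [[]] := Hk k|rewrite add0r r0].
  by apply: h3; [move=> k; have [[]] := Hk k|rewrite rt].
move=> k _; split; first split.
- by apply: h2 => r; rewrite add0r => /andP[r0 rt]; apply: H; rewrite r0 (lt_trans rt)// ltrDl.
- by apply: H; rewrite t0 ltrDl.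
- by apply: h4 => r /andP[rt rts]; apply: H; rewrite rts (lt_trans t0 rt).
Qed.

Lemma measurable_survival x t : 0 < t -> measurable (survival x t).
Proof.
move=> t0; apply: bigcap_measurableType => k _; apply: bigcap_measurableType => j _.
rewrite -[X in measurable X]setTI; apply: (measurable_started x hX) => //.
by rewrite add0r mulr_ge0// divr_ge0 ?exprn_ge0 ?(ltW t0).
Qed.

Lemma ae_eq_measure (A B : set Omega) : measurable A -> measurable B ->
  {ae P, forall w, A w <-> B w} -> P A = P B.
Proof.
move=> mA mB AB; rewrite -[A]setIT -[B]setIT -!integral_indic//.
apply: ae_eq_integral => //.
- by apply/measurable_EFinP; exact: measurable_indic.
- by apply/measurable_EFinP; exact: measurable_indic.
apply: filterS AB => w ABw _; congr EFin; rewrite !indicE; congr (nat_of_bool _)%:R.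
by apply/idP/idP; rewrite !inE => /ABw.
Qed.

(** Both sides are densities of the position at [t + s] on events that agree for cadlag paths: one
    uses the grids of the two durations together with the time [t], the other the grids of the total
    duration, and either means that the path is in [C] throughout the open interval. *)
Let kcomp_killed_ae x t s : 0 < t -> 0 < s ->
  {ae lam, forall y, kcomp lam C (killed_pdens t) (killed_pdens s) x y = killed_pdens (t + s) x y}.
Proof.
move=> t0 s0; have ts0 : 0 < t + s by exact: addr_gt0.
have kt := is_kernel_killed_pdens t0; have ks := is_kernel_killed_pdens s0.
have kts := is_kernel_killed_pdens ts0; have kc := is_kernel_kcomp lam mC kt ks.
have mts := kernel_measurabler x kts; have mc := kernel_measurabler x kc.
have : ae_eq lam setT (kcomp lam C (killed_pdens t) (killed_pdens s) x) (killed_pdens (t + s) x).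
  apply: integral_ae_eq => //.
    apply: le_integrable (integrable_pdens x ts0) => // y _.
    have [_ c0] := kc; rewrite gee0_abs; last exact: c0.
    apply: (@le_trans _ _ (pdens alpha (t + s) x y)%:E); last by rewrite lee_fin ler_norm.
    by apply: (kcomp_pdens_le alpha_gt0 hX mC t0 s0 kt ks) => u v; exact: killed_pdens_le.
  move=> B _ mB; rewrite -survival_mixed_law// -survival_law//.
  have mZ : measurable (started X x (t + s) @^-1` B).
    by rewrite -[X in measurable X]setTI; exact: (measurable_started x hX (ltW ts0)).
  apply: ae_eq_measure.
  - apply: measurableI => //; apply: bigcap_measurableType => k _.
    apply: measurableI; first apply: measurableI.
    + apply: bigcap_measurableType => j _; rewrite -[X in measurable X]setTI.
      by apply: (measurable_started x hX) => //; rewrite add0r mulr_ge0// divr_ge0 ?exprn_ge0 ?(ltW t0).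
    + by rewrite -[X in measurable X]setTI; exact: (measurable_started x hX (ltW t0)).
    + apply: bigcap_measurableType => j _; rewrite -[X in measurable X]setTI.
      by apply: (measurable_started x hX) => //; rewrite addr_ge0 ?(ltW t0)// mulr_ge0// divr_ge0 ?exprn_ge0 ?(ltW s0).
  - by apply: measurableI => //; exact: measurable_survival.
  case: hX => -[_ cad _ _] _; apply: filterS cad => w cw.
  have [h1 h2] := survival_mixedP x cw t0 s0.
  by split=> -[hw hB]; split => //; [exact: h1|exact: h2].
by apply: filterS => y; apply.
Qed.

Lemma kcomp_killed_pdens t s x y : 0 < t -> 0 < s ->
  kcomp lam C (killed_pdens t) (killed_pdens s) x y = killed_pdens (t + s) x y.
Proof.
have [M pB] := pBound.
apply: (kcomp_semigroup mC is_kernel_killed_pdens).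
- by move=> r u v; exact: killed_pdens_sym.
- by move=> r u v r0; exact: (kcomp_killed_half mC pK pCK pM pB).
- by move=> r s' u r0 s'0; exact: kcomp_killed_ae.
Qed.

End killed_law.

(** * First exits *)

Section first_exit.
Context {R : realType} {d : nat} {disp : measure_display}
  {Omega : measurableType disp} (P : probability Omega R).
Local Notation lam := (@lebesgue_rV R d).
Local Notation E := ('rV[R]_d).
Variables (alpha : R) (X : R -> Omega -> E).
Hypotheses (alpha_gt0 : 0 < alpha) (alpha_lt2 : alpha < 2).
Hypothesis hX : rectilinear_stable alpha P X.

Let hY t : 0 < t -> stable_increment P alpha t (fun w => X t w - X 0 w).
Proof. by move=> t0; apply: increment_stable; [exact: hX|exact: ltW]. Qed.

Let tail t r : R := d%:R * (34 * t * r `^ (- alpha)).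

Let tail_ge0 t r : 0 <= t -> 0 <= tail t r.
Proof. by move=> t0; rewrite !mulr_ge0 ?powR_ge0. Qed.

Let tail_le s t r : s <= t -> tail s r <= tail t r.
Proof. by move=> st; rewrite /tail ler_wpM2l// ler_wpM2r ?powR_ge0// ler_wpM2l. Qed.

Definition large_increment u v (r : R) := [set w : Omega | r <= `|X (u + v) w - X u w|].

Let mlarge (r : R) : measurable [set z : E | r <= `|z|].
Proof.
have -> : [set z : E | r <= `|z|] = ~` norm_ball 0 r.
  by apply/seteqP; split => z; rewrite /norm_ball/= subr0 leNgt; [move/negP|move/negP].
by apply: measurableC; exact: measurable_norm_ball.
Qed.

Let large_incrementE u v r : large_increment u v r = [set w | [set z : E | r <= `|z|] (X (u + v) w - X u w)].
Proof. by []. Qed.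

Lemma past_large_increment u v r A : past X u A -> 0 < v -> 0 < r ->
  measurable (A `&` large_increment u v r) /\
  (P (A `&` large_increment u v r) <= P A * (tail v r)%:E)%E.
Proof.
move=> pA v0 r0; have u0 := past_ge0 pA.
have [mA PE] := past_indep hX pA (ltW v0) (mlarge r).
split.
  apply: measurableI => //; rewrite large_incrementE -[X in measurable X]setTI.
  have mX s : 0 <= s -> measurable_fun setT (X s) by case: hX => -[mX _ _ _] _; exact: mX.
  have mV : measurable_fun setT (fun w => X (u + v) w - X u w).
    apply: measurable_rV => i; under eq_fun do rewrite !mxE.
    apply: measurable_funB; apply: (measurableT_comp (measurable_coord i)); apply: mX => //.
    by rewrite addr_ge0 // ltW.
  by apply: mV => //; exact: mlarge.
rewrite large_incrementE PE lee_wpmul2l ?measure_ge0//.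
exact: (increment_tail alpha_gt0 alpha_lt2 hY v0 r0).
Qed.

(** Each term is at most [e] times [P (B j)] by independence of the past, and the probabilities of
    the disjoint [B j] sum to at most 1: the number of grid times does not matter. *)
Lemma first_exit_sum (B : nat -> set Omega) (u v : nat -> R) (r e : R) : 0 < r ->
  (forall j, past X (u j) (B j)) -> trivIset setT B -> (forall j, 0 < v j) ->
  (forall j, tail (v j) r <= e) ->
  (P (\bigcup_j (B j `&` large_increment (u j) (v j) r)) <= e%:E)%E.
Proof.
move=> r0 pB tB v0 ve.
have e0 : 0 <= e by apply: le_trans (ve 0%N); rewrite tail_ge0// ltW.
have mB j : measurable (B j) by have [] := past_indep hX (pB j) (lexx 0) (mlarge r).
have mBW j := (past_large_increment (pB j) (v0 j) r0).1.
have tBW : trivIset setT (fun j => B j `&` large_increment (u j) (v j) r).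
  apply/trivIsetP => i j _ _ ij; rewrite setIACA.
  by move/trivIsetP : tB => /(_ i j Logic.I Logic.I ij) ->; rewrite set0I.
rewrite measure_bigcup//.
apply: (@le_trans _ _ (\sum_(j <oo | j \in [set: nat]) (e%:E * P (B j)))%E).
  apply: lee_nneseries => // j _; rewrite muleC.
  apply: le_trans (past_large_increment (pB j) (v0 j) r0).2 _.
  by rewrite lee_wpmul2l ?measure_ge0// lee_fin.
rewrite nneseriesZl// -[leRHS]mule1 lee_wpmul2l ?lee_fin//.
rewrite -measure_bigcup//; apply: probability_le1.
exact: bigcup_measurable.
Qed.

Variables (x : E).

Definition first_exit C h j := grid_event X C x 0 h j `&` started X x (j.+1%:R * h) @^-1` (~` C).

Lemma past_first_exit C h j : measurable C -> 0 < h -> past X (j.+1%:R * h) (first_exit C h j).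
Proof.
move=> mC h0; apply: past_event; last exact: measurableC.
by have [] := past_density_grid alpha_gt0 hX x mC j h0.
Qed.

Lemma trivIset_first_exit C h : trivIset setT (first_exit C h).
Proof.
apply/trivIsetP => i j _ _ ij.
wlog {ij}ij : i j / (i < j)%N.
  move=> H; have [|ji|e] := ltngtP i j; [exact: H| |by rewrite e eqxx in ij].
  by rewrite setIC; exact: H.
apply/seteqP; split => // w [[_ /= h1] [h2 _]].
by have := h2 i ij; rewrite /= add0r.
Qed.

Lemma ex_first_exit C h j w : ~ C (started X x (j.+1%:R * h) w) ->
  exists i, (i <= j)%N /\ first_exit C h i w.
Proof.
move=> nj.
have ex : exists i, `[< ~ C (started X x (i.+1%:R * h) w) >] by exists j; exact/asboolP.
have [i /asboolP Ci imin] := ex_minnP ex.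
exists i; split; first by apply: imin; exact/asboolP.
split => // l /= li; rewrite add0r; apply: contrapT => nl.
by have /imin := asboolT nl; rewrite leqNgt li.
Qed.

(* Ottaviani's argument: if the grid leaves the ball of radius [r] at a time
   [u < t], then one of the increments over [[u, t]] and [[0, t]] is at least
   [r / 2], and the first exit at [u] is independent of the former. *)
Lemma grid_exit_le C h m (r : R) : measurable C -> 0 < h -> 0 < r -> norm_ball x r `<=` C ->
  (P (~` grid_event X C x 0 h m) <= (2 * tail (m.+1%:R * h) (r / 2))%:E)%E.
Proof.
move=> mC h0 r0 xC; set t := m.+1%:R * h; set e := tail t (r / 2).
have t0 : 0 < t by rewrite mulr_gt0.
have r20 : 0 < r / 2 by rewrite divr_gt0.
(* From the time [(j + 1) h] of a first exit with [j < m] there remains [(m - j) h] until [t]; the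
   maximum with 1 only keeps [v j] positive for the other indices. *)
pose v j : R := (maxn (m - j) 1)%:R * h.
have v0 j : 0 < v j by rewrite mulr_gt0// ltr0n leq_max orbT.
have ve j : tail (v j) (r / 2) <= e.
  apply: tail_le; rewrite ler_pM2r// ler_nat geq_max ltnS leq0n andbT.
  by rewrite (leq_trans (leq_subr _ _)).
pose u j : R := j.+1%:R * h.
have pu j := past_first_exit j mC h0.
have h1 := first_exit_sum r20 pu (@trivIset_first_exit C h) v0 ve.
have [mT h2] := past_large_increment (pastT X) t0 r20.
rewrite !setTI in mT h2; rewrite probability_setT mul1e in h2.
have mU : measurable (\bigcup_j (first_exit C h j `&` large_increment (u j) (v j) (r / 2))).
  by apply: bigcup_measurable => j _; exact: (past_large_increment (pu j) (v0 j) r20).1.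
apply: (@le_trans _ _ (P ((\bigcup_j (first_exit C h j `&` large_increment (u j) (v j) (r / 2))) `|`
    large_increment 0 t (r / 2)))).
  apply: le_measure; rewrite ?inE.
  - apply: measurableC; apply: (past_measurable hX mC (s := t)).
    by have [] := past_density_grid alpha_gt0 hX x mC m h0.
  - exact: measurableU.
  move=> w; rewrite /grid_event /= => /existsNP[j /not_implyP[/= jm]].
  rewrite add0r => nj; have [i [ij [fg fe]]] := ex_first_exit nj.
  have im := leq_ltn_trans ij jm.
  have [|nl] := pselect (large_increment 0 t (r / 2) w); first by right.
  left; exists i => //; split => //.
  have vE : v i = (m.+1 - i.+1)%:R * h by rewrite /v subSS; congr (_%:R * h); apply/maxn_idPl; rewrite subn_gt0.
  have uvE : u i + v i = t by rewrite vE /u -mulrDl -natrD subnKC// ltnS ltnW.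
  rewrite /large_increment/= uvE.
  move/negP : nl; rewrite -ltNge add0r => nl.
  have : r <= `|started X x (u i) w - x|.
    rewrite leNgt; apply/negP => lr; apply: fe; apply: xC; exact: lr.
  rewrite /started addrC addKr => hr.
  have := ler_distD (X t w) (X (u i) w) (X 0 w).
  by rewrite (distrC (X (u i) w) (X t w)); lra.
apply: le_trans (measureU2 _ mU mT) _.
by rewrite mulr2n mulrDl mul1r EFinD; apply: leeD.
Qed.

(** The total mass is the survival probability, a decreasing limit over grids, and the bound of
    [grid_exit_le] is the same for every mesh. *)
Lemma killed_pdens_mass C t (r : R) : measurable C -> 0 < t -> 0 < r -> norm_ball x r `<=` C ->
  (1 - (2 * tail t (r / 2))%:E <= \int[lam]_y killed_pdens alpha C t x y)%E.
Proof.
move=> mC t0 r0 xC; rewrite -(survival_law alpha_gt0 hX mC x t0)// preimage_setT setIT.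
have h0 k : 0 < t / 2 ^+ k by rewrite divr_gt0// exprn_gt0.
have tE k : (2 ^ k).-1.+1%:R * (t / 2 ^+ k) = t.
  by rewrite prednK ?expn_gt0// natrX mulrCA mulfV ?mulr1// expf_neq0.
have mG k : measurable (grid_event X C x 0 (t / 2 ^+ k) (2 ^ k).-1).
  apply: (past_measurable hX mC (s := t)).
  by have [] := past_density_grid alpha_gt0 hX x mC (2 ^ k).-1 (h0 k); rewrite tE.
have cv : P (grid_event X C x 0 (t / 2 ^+ k) (2 ^ k).-1) @[k --> \oo] --> P (survival X C x t).
  apply: nonincreasing_cvg_mu => //.
  - by rewrite (le_lt_trans (probability_le1 P _))// ltry.
  - exact: bigcap_measurableType.
  - by apply/nonincreasing_seqP => k; apply/subsetPset; exact: grid_event_refine.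
rewrite -(cvg_lim _ cv)//; apply: lime_ge; first by apply/cvg_ex; eexists; exact: cv.
apply: nearW => k.
have := grid_exit_le (2 ^ k).-1 mC (h0 k) r0 xC; rewrite tE probability_setC//.
have : P (grid_event X C x 0 (t / 2 ^+ k) (2 ^ k).-1) \is a fin_num by exact: fin_num_measure.
by case: (P _) => // p _; rewrite -EFinB -EFinB !lee_fin; lra.
Qed.

(** The increment is taken over a fixed delay [v] after the first grid time outside [C]. By
    independence from that exit the probability is at most the tail at [v], whatever [C] and [h]. *)
Definition exit_jump C h v (r : R) :=
  \bigcup_j (first_exit C h j `&` large_increment (j.+1%:R * h) v r).

Lemma exit_jump_le C h v (r : R) : measurable C -> 0 < h -> 0 < v -> 0 < r ->
  measurable (exit_jump C h v r) /\ (P (exit_jump C h v r) <= (tail v r)%:E)%E.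
Proof.
move=> mC h0 v0 r0; have pu j := past_first_exit j mC h0.
split; last exact: (first_exit_sum r0 pu (@trivIset_first_exit C h) (fun=> v0)).
by apply: bigcup_measurable => j _; exact: (past_large_increment (pu j) v0 r0).1.
Qed.

Lemma measure_liminf_le (A : nat -> set Omega) (e : \bar R) :
  (forall k, measurable (A k)) -> (forall k, P (A k) <= e)%E ->
  measurable (\bigcup_m \bigcap_(k in [set k | (m <= k)%N]) A k) /\
  (P (\bigcup_m \bigcap_(k in [set k | (m <= k)%N]) A k) <= e)%E.
Proof.
move=> mA Ae; pose F m := \bigcap_(k in [set k | (m <= k)%N]) A k.
have mF m : measurable (F m) by apply: bigcap_measurableType => k _.
have mU : measurable (\bigcup_m F m) by apply: bigcup_measurable.
split => //.
have cv : P (F m) @[m --> \oo] --> P (\bigcup_m F m).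
  apply: nondecreasing_cvg_mu => //; apply/nondecreasing_seqP => m; apply/subsetPset.
  by move=> w hw k /= mk; apply: hw => /=; exact: ltnW.
rewrite -(cvg_lim _ cv)//; apply: lime_le; first by apply/cvg_ex; eexists; exact: cv.
apply: nearW => m; apply: le_trans (Ae m); apply: le_measure; rewrite ?inE//.
by move=> w; apply => /=.
Qed.

(** The bound at delay [2^(-m)] is uniform in [n] and [k], so it survives both lower limits; it
    tends to 0 with [m], so the last one is null. The order of the limits is that of the quantifiers
    in [exit_jump_path]. *)
Lemma exit_jump_null (C : nat -> set E) t (r : R) : (forall n, measurable (C n)) -> 0 < t -> 0 < r ->
  P.-negligible (\bigcup_m0 \bigcap_(m in [set m | (m0 <= m)%N])
    \bigcup_n0 \bigcap_(n in [set n | (n0 <= n)%N])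
    \bigcup_k0 \bigcap_(k in [set k | (k0 <= k)%N])
      exit_jump (C n) (t / 2 ^+ k) (2 ^+ m)^-1 r).
Proof.
move=> mC t0 r0; have h0 k : 0 < t / 2 ^+ k by rewrite divr_gt0// exprn_gt0.
have v0 m : 0 < (2 ^+ m)^-1 :> R by rewrite invr_gt0 exprn_gt0.
pose S m := \bigcup_n0 \bigcap_(n in [set n | (n0 <= n)%N])
    \bigcup_k0 \bigcap_(k in [set k | (k0 <= k)%N])
      exit_jump (C n) (t / 2 ^+ k) (2 ^+ m)^-1 r.
have [mS PS] : (forall m, measurable (S m)) /\ forall m, (P (S m) <= (tail (2 ^+ m)^-1 r)%:E)%E.
  suff H m : measurable (S m) /\ (P (S m) <= (tail (2 ^+ m)^-1 r)%:E)%E by split => m; case: (H m).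
  have HL n := @measure_liminf_le _ (tail (2 ^+ m)^-1 r)%:E (fun k => (exit_jump_le (mC n) (h0 k) (v0 m) r0).1)
    (fun k => (exit_jump_le (mC n) (h0 k) (v0 m) r0).2).
  exact: (@measure_liminf_le _ _ (fun n => (HL n).1) (fun n => (HL n).2)).
have mF m0 : measurable (\bigcap_(m in [set m | (m0 <= m)%N]) S m).
  by apply: bigcap_measurableType => m _; exact: mS.
apply: negligible_bigcup => m0; exists (\bigcap_(m in [set m | (m0 <= m)%N]) S m); split => //.
apply/eqP; rewrite eq_le measure_ge0 andbT; apply/lee_addgt0Pr => e e0; rewrite add0e.
have c0 : 0 <= d%:R * (34 * r `^ (- alpha)) by rewrite !mulr_ge0 ?powR_ge0.
have c1 : 0 < d%:R * (34 * r `^ (- alpha)) + 1 by rewrite ltr_wpDl.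
have [k ke] := @exists_exp2V R _ _ c1 e0.
apply: (@le_trans _ _ (P (S (maxn m0 k)))).
  by apply: le_measure; rewrite ?inE// => w; apply => /=; rewrite leq_maxl.
apply: le_trans (PS _) _; rewrite lee_fin; apply: ltW; apply: le_lt_trans ke.
have -> : tail (2 ^+ maxn m0 k)^-1 r = (d%:R * (34 * r `^ (- alpha))) / 2 ^+ maxn m0 k.
  by rewrite /tail; ring.
apply: ler_pM => //; first by rewrite lerDl.
by rewrite lef_pV2 ?posrE ?exprn_gt0// ler_weXn2l ?ler1n// leq_maxr.
Qed.

End first_exit.

Lemma dyadic_point {R : realType} (t a b : R) : 0 < t -> 0 <= a < b ->
  exists k0, forall k, (k0 <= k)%N -> exists j : nat, a < j.+1%:R * (t / 2 ^+ k) < b.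
Proof.
move=> t0 /andP[a0 ab]; have ba0 : 0 < b - a by rewrite subr_gt0.
have [k0 hk0] := exists_exp2V t0 ba0; exists k0 => k k0k.
have h0 : 0 < t / 2 ^+ k by rewrite divr_gt0// exprn_gt0.
have hk : t / 2 ^+ k < b - a.
  apply: le_lt_trans hk0; rewrite ler_pM2l// lef_pV2 ?posrE ?exprn_gt0//.
  by rewrite ler_weXn2l ?ler1n.
move: (t / 2 ^+ k) h0 hk => h h0 hk.
have ah0 : 0 <= a / h by rewrite divr_ge0// ltW.
have /andP[n1 n2] := truncn_itv ah0.
exists (Num.truncn (a / h)); rewrite -ltr_pdivrMr// n2/=.
move: n1; rewrite ler_pdivlMr// => n1; rewrite -natr1 mulrDl mul1r; lra.
Qed.

(** * Paths that leave every set of an exhaustion *)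

Section path.
Context {R : realType} {d : nat}.
Local Notation E := ('rV[R]_d).
Variables (f : R -> E) (D : set E) (C : nat -> set E) (t : R).
Hypotheses (t0 : 0 < t) (cf : cadlag f).
Hypothesis cC : forall n, closed (C n).
Hypothesis ndC : forall m n, (m <= n)%N -> C m `<=` C n.
Hypothesis DC : forall z, D z -> exists n, nbhs z (C n).
Hypothesis fD : forall r, 0 <= r <= t -> D (f r).
Hypothesis fC : forall n, exists r, 0 < r < t /\ ~ C n (f r).

Let near_right r (A : set E) : 0 <= r -> nbhs (f r) A ->
  exists e, 0 < e /\ forall s, r <= s < r + e -> A (f s).
Proof.
move=> r0 nA; have [h _] := cf r0.
have /nbhs_ballP[e /= e0 he] := h _ nA; exists e; split => // s /andP[rs sre].
have [->|rs'] := eqVneq s r; first exact: nbhs_singleton.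
have rls : r < s by rewrite lt_neqAle eq_sym rs'.
apply: he => //.
by rewrite /ball/= ltr_distlC; apply/andP; split; lra.
Qed.

(** Let [sg] be the supremum of the times up to which the path stays in a single [C n]. Every [C n]
    is left before [sg], so the left limit at [sg] is not in [D], while [f sg] is: there is a jump
    at [sg]. For large [n] and fine grids the first grid exit from [C n] comes just before [sg], and
    a delay [2^(-m)] carries it across the jump. *)
Lemma exit_jump_path : exists i m0, forall m, (m0 <= m)%N ->
  exists n0, forall n, (n0 <= n)%N -> exists k0, forall k, (k0 <= k)%N ->
  exists j, [/\ forall l, (l < j)%N -> C n (f (l.+1%:R * (t / 2 ^+ k))),
     ~ C n (f (j.+1%:R * (t / 2 ^+ k))) &
     i.+1%:R^-1 <= `|f (j.+1%:R * (t / 2 ^+ k) + (2 ^+ m)^-1) - f (j.+1%:R * (t / 2 ^+ k))|].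
Proof.
pose S := [set s | 0 <= s <= t /\ exists n, forall r, 0 < r < s -> C n (f r)].
have S0 : S 0.
  by split; [rewrite lexx ltW|exists 0%N => r /andP[r0 /(lt_trans r0)]; rewrite ltxx].
have hS : has_sup S by split; [exists 0|exists t => s [/andP[]]].
pose sg := sup S.
have sgt : sg <= t by apply: ge_sup; [exists 0|move=> s [/andP[]]].
have sg0 : 0 <= sg by apply: ub_le_sup => //; case: hS.
have before s : s < sg -> exists n, forall r, 0 < r < s -> C n (f r).
  move=> ssg; have sg' : 0 < sg - s by rewrite subr_gt0.
  have [s' [_ [n hn]]] := sup_adherent sg' hS; rewrite -/sg subKr => ss'.
  by exists n => r /andP[r0 rs]; apply: hn; rewrite r0 (lt_trans rs).
(* Otherwise [f sg], a point of [D], has some [C n'] as a neighbourhood, and right-continuity keeps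
   the path in the larger of the two sets beyond [sg]. This contradicts the supremum if [sg < t],
   and [fC] if [sg = t]. *)
have exitn n : exists r, 0 < r < sg /\ ~ C n (f r).
  apply: contrapT => nex.
  have H r : 0 < r < sg -> C n (f r) by move=> hr; apply: contrapT => nc; apply: nex; exists r.
  have [n' nn'] := DC (fD (introT andP (conj sg0 sgt))).
  have [e [e0 he]] := near_right sg0 nn'.
  have Hm r : 0 < r < sg + e -> C (maxn n n') (f r).
    move=> /andP[r0 re]; have [rs|sr] := ltP r sg.
      by apply: (ndC (leq_maxl n n')); apply: H; rewrite r0.
    by apply: (ndC (leq_maxr n n')); apply: he; rewrite sr.
  have [st|ts] := ltP sg t; last first.
    have [r [/andP[r0 rt] nr]] := fC (maxn n n'); apply: nr; apply: Hm.
    by rewrite r0 (lt_trans rt)// (le_lt_trans ts)// ltrDl.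
  have : S (Num.min (sg + e) t).
    split; first by rewrite le_min addr_ge0 ?(ltW e0) ?(ltW t0)//= ge_min lexx orbT.
    exists (maxn n n') => r /andP[r0]; rewrite lt_min => /andP[re _].
    by apply: Hm; rewrite r0.
  move=> /(ub_le_sup (proj2 hS)); rewrite -/sg leNgt lt_min st ltrDl e0//.
have sgp : 0 < sg by have [r [/andP[r0 rs] _]] := exitn 0%N; exact: lt_trans rs.
have [rc /(_ sgp) lc] := cf sg0.
pose ell := lim (f s @[s --> sg^'-]).
have near_left (A : set E) : nbhs ell A -> exists e, 0 < e /\ forall s, sg - e < s < sg -> A (f s).
  move=> nA; have /nbhs_ballP[e /= e0 he] := lc _ nA; exists e; split => // s /andP[rs sre].
  apply: he => //.
  by rewrite /ball/= ltr_distlC; apply/andP; split; lra.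
(* A left limit in [D] would put the path in one [C n] just before [sg]; with the set that serves
   for earlier times, a single set would serve up to [sg], against [exitn]. *)
have ellD : ~ D ell.
  move=> /DC[n nn]; have [e [e0 he]] := near_left _ nn.
  have [|n' hn'] := before (sg - e / 2); first by rewrite ltrBlDr ltrDl divr_gt0.
  have [r [/andP[r0 rs] nr]] := exitn (maxn n n'); apply: nr.
  have [rl|rl] := ltP r (sg - e / 2).
    by apply: (ndC (leq_maxr n n')); apply: hn'; rewrite r0.
  by apply: (ndC (leq_maxl n n')); apply: he; rewrite rs andbT; lra.
have neq : f sg != ell.
  by apply: contra_notN ellD => /eqP <-; apply: fD; rewrite sg0.
have g0 : 0 < `|f sg - ell| by rewrite normr_gt0 subr_eq0.
(* The jump exceeds [3 eta]; each end of the increment is within [eta] of its side of the jump, so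
   more than [eta] remains. *)
have [|i] := @ltr_add_invr R 0 (`|f sg - ell| / 3); first by rewrite divr_gt0.
rewrite add0r => hi; set eta := i.+1%:R^-1 in hi *.
have eta0 : 0 < eta by rewrite invr_gt0.
have [e1 [e10 he1]] := near_right sg0 (nbhsx_ballx (f sg) eta eta0).
have [e2 [e20 he2]] := near_left _ (nbhsx_ballx ell eta eta0).
have [m0 hm0] := exists_exp2V (ltr01 : 0 < 1 :> R) e10.
exists i, m0 => m mm0; set v := (2 ^+ m)^-1.
have v0 : 0 < v by rewrite invr_gt0 exprn_gt0.
have ve : v < e1.
  apply: le_lt_trans hm0; rewrite mul1r /v lef_pV2 ?posrE ?exprn_gt0//.
  by rewrite ler_weXn2l ?ler1n.
(* The exit [tau] will lie in [[sg - w / 2, sg[]. From [w <= e2] it is close to the left limit; from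
   [w <= v < e1] the time [tau + v] falls in []sg, sg + e1[]. *)
have mn0 : 0 < Num.min v e2 by rewrite lt_min v0.
set w := Num.min v e2 in mn0.
have wv : w <= v by rewrite ge_min lexx.
have we : w <= e2 by rewrite ge_min lexx orbT.
have [|n0 hn0] := before (sg - w / 2); first by rewrite ltrBlDr ltrDl divr_gt0.
exists n0 => n nn0.
have [r [/andP[r0 rs] nr]] := exitn n.
have oC : nbhs (f r) (~` C n).
  by apply: open_nbhs_nbhs; split => //; exact: closed_openC.
have [e3 [e30 he3]] := near_right (ltW r0) oC.
(* A grid point before [sg] at which the path is still outside the closed set [C n]; the first grid
   exit is no later. *)
have [|k0 hk0] := @dyadic_point R t r (Num.min (r + e3) sg) t0.
  by rewrite (ltW r0) lt_min ltrDl e30.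
exists k0 => k /hk0[j /andP[rj]]; rewrite lt_min => /andP[jr js].
set h := t / 2 ^+ k in rj jr js *.
have h0 : 0 < h by rewrite divr_gt0// exprn_gt0.
have nj : ~ C n (f (j.+1%:R * h)) by apply: he3; rewrite (ltW rj).
have ex : exists l, `[< ~ C n (f (l.+1%:R * h)) >] by exists j; exact/asboolP.
have [l /asboolP Cl lmin] := ex_minnP ex.
have lj : (l <= j)%N by apply: lmin; exact/asboolP.
exists l; split => //.
  move=> l' ll; apply: contrapT => nl.
  by have /lmin := asboolT nl; rewrite leqNgt ll.
set tau := l.+1%:R * h in Cl *.
have tausg : tau < sg by apply: le_lt_trans js; rewrite ler_pM2r// ler_nat ltnS.
have tau0 : 0 < tau by rewrite mulr_gt0.
have taus : sg - w / 2 <= tau.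
  by rewrite leNgt; apply/negP => tl; apply: Cl; apply: (ndC nn0); apply: hn0; rewrite tau0.
have b1 : ball (f sg) eta (f (tau + v)) by apply: he1; apply/andP; split; lra.
have b2 : ball ell eta (f tau) by apply: he2; rewrite tausg andbT; lra.
move: b1 b2; rewrite -!ball_normE/= => b1 b2.
have := ler_distD (f (tau + v)) (f sg) ell; have := ler_distD (f tau) (f (tau + v)) ell.
rewrite (distrC (f tau) ell) -/eta; move: b1 b2 hi; clearbody eta.
move: `|f sg - f (tau + v)| `|ell - f tau| `|f (tau + v) - ell| `|f (tau + v) - f tau| `|f sg - ell| => *; lra.
Qed.

End path.

(** * Killing outside an open set *)

Section kernel_subset.
Local Open Scope ereal_scope.
Context {R : realType} {dT : measure_display} {T : measurableType dT}.
Variables (l : {sigma_finite_measure set T -> \bar R}) (C C' : set T).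
Hypotheses (mC : measurable C) (mC' : measurable C') (CC' : C `<=` C').

Lemma kcomp_le_set a b a' b' : is_kernel a -> is_kernel b -> is_kernel a' -> is_kernel b' ->
  (forall x y, a x y <= a' x y) -> (forall x y, b x y <= b' x y) ->
  forall x y : T, kcomp l C a b x y <= kcomp l C' a' b' x y.
Proof.
move=> ka kb ka' kb' aa' bb' x y; have [ma a0] := ka; have [mb b0] := kb.
apply: ge0_le_integral => //.
- by move=> z _; exact: kcomp_integrand_ge0.
- exact: measurable_kcomp_integrand.
- exact: measurable_kcomp_integrand.
have CE z : (\1_C z)%:E <= (\1_C' z)%:E :> \bar R.
  rewrite lee_fin !indicE; case: (boolP (z \in C)) => // zC.
  by rewrite (mem_set (CC' (set_mem zC))).
have i0 (A : set T) z : 0 <= (\1_A z)%:E :> \bar R by rewrite lee_fin indicE.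
by move=> z _; rewrite lee_pmul// ?mule_ge0// lee_pmul.
Qed.

Lemma kpow_le_set a n : is_kernel a ->
  forall x y : T, kpow l C a n x y <= kpow l C' a n x y.
Proof.
move=> ka; elim: n => [|n IH] x y; first exact: lexx.
have k1 := is_kernel_kpow l mC n ka; have k2 := is_kernel_kpow l mC' n ka.
exact: (kcomp_le_set k1 ka k2 ka IH (fun x y => lexx _)).
Qed.

End kernel_subset.

(** The points at distance at least [1 / (n + 1)] from the complement, written without an infimum so
    that [D = setT] is no separate case. *)
Definition exhaustion {R : realType} {d : nat} (D : set 'rV[R]_d) (n : nat) : set 'rV[R]_d :=
  \bigcap_(y in ~` D) [set z | n.+1%:R^-1 <= `|z - y|].

Section exhaustion.
Context {R : realType} {d : nat}.
Local Notation E := ('rV[R]_d).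
Variable D : set E.

Lemma closed_exhaustion n : closed (exhaustion D n).
Proof.
apply: closed_bigI => y _.
have -> : [set z | n.+1%:R^-1 <= `|z - y|] = ~` ball y n.+1%:R^-1.
  by apply/seteqP; split => z; rewrite -ball_normE/= distrC leNgt => /negP.
by apply: open_closedC; apply: ball_open.
Qed.

Lemma measurable_exhaustion n : measurable (exhaustion D n).
Proof.
rewrite -[exhaustion D n]setCK; apply: measurableC; apply: open_measurable_rV.
exact/closed_openC/closed_exhaustion.
Qed.

Lemma exhaustion_le m n : (m <= n)%N -> exhaustion D m `<=` exhaustion D n.
Proof.
move=> mn z zm y yD; apply: le_trans (zm y yD).
by rewrite lef_pV2 ?posrE ?ltr0n// ler_nat.
Qed.

Lemma exhaustion_sub n : exhaustion D n `<=` D.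
Proof.
move=> z zn; apply: contrapT => zD; have := zn z zD.
by rewrite /= subrr normr0 leNgt invr_gt0 ltr0n.
Qed.

(** The distance [1 / (n + 1)] is split into two halves [1 / (2 n + 2)], the second being the
    threshold of index [2 n + 1]. *)
Lemma norm_ball_exhaustion n x : exhaustion D n x ->
  norm_ball x (n.*2.+2%:R^-1) `<=` exhaustion D n.*2.+1.
Proof.
move=> xn z; rewrite /norm_ball/= => zx y yD; have := xn y yD => /= h.
have := ler_distD z x y; rewrite (distrC x z) => tri.
have E : n.+1%:R^-1 = 2 * n.*2.+2%:R^-1 :> R.
  by rewrite -doubleS -muln2 natrM invfM mulrCA mulfV ?mulr1// pnatr_eq0.
move: h zx tri; rewrite E; move: (n.*2.+2%:R^-1) `|z - x| `|z - y| `|x - y| => *; lra.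
Qed.

Lemma exhaustion_nbhs z : open D -> D z -> exists n, nbhs z (exhaustion D n).
Proof.
move=> oD Dz; have /nbhs_ballP[e /= e0 he] := open_nbhs_nbhs (conj oD Dz).
have [|n] := @ltr_add_invr R 0 e; first by [].
rewrite add0r => ne.
exists n.*2.+1; apply/nbhs_ballP; exists n.*2.+2%:R^-1 => /=; first by rewrite invr_gt0.
move=> u; rewrite -ball_normE/= distrC => uz; apply: norm_ball_exhaustion uz => y yD /=.
rewrite leNgt; apply/negP => yn; apply: yD; apply: he; rewrite -ball_normE/=.
exact: lt_trans ne.
Qed.

Lemma exhaustion_ex z : open D -> D z -> exists n, exhaustion D n z.
Proof. by move=> oD /(exhaustion_nbhs oD)[n /nbhs_singleton ?]; exists n. Qed.

End exhaustion.

Section domain_kernel.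
Context {R : realType} {d : nat} {disp : measure_display}
  {Omega : measurableType disp} (P : probability Omega R).
Local Notation lam := (@lebesgue_rV R d).
Local Notation E := ('rV[R]_d).
Variables (alpha : R) (X : R -> Omega -> E).
Hypotheses (alpha_gt0 : 0 < alpha) (alpha_lt2 : alpha < 2).
Hypothesis hX : rectilinear_stable alpha P X.
Variable D : set E.
Hypothesis oD : open D.

Let mD : measurable D. Proof. exact: open_measurable_rV. Qed.

Let K n t := killed_pdens alpha (exhaustion D n) t.
Let mC n : measurable (exhaustion D n). Proof. exact: measurable_exhaustion. Qed.

Let kK n t : 0 < t -> is_kernel (K n t).
Proof. by move=> t0; exact: (is_kernel_killed_pdens alpha_gt0 hX (mC n) t0). Qed.

Let K0 n t x y : 0 < t -> (0 <= K n t x y)%E.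
Proof. by move=> t0; have [_] := kK n t0; exact. Qed.

Let KS t x y : 0 < t -> nondecreasing_seq (fun n => K n t x y).
Proof.
move=> t0; apply/nondecreasing_seqP => n.
have pK s : 0 < s -> is_kernel (fun x y : E => (pdens alpha s x y)%:E) by exact: (is_kernel_pdens alpha_gt0 hX).
have pCK := @pdens_CKE _ _ _ _ P alpha X alpha_gt0 hX.
have c m : dyadic lam (exhaustion D m) (pdens alpha) t k x y @[k --> \oo] --> K m t x y.
  exact: (cvg_dyadic (mC m) pK pCK).
apply: (lee_cvg_to (c n) (c n.+1)); apply: nearW => k.
have h0 : 0 < t / 2 ^+ k by rewrite divr_gt0// exprn_gt0.
exact: (kpow_le_set lam (mC n) (mC n.+1) (exhaustion_le (leqnSn n)) (2 ^ k).-1 (pK _ h0)).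
Qed.

Definition domain_kernel t x y := limn (fun n => K n t x y).

Lemma cvg_domain_kernel t x y : 0 < t -> K n t x y @[n --> \oo] --> domain_kernel t x y.
Proof. by move=> t0; exact/ereal_nondecreasing_is_cvgn/KS. Qed.

Lemma killed_le_domain_kernel n t x y : 0 < t -> (K n t x y <= domain_kernel t x y)%E.
Proof.
move=> t0; apply: lime_ge; first by apply/cvg_ex; eexists; exact: cvg_domain_kernel.
by exists n => [//|m /= nm]; exact: (KS x y t0 nm).
Qed.

Lemma is_kernel_domain t : 0 < t -> is_kernel (domain_kernel t).
Proof.
move=> t0; split.
  apply: (emeasurable_fun_cvg (fun n (z : E * E) => K n t z.1 z.2)).
    by move=> n; case: (kK n t0).
  by move=> z _; exact: cvg_domain_kernel.
by move=> x y; apply: le_trans (killed_le_domain_kernel 0 x y t0); exact: K0.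
Qed.

Lemma domain_kernel_le t x y : 0 < t -> (domain_kernel t x y <= (pdens alpha t x y)%:E)%E.
Proof.
move=> t0; apply: lime_le; first by apply/cvg_ex; eexists; exact: cvg_domain_kernel.
by apply: nearW => n; exact: (killed_pdens_le alpha_gt0 hX (mC n)).
Qed.

Lemma domain_kernel_fin t x y : 0 < t -> domain_kernel t x y \is a fin_num.
Proof.
move=> t0; have [_ k0] := is_kernel_domain t0.
by rewrite ge0_fin_numE ?k0// (le_lt_trans (domain_kernel_le _ _ t0))// ltry.
Qed.

Lemma domain_kernel_sym t x y : 0 < t -> domain_kernel t x y = domain_kernel t y x.
Proof.
move=> t0; rewrite /domain_kernel; congr (limn _); apply/funext => n.
exact: (killed_pdens_sym alpha_gt0 hX (mC n)).
Qed.

Lemma domain_kernel_mass n t x : 0 < t -> exhaustion D n x ->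
  (1 - (2 * (d%:R * (34 * t * (n.*2.+2%:R^-1 / 2) `^ (- alpha))))%:E <=
   \int[lam]_y domain_kernel t x y)%E.
Proof.
move=> t0 xn; have r0 : 0 < n.*2.+2%:R^-1 :> R by rewrite invr_gt0.
apply: le_trans (killed_pdens_mass alpha_gt0 alpha_lt2 hX (mC n.*2.+1) t0 r0 (norm_ball_exhaustion xn)) _.
have kn := kK n.*2.+1 t0; have kd := is_kernel_domain t0.
apply: ge0_le_integral => //.
- by move=> y _; exact: K0.
- exact: (kernel_measurabler x kn).
- exact: (kernel_measurabler x kd).
- by move=> y _; exact: killed_le_domain_kernel.
Qed.

Let cvg_ind z : (\1_(exhaustion D n) z)%:E @[n --> \oo] --> ((\1_D z)%:E : \bar R).
Proof.
have [Dz|nDz] := pselect (D z).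
  have [n hn] := exhaustion_ex oD Dz.
  apply: cvg_near_cst; exists n => // m /= nm.
  by rewrite !indicE !mem_set//; exact: (exhaustion_le nm hn).
apply: cvg_near_cst; apply: nearW => n; rewrite !indicE !memNset//.
by move=> /exhaustion_sub.
Qed.

(** Kernels and indicators all increase with [n], so the identities over the closed sets pass to the
    limit by monotone convergence, at every pair of points. *)
Lemma kcomp_domain_kernel t s x y : 0 < t -> 0 < s ->
  kcomp lam D (domain_kernel t) (domain_kernel s) x y = domain_kernel (t + s) x y.
Proof.
move=> t0 s0; have ts0 : 0 < t + s by exact: addr_gt0.
have [_ kt0] := is_kernel_domain t0; have [_ ks0] := is_kernel_domain s0.
pose F n z : \bar R := (K n t x z * (\1_(exhaustion D n) z)%:E * K n s z y)%E.
have F0 n z : (0 <= F n z)%E by apply: kcomp_integrand_ge0; exact: kK.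
have ndF z : {homo F^~ z : n m / (n <= m)%N >-> (n <= m)%E}.
  move=> n m nm; have i0 A : (0 <= (\1_A z)%:E :> \bar R)%E by rewrite lee_fin indicE.
  apply: lee_pmul; [by apply: mule_ge0; [exact: K0|exact: i0]|exact: K0| |exact: (KS z y s0 nm)].
  apply: lee_pmul; [exact: K0|exact: i0|exact: (KS x z t0 nm)|].
  rewrite lee_fin !indicE; case: (boolP (z \in exhaustion D n)) => // zC.
  by rewrite (mem_set (exhaustion_le nm (set_mem zC))).
have c1 : (\int[lam]_z F n z)%E @[n --> \oo] --> (\int[lam]_z limn (F^~ z))%E.
  apply: cvg_monotone_convergence => //.
    by move=> n; exact: (measurable_kcomp_integrand (mC n) x y (kK n t0) (kK n s0)).
have -> : kcomp lam D (domain_kernel t) (domain_kernel s) x y = (\int[lam]_z limn (F^~ z))%E.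
  apply: eq_integral => z _; apply/esym/cvg_lim => //.
  apply: cvgeM; last exact: cvg_domain_kernel.
    by rewrite mule_def_fin// ?fin_numM// domain_kernel_fin.
  apply: cvgeM; [|exact: cvg_domain_kernel|exact: cvg_ind].
  by rewrite mule_def_fin// domain_kernel_fin.
have c2 : K n (t + s) x y @[n --> \oo] --> domain_kernel (t + s) x y by exact: cvg_domain_kernel.
apply: (cvg_unique _ c1) => //.
suff -> : (fun n => \int[lam]_z F n z)%E = (fun n => K n (t + s) x y) by [].
apply/funext => n.
exact: (kcomp_killed_pdens alpha_gt0 hX (mC n) (@closed_exhaustion _ _ D n) x y t0 s0).
Qed.

(** To be in one set of the exhaustion on all of []0, t[] is more than to be in [D] there: the path
    might approach the boundary and jump back. For [X] the difference lies in the null set of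
    [exit_jump_null]. *)
Definition alive x t : set Omega := \bigcup_n survival X (exhaustion D n) x t.

Lemma measurable_alive x t : 0 < t -> measurable (alive x t).
Proof. by move=> t0; apply: bigcup_measurable => n _; exact: (measurable_survival hX (mC n)). Qed.

Lemma alive_law x t B : 0 < t -> measurable B ->
  P (alive x t `&` started X x t @^-1` B) = (\int[lam]_(y in B) domain_kernel t x y)%E.
Proof.
move=> t0 mB.
have mZ : measurable (started X x t @^-1` B).
  by rewrite -[X in measurable X]setTI; exact: (measurable_started x hX (ltW t0)).
have mS n := measurable_survival hX (mC n) x t0.
have c1 : P (survival X (exhaustion D n) x t `&` started X x t @^-1` B) @[n --> \oo] -->
    P (\bigcup_n (survival X (exhaustion D n) x t `&` started X x t @^-1` B)).
  apply: nondecreasing_cvg_mu.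
  - by move=> n; exact: measurableI.
  - by apply: bigcup_measurable => n _; exact: measurableI.
  - apply/nondecreasing_seqP => n; apply/subsetPset => w [hw hB]; split => // k _ j jk.
    exact: (exhaustion_le (leqnSn n) (hw k Logic.I j jk)).
rewrite /alive setI_bigcupl; apply: (cvg_unique _ c1) => //.
have -> : (fun n => P (survival X (exhaustion D n) x t `&` started X x t @^-1` B)) =
    (fun n => \int[lam]_(y in B) K n t x y)%E.
  by apply/funext => n; exact: (survival_law alpha_gt0 hX (mC n) x t0 mB).
apply: cvg_monotone_convergence => //.
- by move=> n; apply: measurable_funTS; exact: (kernel_measurabler x (kK n t0)).
- by move=> n y _; exact: K0.
- by move=> y _ n m nm; exact: (KS x y t0 nm).
Qed.

End domain_kernel.

Section integral_ae.
Import HBNNSimple.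
Local Open Scope ereal_scope.
Context d (T : measurableType d) (R : realType) (mu : {measure set T -> \bar R}).

(* [f] need not be measurable: the integral of a nonnegative function is a
   supremum over the simple functions below it *)
Lemma ge0_integral_ae_eq (f g : T -> \bar R) : (forall x, 0 <= f x) -> (forall x, 0 <= g x) ->
  measurable_fun setT g -> {ae mu, forall x, f x = g x} -> \int[mu]_x f x = \int[mu]_x g x.
Proof.
move=> f0 g0 mg fg; apply/eqP; rewrite eq_le; apply/andP; split.
  rewrite ge0_integralTE//; apply: ge_ereal_sup => _ [h /= hf <-].
  rewrite -integralT_nnsfun; apply: ae_ge0_le_integral => //.
  - by move=> x _; rewrite lee_fin.
  - by apply/measurable_EFinP.
  - by apply: filterS fg => x <- _; exact: hf.
have [N [mN N0 hN]] := fg.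
pose g' x := g x * (\1_(~` N) x)%:E.
have g'0 x : 0 <= g' x by rewrite mule_ge0// lee_fin indicE.
have mg' : measurable_fun setT g'.
  apply: emeasurable_funM => //; apply/measurable_EFinP; apply: measurable_indic.
  exact: measurableC.
have -> : \int[mu]_x g x = \int[mu]_x g' x.
  apply: ge0_ae_eq_integral => //; exists N; split => //.
  move=> x /= hx; apply: contrapT => nN; apply: hx => _.
  by rewrite /g' indicE mem_set ?mule1.
rewrite !ge0_integralTE//; apply: le_ereal_sup => _ [h /= hg <-].
exists h => // x; apply: le_trans (hg x) _.
rewrite /g' indicE; have [xN|xN] := pselect (N x).
  by rewrite memNset ?mule0//; exact.
rewrite mem_set// mule1; have [->//|nfg] := pselect (f x = g x).
by exfalso; apply: xN; exact: hN.
Qed.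

End integral_ae.

Section exit_time.
Context {R : realType} {d : nat}.
Variables (D : set 'rV[R]_d) (f : R -> 'rV[R]_d).

Lemma exit_time_gt t s : (t%:E < exit_time D f)%E -> 0 < s <= t -> D (f s).
Proof.
move=> te /andP[s0 st]; apply: contrapT => nD; move: te; rewrite ltNge => /negP; apply.
apply: (@le_trans _ _ s%:E); last by rewrite lee_fin.
by apply: ereal_inf_lbound; exists s.
Qed.

Lemma lt_exit_time t e : 0 < e -> (forall s, 0 < s < t + e -> D (f s)) -> (t%:E < exit_time D f)%E.
Proof.
move=> e0 H; apply: (@lt_le_trans _ _ (t + e)%:E); first by rewrite lte_fin ltrDl.
apply: le_ereal_inf_tmp => _ [s [s0 nD] <-]; rewrite lee_fin leNgt; apply/negP => st.
by apply: nD; apply: H; rewrite s0.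
Qed.

End exit_time.

(** * Expectations of the killed process *)

Section killed_expectation.
Context {R : realType} {d : nat} {disp : measure_display}
  {Omega : measurableType disp} (P : probability Omega R).
Local Notation lam := (@lebesgue_rV R d).
Local Notation E := ('rV[R]_d).
Variables (alpha : R) (X : R -> Omega -> E).
Hypotheses (alpha_gt0 : 0 < alpha) (alpha_lt2 : alpha < 2).
Hypothesis hX : rectilinear_stable alpha P X.
Variables (D : set E) (x : E) (t : R).
Hypotheses (oD : open D) (Dx : D x) (t0 : 0 < t).
Hypothesis X0 : {ae P, forall w, X 0 w = x}.

(** The exit time is an infimum, so the strict inequality requires the path to be in [D] a little
    beyond [t]; openness of [D] and right-continuity at [t] provide this. *)
Let exit_time_alive w : cadlag (X^~ w) -> X 0 w = x -> D (X t w) -> alive X D x t w ->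
  (t%:E < exit_time D (X^~ w))%E.
Proof.
move=> cw Xx DX [n _ sn].
have sE r : started X x r w = X r w by rewrite /started Xx subrKC.
have H := (survivalP (@closed_exhaustion _ _ D n) x cw t0).1 sn.
have [rc _] := cw t (ltW t0).
have /nbhs_ballP[e /= e0 he] := rc _ (open_nbhs_nbhs (conj oD DX)).
apply: (lt_exit_time e0) => s /andP[s0 ste].
have [st|ts|->//] := ltgtP s t.
  by rewrite -sE; apply: (@exhaustion_sub _ _ D n); apply: H; rewrite s0.
by apply: he => //; rewrite /ball/= ltr_distlC; apply/andP; split; lra.
Qed.

Let alive_exit_time w : cadlag (X^~ w) -> X 0 w = x ->
  ~ (\bigcup_i \bigcup_m0 \bigcap_(m in [set m | (m0 <= m)%N])
    \bigcup_n0 \bigcap_(n in [set n | (n0 <= n)%N])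
    \bigcup_k0 \bigcap_(k in [set k | (k0 <= k)%N])
      exit_jump X x (exhaustion D n) (t / 2 ^+ k) (2 ^+ m)^-1 i.+1%:R^-1) w ->
  (t%:E < exit_time D (X^~ w))%E -> alive X D x t w.
Proof.
move=> cw Xx nN te; apply: contrapT => na; apply: nN.
have sE r : started X x r w = X r w by rewrite /started Xx subrKC.
(* The exit time looks at positive times only; time 0 is covered by the starting point in [D]. *)
have fD r : 0 <= r <= t -> D (X r w).
  rewrite le_eqVlt => /andP[/predU1P[<- _|r0 rt]]; first by rewrite Xx.
  by apply: (exit_time_gt te); rewrite r0.
have fC n : exists r, 0 < r < t /\ ~ exhaustion D n (X r w).
  apply: contrapT => nex; apply: na; exists n => //.
  apply: (survivalP (@closed_exhaustion _ _ D n) x cw t0).2 => r rt; rewrite sE.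
  by apply: contrapT => nc; apply: nex; exists r.
have [i [m0 h]] := exit_jump_path t0 cw (@closed_exhaustion _ _ D) (@exhaustion_le _ _ D)
  (fun z => exhaustion_nbhs oD) fD fC.
exists i => //; exists m0 => // m /= /h[n0 {}h]; exists n0 => // n /= /h[k0 {}h].
exists k0 => // k /= /h[j [h1 h2 h3]]; exists j => //; split; last exact: h3.
split; last by rewrite /= sE.
by move=> l /= lj; rewrite /= add0r sE; exact: h1.
Qed.

Lemma killed_expectation (phi : E -> R) : measurable_fun D phi -> (forall y, D y -> 0 <= phi y) ->
  ('E_P[fun w => extend0 phi (killed D (X^~ w) t)] =
   \int[lam]_(y in D) (fine (domain_kernel alpha D t x y) * phi y)%:E)%E.
Proof.
move=> mphi phi0.
have mD : measurable D by exact: open_measurable_rV.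
have k0 := is_kernel_domain alpha_gt0 hX D t0.
have kfin y := domain_kernel_fin alpha_gt0 hX D x y t0.
pose psi y := ((phi \_ D) y)%:E.
have psi0 y : (0 <= psi y)%E.
  by rewrite lee_fin patchE; case: (boolP (y \in D)) => // /set_mem; exact: phi0.
have mpsi : measurable_fun setT psi by apply/measurable_EFinP; exact: (measurable_restrictT phi mD).1 mphi.
have mA := measurable_alive hX D x t0.
have mZ := measurable_started x hX (ltW t0).
have mpsiZ : measurable_fun setT (fun w => psi (started X x t w)) by exact: (measurableT_comp mpsi mZ).
rewrite unlock.
(* [psi] vanishes off [D], which restores the condition on the position at [t] that [alive] leaves
   open. *)
transitivity (\int[P]_(w in alive X D x t) psi (started X x t w))%E.
  rewrite [RHS]integral_mkcond; apply: ge0_integral_ae_eq.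
  - move=> w; rewrite lee_fin /killed; case: ifPn => // te /=.
    by apply: phi0; apply: (exit_time_gt te); rewrite t0 lexx.
  - by move=> w; rewrite patchE; case: ifP.
  - by apply/(measurable_restrictT _ mA); exact: measurable_funTS.
  have [N [mN N0 hN]] : P.-negligible (\bigcup_i \bigcup_m0 \bigcap_(m in [set m | (m0 <= m)%N])
    \bigcup_n0 \bigcap_(n in [set n | (n0 <= n)%N])
    \bigcup_k0 \bigcap_(k in [set k | (k0 <= k)%N])
      exit_jump X x (exhaustion D n) (t / 2 ^+ k) (2 ^+ m)^-1 i.+1%:R^-1).
    apply: negligible_bigcup => i; apply: (exit_jump_null alpha_gt0 alpha_lt2 hX) => //.
    by move=> n; exact: measurable_exhaustion.
  have aN : {ae P, forall w, ~ N w}.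
    by exists N; split => // w /=; exact: contrapT.
  case: (hX) => -[_ cad _ _] _.
  apply: filterS3 aN cad X0 => w nN cw Xx.
  have sE : started X x t w = X t w by rewrite /started Xx subrKC.
  rewrite patchE /killed; case: ifPn => te /=.
    have Dt : D (X t w) by apply: (exit_time_gt te); rewrite t0 lexx.
    have al : alive X D x t w by apply: alive_exit_time => //; move=> /hN.
    by rewrite mem_set// /psi sE patchE mem_set.
  case: ifPn => // /set_mem al; rewrite /psi sE patchE.
  case: ifPn => // /set_mem Dt; exfalso; move/negP : te; apply.
  exact: exit_time_alive.
have law B : measurable B -> P (alive X D x t `&` started X x t @^-1` B) = (\int[lam]_(y in B) domain_kernel alpha D t x y)%E.
  by move=> mB; exact: (alive_law alpha_gt0 hX D x t0 mB).
have [_ k0'] := k0.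
have -> := ge0_integral_density mA mZ (kernel_measurabler x k0) (k0' x) kfin law mpsi psi0.
rewrite [RHS]integral_mkcond; apply: eq_integral => y _.
rewrite patchE /psi patchE; case: ifPn => _; last by rewrite mul0e.
by rewrite mulrC EFinM fineK.
Qed.

End killed_expectation.

(** * Hoelder estimates *)

(** For [H > h0] the trivial bound [M] is at most [(M / h0^g) H^g], so only small increments need an
    argument. *)
Lemma holder_of_small {R : realType} (F H h0 g C M : R) : 0 <= H -> 0 < h0 -> 0 < g -> 0 <= C -> 0 <= M ->
  `|F| <= M -> (H <= h0 -> `|F| <= C * H `^ g) -> `|F| <= (C + M / h0 `^ g) * H `^ g.
Proof.
move=> H0 h00 g0 C0 M0 FM small; have hg0 : 0 < h0 `^ g by exact: powR_gt0.
have [/small h|/ltW hH] := leP H h0.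
  apply: le_trans h _; rewrite ler_wpM2r ?powR_ge0// lerDl divr_ge0//; exact: ltW.
apply: le_trans FM _.
apply: (@le_trans _ _ (M / h0 `^ g * H `^ g)).
  rewrite -mulrA ler_peMr// ler_pdivlMl// mulr1.
  by apply: ge0_ler_powR => //; rewrite ?nnegrE ltW.
by rewrite ler_wpM2r ?powR_ge0// lerDr.
Qed.

Section holder_steps.
Context {R : realType} {d : nat}.
Local Notation lam := (@lebesgue_rV R d).
Local Notation E := ('rV[R]_d).
Variables (D : set E) (p q : R -> E -> E -> R) (M : R -> R).
Hypothesis mD : measurable D.
Hypothesis mp : forall t x, 0 < t -> measurable_fun setT (p t x).
Hypothesis mq : forall t x, 0 < t -> measurable_fun setT (q t x).
Hypothesis q_ge0 : forall t x y, 0 < t -> 0 <= q t x y.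
Hypothesis q_le : forall t x y, 0 < t -> q t x y <= p t x y.
Hypothesis q_sym : forall t x y, 0 < t -> q t x y = q t y x.
Hypothesis q_CK : forall s t x y, 0 < s -> 0 < t ->
  (\int[lam]_z (q s x z * \1_D z * q t z y)%:E = (q (s + t) x y)%:E)%E.
Hypothesis p_mass : forall t x, 0 < t -> (\int[lam]_z (p t x z)%:E = 1)%E.
Hypothesis p_le : forall t x y, 0 < t -> p t x y <= M t.

Let p_ge0 t x y : 0 < t -> 0 <= p t x y.
Proof. by move=> t0; apply: le_trans (q_le x y t0); exact: q_ge0. Qed.

Let M_ge0 t : 0 < t -> 0 <= M t.
Proof. by move=> t0; apply: le_trans (p_le 0 0 t0); exact: p_ge0. Qed.

Let ind_ge0 (B : set E) z : 0 <= \1_B z :> R.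
Proof. by rewrite indicE. Qed.

Let ind_le1 (B : set E) z : \1_B z <= 1 :> R.
Proof. by rewrite indicE; case: (_ \in _). Qed.

Let mqc s t x y : 0 < s -> 0 < t -> measurable_fun setT (fun z => q s x z * \1_D z * q t z y).
Proof.
move=> s0 t0; apply: measurable_funM.
  by apply: measurable_funM; [exact: mq|exact: measurable_indic].
have -> : (fun z => q t z y) = q t y by apply/funext => z; exact: q_sym.
exact: mq.
Qed.

(** Bookkeeping for [integral_bound_le]: a pointwise majorant assembled from such functions yields
    the same combination of their constants. *)
Definition integral_bound (u : E -> R) (e : R) :=
  [/\ measurable_fun setT u, forall z, 0 <= u z & (\int[lam]_z (u z)%:E <= e%:E)%E].

Lemma integral_boundD u v e e' : integral_bound u e -> integral_bound v e' ->
  integral_bound (fun z => u z + v z) (e + e').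
Proof.
move=> [mu u0 ue] [mv v0 ve']; split; [exact: measurable_funD|by move=> z; rewrite addr_ge0|].
under eq_integral do rewrite EFinD.
rewrite ge0_integralD//.
- by rewrite EFinD leeD.
- by move=> z _; rewrite lee_fin.
- exact/measurable_EFinP.
- by move=> z _; rewrite lee_fin.
- exact/measurable_EFinP.
Qed.

Lemma integral_boundZ k u e : 0 <= k -> integral_bound u e -> integral_bound (fun z => k * u z) (k * e).
Proof.
move=> k0 [mu u0 ue]; split; [exact: measurable_funM|by move=> z; rewrite mulr_ge0|].
under eq_integral do rewrite EFinM.
rewrite ge0_integralZl//.
- by rewrite EFinM lee_wpmul2l// lee_fin.
- exact/measurable_EFinP.
- by move=> z _; rewrite lee_fin.
Qed.

Lemma integral_bound_le (f u : E -> R) e : measurable_fun setT f -> (forall z, 0 <= f z) ->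
  (forall z, f z <= u z) -> integral_bound u e -> (\int[lam]_z (f z)%:E <= e%:E)%E.
Proof.
move=> mf f0 fu [mu u0 ue]; apply: le_trans ue; apply: ge0_le_integral => //.
- by move=> z _; rewrite lee_fin.
- exact/measurable_EFinP.
- exact/measurable_EFinP.
- by move=> z _; rewrite lee_fin.
Qed.

Let qc_ge0 s t x y z : 0 < s -> 0 < t -> 0 <= q s x z * \1_D z * q t z y.
Proof. by move=> s0 t0; rewrite !mulr_ge0// q_ge0. Qed.

Let integral_bound_q s t x y : 0 < s -> 0 < t ->
  integral_bound (fun z => q s x z * \1_D z * q t z y) (q (s + t) x y).
Proof.
move=> s0 t0; split; [exact: mqc|by move=> z; exact: qc_ge0|].
by rewrite q_CK.
Qed.

Let integral_bound_p t x : 0 < t -> integral_bound (p t x) 1.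
Proof. by move=> t0; split; [exact: mp|by move=> z; exact: p_ge0|by rewrite p_mass]. Qed.

Let integral_bound_pq t x e : 0 < t -> (\int[lam]_z (p t x z - q t x z)%:E <= e%:E)%E ->
  integral_bound (fun z => p t x z - q t x z) e.
Proof.
move=> t0 he; split => //; last by move=> z; rewrite subr_ge0 q_le.
by apply: measurable_funB; [exact: mp|exact: mq].
Qed.

(** In [q_t(x, y)], split at time [s], the first factor obeys [q_s(x, .) <= p_s(x, .) <= q_s(x', .)
    + (p_s - q_s)(x', .) + |p_s(x, .) - p_s(x', .)|] and the second is at most [M (t - s)]. Only the
    mass deficit at [x'] enters; exchanging the points gives the other inequality. *)
Lemma space_step s t x x' y e1 e2 : 0 < s -> s < t ->
  (\int[lam]_z (p s x' z - q s x' z)%:E <= e1%:E)%E ->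
  (\int[lam]_z `|p s x z - p s x' z|%:E <= e2%:E)%E ->
  q t x y <= q t x' y + M (t - s) * (e1 + e2).
Proof.
move=> s0 st h1 h2; have ts0 : 0 < t - s by rewrite subr_gt0.
have M0 := M_ge0 ts0.
have tE : s + (t - s) = t by rewrite addrC subrK.
have b0 := integral_bound_q x' y s0 ts0; have b1 := integral_bound_pq s0 h1.
have b2 : integral_bound (fun z => `|p s x z - p s x' z|) e2.
  by split => //; apply: measurableT_comp => //; apply: measurable_funB; exact: mp.
have CK := q_CK x y s0 ts0; rewrite tE in b0 CK.
rewrite -lee_fin -CK.
apply: integral_bound_le (integral_boundD b0 (integral_boundZ M0 (integral_boundD b1 b2))).
- exact: mqc.
- by move=> z; exact: qc_ge0.
move=> z.
have a1 : q s x z <= q s x' z + (p s x' z - q s x' z + `|p s x z - p s x' z|).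
  by have := q_le x z s0; have := ler_norm (p s x z - p s x' z); lra.
have a2 : \1_D z * q (t - s) z y <= M (t - s).
  apply: le_trans (p_le z y ts0); apply: le_trans (q_le z y ts0).
  by rewrite ler_piMl ?q_ge0.
have a3 : 0 <= \1_D z * q (t - s) z y by rewrite mulr_ge0 ?q_ge0.
rewrite -!mulrA; move: (\1_D z * _) a2 a3 => k a2 a3.
apply: le_trans (ler_wpM2r a3 a1) _.
rewrite [leLHS]mulrDl lerD2l [leRHS]mulrC ler_wpM2l//.
by rewrite addr_ge0// subr_ge0 q_le.
Qed.

(** [q_(t+h)(x, y)] averages [q_t(z, y)] against [q_h(x, z)] on [D], and is compared with the
    average of the constant [q_t(x, y)] against the probability density [p_h(x, .)]. On [B] the
    discrepancy is the oscillation [w] and the mass deficit, off [B] the tail. *)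
Lemma time_step t h x y B w e1 e2 : 0 < t -> 0 < h -> measurable B -> B `<=` D -> 0 <= w ->
  (forall z, B z -> `|q t z y - q t x y| <= w) ->
  (\int[lam]_z (p h x z - q h x z)%:E <= e1%:E)%E ->
  (\int[lam]_(z in ~` B) (p h x z)%:E <= e2%:E)%E ->
  `|q (t + h) x y - q t x y| <= w + M t * (e1 + e2).
Proof.
move=> t0 h0 mB BD w0 hw h1 h2; have M0 := M_ge0 t0.
have ph0 z : 0 <= p h x z by exact: p_ge0.
have qh0 z : 0 <= q h x z by exact: q_ge0.
have qt0 z z' : 0 <= q t z z' by exact: q_ge0.
have qtM z z' : q t z z' <= M t by apply: le_trans (p_le z z' t0); exact: q_le.
have b0 := integral_bound_q x y h0 t0; have bp := integral_bound_p x h0.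
have b1 := integral_bound_pq h0 h1.
have b2 : integral_bound (fun z => p h x z * \1_(~` B) z) e2.
  split.
  - by apply: measurable_funM; [exact: mp|apply: measurable_indic; exact: measurableC].
  - by move=> z; rewrite mulr_ge0.
  apply: le_trans h2; rewrite [leRHS]integral_mkcond le_eqVlt; apply/orP; left; apply/eqP.
  apply: eq_integral => z _; rewrite patchE indicE.
  by case: (_ \in _); rewrite ?mulr1 ?mulr0.
have bM := integral_boundZ M0 (integral_boundD b1 b2).
have CK := q_CK x y h0 t0; rewrite addrC in CK b0.
have indB z : B z -> \1_(~` B) z = 0 :> R by move=> Bz; rewrite indicE memNset//; apply.
have indnB z : ~ B z -> \1_(~` B) z = 1 :> R by move=> Bz; rewrite indicE mem_set.
rewrite ler_distl; apply/andP; split.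
  rewrite lerBlDr -lee_fin.
  have -> : (q t x y)%:E = (\int[lam]_z (q t x y * p h x z)%:E)%E.
    under eq_integral do rewrite EFinM.
    rewrite ge0_integralZl// ?p_mass ?mule1//.
    + by apply/measurable_EFinP; exact: mp.
    + by move=> z _; rewrite lee_fin.
    + by rewrite lee_fin.
  have := integral_boundD b0 (integral_boundD (integral_boundZ w0 bp) bM).
  rewrite mulr1; apply: integral_bound_le.
  - by apply: measurable_funM => //; exact: mp.
  - by move=> z; rewrite mulr_ge0.
  move=> z; have pqz := q_le x z h0; have [Bz|nB] := pselect (B z).
    rewrite (indB z Bz) mulr0 addr0 indicE (mem_set (BD z Bz)) mulr1.
    have := hw z Bz; rewrite ler_distlC => /andP[_ hz].
    have e3 : q t x y * p h x z = q t x y * q h x z + q t x y * (p h x z - q h x z) by ring.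
    rewrite e3 [leRHS]addrA; apply: lerD; last by rewrite ler_wpM2r// subr_ge0.
    apply: (@le_trans _ _ ((q t z y + w) * q h x z)).
      by rewrite ler_wpM2r//; lra.
    by rewrite mulrDl mulrC lerD2l ler_wpM2l.
  rewrite (indnB z nB) mulr1.
  apply: (@le_trans _ _ (M t * (p h x z - q h x z + p h x z))); last first.
    by rewrite addrA lerDr addr_ge0 ?qc_ge0// mulr_ge0.
  apply: ler_pM => //.
  by rewrite lerDr subr_ge0.
rewrite -lee_fin -CK.
have bq : integral_bound (fun z => q t x y * p h x z) (q t x y) by have := integral_boundZ (qt0 x y) bp; rewrite mulr1.
have := integral_boundD bq (integral_boundD (integral_boundZ w0 bp) bM).
rewrite mulr1; apply: integral_bound_le.
- exact: mqc.
- by move=> z; exact: qc_ge0.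
move=> z; have pqz := q_le x z h0; have [Bz|nB] := pselect (B z).
  rewrite indicE (mem_set (BD z Bz)) mulr1 (indB z Bz) mulr0 addr0.
  have := hw z Bz; rewrite ler_distlC => /andP[hz _].
  have n0 : 0 <= M t * (p h x z - q h x z) by rewrite mulr_ge0// subr_ge0.
  apply: (@le_trans _ _ (q h x z * (q t x y + w))); first by rewrite ler_wpM2l//; lra.
  apply: (@le_trans _ _ (p h x z * (q t x y + w))); first by rewrite ler_wpM2r// addr_ge0.
  by rewrite mulrDr mulrC addrA [in leRHS](mulrC w) lerDl.
rewrite (indnB z nB) mulr1.
apply: (@le_trans _ _ (M t * p h x z)).
  rewrite mulrC; apply: ler_pM => //; first by rewrite mulr_ge0.
  by apply: le_trans pqz; rewrite ler_piMr.
rewrite mulrDr !addrA lerDr !addr_ge0// mulr_ge0// subr_ge0//.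
Qed.

Hypothesis M_anti : forall s t, 0 < s -> s <= t -> M t <= M s.

Lemma kernel_dist_le t0 t t' x y x' y' : 0 < t0 -> t0 <= t -> t0 <= t' -> `|q t x y - q t' x' y'| <= M t0.
Proof.
move=> t00 tt tt'; have t1 := lt_le_trans t00 tt; have t1' := lt_le_trans t00 tt'.
have b r u v : 0 < r -> t0 <= r -> q r u v <= M t0.
  by move=> r0 tr; apply: le_trans (M_anti t00 tr); apply: le_trans (p_le u v r0); exact: q_le.
have := b _ x y t1 tt; have := b _ x' y' t1' tt'.
have := q_ge0 x y t1; have := q_ge0 x' y' t1'.
by move=> h1 h2 h3 h4; rewrite ler_distl; apply/andP; split; lra.
Qed.

Let root_bound (H k : R) n : 0 < H -> 0 < k -> H <= k ^+ n.+1 ->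
  exists s, [/\ 0 < s, s <= k, s = H `^ n.+1%:R^-1 & H = s ^+ n.+1].
Proof.
move=> H0 k0 Hk; have s0 : 0 < H `^ n.+1%:R^-1 by exact: powR_gt0.
have HE : H = (H `^ n.+1%:R^-1) ^+ n.+1.
  by rewrite -powR_mulrn ?powR_ge0// -powRrM mulVf ?powRr1 ?(ltW H0)// pnatr_eq0.
exists (H `^ n.+1%:R^-1); split => //.
by move: Hk; rewrite {1}HE ler_pXn2r// nnegrE ltW.
Qed.

(* With [s] the N-th root of [|x - x'|] and [r = 1 / s], all the error terms
   of [space_step] are of order [s]. *)
Lemma space_holder (A : set E) (c C1 alpha t0 : R) (m : nat) : 0 <= c -> 0 <= C1 -> 0 < alpha -> 0 < t0 ->
  (forall s x, 0 < s -> A x -> (\int[lam]_z (p s x z - q s x z)%:E <= (c * s)%:E)%E) ->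
  (forall s x x' r, 0 < s -> 0 < r -> `|x - x'| <= r ->
    (\int[lam]_z `|p s x z - p s x' z|%:E <=
      (C1 * ((1 + s^-1) ^+ m * r ^+ d * `|x - x'| + s * r `^ (- alpha)))%:E)%E) ->
  exists2 C, 0 <= C & forall t x x' y, t0 <= t -> A x -> A x' ->
    `|q t x y - q t x' y| <= C * `|x - x'| `^ (m + d).+1%:R^-1.
Proof.
move=> c0 C10 al0 t00 hc hL; set N := (m + d).+1.
have t20 : 0 < t0 / 2 by rewrite divr_gt0.
(* For [s <= k], the radius [1 / s] is at least [|x - x'|], and the remaining time [t - s] is at
   least [t0 / 2]. *)
pose k := Num.min 1 (t0 / 2); have k0 : 0 < k by rewrite lt_min ltr01.
have hk0 : 0 < k ^+ N by rewrite exprn_gt0.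
have g0 : 0 < N%:R^-1 :> R by rewrite invr_gt0 ltr0n.
have M2 := M_ge0 t20; have M1 := M_ge0 t00.
pose C := M (t0 / 2) * (c + C1 * (2 ^+ m + 1)).
have C0 : 0 <= C by rewrite mulr_ge0// addr_ge0// mulr_ge0// addr_ge0// exprn_ge0.
exists (C + M t0 / (k ^+ N) `^ N%:R^-1).
  by rewrite addr_ge0// divr_ge0// powR_ge0.
move=> t x x' y tt Ax Ax'; apply: holder_of_small => //; first exact: kernel_dist_le.
move=> Hk; have [->|nx] := eqVneq x x'.
  by rewrite subrr normr0 mulr_ge0 ?powR_ge0.
have H0 : 0 < `|x - x'| by rewrite normr_gt0 subr_eq0.
have [s [s0 sk sE HE]] := root_bound H0 k0 Hk; rewrite -sE.
have s1 : s <= 1 by apply: le_trans sk _; rewrite ge_min lexx.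
have st2 : s <= t0 / 2 by apply: le_trans sk _; rewrite ge_min lexx orbT.
have st : s < t by apply: le_lt_trans st2 _; lra.
have V0 : 0 < s^-1 by rewrite invr_gt0.
have V1 : 1 <= s^-1 by rewrite invf_ge1.
have HV : `|x - x'| <= s^-1.
  by apply: le_trans V1; rewrite HE exprn_ile1// ltW.
(* The exponent [N = m + d + 1] makes the first term [(1 + s)^m s <= 2^m s]; the second is
   [s * s^alpha <= s]. *)
have err : C1 * ((1 + s^-1) ^+ m * s^-1 ^+ d * `|x - x'| + s * s^-1 `^ (- alpha)) <= C1 * (2 ^+ m + 1) * s.
  rewrite -[leRHS]mulrA ler_wpM2l// [leRHS]mulrDl mul1r; apply: lerD.
    rewrite HE /N exprS exprD.
    have -> : (1 + s^-1) ^+ m * s^-1 ^+ d * (s * (s ^+ m * s ^+ d)) = (s + 1) ^+ m * s.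
      have -> : s + 1 = (1 + s^-1) * s by rewrite mulrDl mul1r mulVf// gt_eqF.
      rewrite exprMn exprVn; field.
      by rewrite expf_neq0 ?gt_eqF.
    by rewrite ler_wpM2r ?(ltW s0)// lerXn2r ?nnegrE//; lra.
  rewrite -[leRHS]mulr1 ler_wpM2l ?(ltW s0)//.
  rewrite -(powRr0 s^-1); apply: ler_powR => //; lra.
have Mts : M (t - s) <= M (t0 / 2) by apply: M_anti => //; lra.
have half u u' : A u' -> `|u - u'| = `|x - x'| -> q t u y <= q t u' y + C * s.
  move=> Au' uE.
  have := space_step y s0 st (hc s u' s0 Au') (hL s u u' s^-1 s0 V0 _); rewrite uE => /(_ HV).
  move/le_trans; apply; rewrite lerD2l /C -[leRHS]mulrA; apply: ler_pM => //.
  - by apply: M_ge0; lra.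
  - by rewrite !addr_ge0 ?mulr_ge0 ?addr_ge0 ?mulr_ge0 ?exprn_ge0 ?addr_ge0 ?powR_ge0 ?(ltW s0) ?(ltW V0).
  - by rewrite mulrDl lerD2l.
have h1 := half x x' Ax' erefl; have h2 := half x' x Ax (distrC _ _).
by rewrite ler_distl; apply/andP; split; lra.
Qed.

(** Apply [time_step] on the ball of radius [a = h^(1/4)]. Its oscillation is at most [C a^g], the
    deficit [c h] is at most [c a], and the tail satisfies [h a^(- alpha) <= h a^(-2) = a^2 <= a],
    as [alpha < 2]; hence the exponent [g / 4]. The margin [rho] keeps the ball inside [A'], where
    the space estimate holds. *)
Lemma time_holder (A A' : set E) (c c2 C g alpha rho t0 : R) : 0 <= c -> 0 <= c2 -> 0 <= C -> 0 < g <= 1 ->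
  alpha < 2 -> 0 < rho -> 0 < t0 -> A' `<=` D -> (forall x, A x -> norm_ball x rho `<=` A') ->
  (forall s x, 0 < s -> A x -> (\int[lam]_z (p s x z - q s x z)%:E <= (c * s)%:E)%E) ->
  (forall s x r, 0 < s -> 0 < r -> (\int[lam]_(z in ~` norm_ball x r) (p s x z)%:E <= (c2 * s * r `^ (- alpha))%:E)%E) ->
  (forall t x x' y, t0 <= t -> A' x -> A' x' -> `|q t x y - q t x' y| <= C * `|x - x'| `^ g) ->
  exists2 C', 0 <= C' & forall t h x y, t0 <= t -> 0 < h -> A x ->
    `|q (t + h) x y - q t x y| <= C' * h `^ (4^-1 * g).
Proof.
move=> c0 c20 C0 /andP[g0 g1] al2 rho0 t00 AD AA hc htail hs.
pose k := Num.min 1 rho; have k0 : 0 < k by rewrite lt_min ltr01.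
have hk0 : 0 < k ^+ 4 by rewrite exprn_gt0.
have M1 := M_ge0 t00.
pose C2 := C + M t0 * (c + c2).
have C20 : 0 <= C2 by rewrite addr_ge0// mulr_ge0// addr_ge0.
exists (C2 + M t0 / (k ^+ 4) `^ (4^-1 * g)); first by rewrite addr_ge0// divr_ge0// powR_ge0.
move=> t h x y tt h0 Ax; have tp := lt_le_trans t00 tt.
apply: holder_of_small => //; first exact: ltW; first by rewrite mulr_gt0.
  by apply: kernel_dist_le => //; rewrite (le_trans tt)// lerDl ltW.
move=> Hk; have [a [a0 ak aE hE]] := root_bound h0 k0 Hk.
rewrite powRrM -aE.
have a1 : a <= 1 by apply: le_trans ak _; rewrite ge_min lexx.
have ar : a <= rho by apply: le_trans ak _; rewrite ge_min lexx orbT.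
have ball_sub : norm_ball x a `<=` A'.
  by move=> z za; apply: (AA x Ax); rewrite /norm_ball/= in za *; exact: lt_le_trans za ar.
have A'x : A' x by apply: (AA x Ax); rewrite /norm_ball/= subrr normr0.
have w0 : 0 <= C * a `^ g by rewrite mulr_ge0// powR_ge0.
have hw z : norm_ball x a z -> `|q t z y - q t x y| <= C * a `^ g.
  move=> za; apply: le_trans (hs t z x y tt (ball_sub z za) A'x) _.
  rewrite ler_wpM2l//; apply: ge0_ler_powR; rewrite ?nnegrE ?normr_ge0 ?(ltW g0) ?(ltW a0)//.
  exact: ltW.
have := time_step tp h0 (measurable_norm_ball x a) (subset_trans ball_sub AD) w0 hw (hc h x h0 Ax) (htail h x a h0 a0).
move/le_trans; apply; rewrite /C2 mulrDl lerD2l -[leRHS]mulrA.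
have ag : a <= a `^ g by apply: ger1_powR => //; rewrite a0.
have tail : h * a `^ (- alpha) <= a.
  apply: (@le_trans _ _ (h * a `^ (- 2))).
    by rewrite ler_wpM2l ?(ltW h0)//; apply: ger_powR; [rewrite a0|lra].
  rewrite (powR_invn 2 (ltW a0)) hE -[4%N]/(2 + 2)%N exprD mulfK ?expf_neq0 ?gt_eqF//.
  by rewrite expr2 ler_piMr// ltW.
have ha : h <= a by rewrite hE -[leRHS]mulr1 exprS ler_wpM2l ?(ltW a0)// exprn_ile1// ltW.
apply: ler_pM => //.
- exact: M_ge0.
- by rewrite addr_ge0 ?mulr_ge0 ?powR_ge0 ?(ltW h0).
- exact: M_anti.
- apply: (@le_trans _ _ ((c + c2) * a)); last by rewrite ler_wpM2l// addr_ge0.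
  by rewrite mulrDl -mulrA; apply: lerD; rewrite ler_wpM2l.
Qed.

(** The variables are changed one at a time, the last one through symmetry. The threshold for small
    increments is 1, since [H^N <= H^g] for [H <= 1]. *)
Lemma joint_holder (A A' : set E) (t0 N g Cs Ct H : R) t x y t' x' y' :
  0 < t0 -> 0 < N -> 0 < g -> g <= N -> 0 <= Cs -> 0 <= Ct -> A `<=` A' ->
  (forall t x x' y, t0 <= t -> A' x -> A' x' -> `|q t x y - q t x' y| <= Cs * `|x - x'| `^ N) ->
  (forall t h x y, t0 <= t -> 0 < h -> A x -> `|q (t + h) x y - q t x y| <= Ct * h `^ g) ->
  t0 <= t -> t0 <= t' -> A x -> A y -> A x' -> A y' ->
  `|t - t'| <= H -> `|x - x'| <= H -> `|y - y'| <= H ->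
  `|q t x y - q t' x' y'| <= (Cs + Cs + Ct + M t0 / 1 `^ g) * H `^ g.
Proof.
move=> t00 N0 g0 gN Cs0 Ct0 inS hs ht tt tt' u2 u3 v2 v3 n1 n2 n3.
have H0 : 0 <= H by apply: le_trans n1.
have M1 := M_ge0 t00.
apply: holder_of_small => //.
- by rewrite addr_ge0// addr_ge0.
- exact: kernel_dist_le.
move=> H1.
have pw (a : R) : 0 <= a -> a <= H -> a `^ N <= H `^ g /\ a `^ g <= H `^ g.
  move=> a0 aH; have h r : 0 < r -> a `^ r <= H `^ r.
    by move=> r0; apply: ge0_ler_powR => //; rewrite ?nnegrE ?ltW.
  split; last exact: h.
  apply: le_trans (h _ N0) _; have [->|Hn] := eqVneq H 0; first by rewrite !powR0 ?gt_eqF.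
  by apply: ger_powR => //; rewrite lt_neqAle eq_sym Hn H0.
have b1 : `|q t x y - q t x' y| <= Cs * H `^ g.
  apply: le_trans (hs t x x' y tt (inS _ u2) (inS _ v2)) _.
  by rewrite ler_wpM2l//; apply: (pw _ _ n2).1.
have tp := lt_le_trans t00 tt; have tp' := lt_le_trans t00 tt'.
have b2 : `|q t x' y - q t x' y'| <= Cs * H `^ g.
  rewrite (q_sym x' y tp) (q_sym x' y' tp).
  apply: le_trans (hs t y y' x' tt (inS _ u3) (inS _ v3)) _.
  by rewrite ler_wpM2l//; apply: (pw _ _ n3).1.
have time a b z z' : t0 <= a -> a < b -> A z -> `|a - b| <= H -> `|q a z z' - q b z z'| <= Ct * H `^ g.
  move=> ta ab zn abH; have ba : 0 < b - a by rewrite subr_gt0.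
  have := ht a (b - a) z z' ta ba zn; rewrite subrKC distrC => /le_trans; apply.
  rewrite ler_wpM2l//; apply: (pw _ _ _).2; first exact: ltW.
  by apply: le_trans abH; rewrite distrC ler_norm.
have b3 : `|q t x' y' - q t' x' y'| <= Ct * H `^ g.
  have [ltt|ltt|->] := ltgtP t t'.
  - exact: time.
  - by rewrite distrC; apply: time => //; rewrite distrC.
  - by rewrite subrr normr0 mulr_ge0// powR_ge0.
have e : q t x y - q t' x' y' = (q t x y - q t x' y) + (q t x' y - q t x' y') + (q t x' y' - q t' x' y') by ring.
rewrite e; apply: le_trans (ler_normD _ _) _; rewrite !mulrDl; apply: lerD => //.
by apply: le_trans (ler_normD _ _) _; apply: lerD.
Qed.

End holder_steps.

Lemma compact_nondecreasing_cover {T : ptopologicalType} (K : set T) (O : nat -> set T) :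
  compact K -> (forall n, open (O n)) -> (forall m n, (m <= n)%N -> O m `<=` O n) ->
  K `<=` \bigcup_n O n -> exists n, K `<=` O n.
Proof.
rewrite compact_cover => cK oO ndO KO.
have [F _ KF] := cK _ setT O (fun n _ => oO n) KO.
exists (\max_(i <- finmap.enum_fset F) i)%N => z /KF[i /= iF]; apply: ndO.
exact: (@leq_bigmax_seq _ _ xpredT id i iF isT).
Qed.

(** * Local Hoelder continuity of the density *)

Section domain_kernel_holder.
Context {R : realType} {d : nat} {disp : measure_display}
  {Omega : measurableType disp} (P : probability Omega R).
Local Notation lam := (@lebesgue_rV R d).
Local Notation E := ('rV[R]_d).
Variables (alpha : R) (X : R -> Omega -> E).
Hypotheses (alpha_gt0 : 0 < alpha) (alpha_lt2 : alpha < 2).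
Hypothesis hX : rectilinear_stable alpha P X.
Variables (D : set E).
Hypotheses (oD : open D).

Let hY t : 0 < t -> stable_increment P alpha t (fun w => X t w - X 0 w).
Proof. by move=> t0; apply: increment_stable; [exact: hX|exact: ltW]. Qed.

Let p t (x y : E) : R := pdens alpha t x y.
Let q t x y := fine (domain_kernel alpha D t x y).

Let mD : measurable D. Proof. exact: open_measurable_rV. Qed.

Let qE t x y : 0 < t -> (q t x y)%:E = domain_kernel alpha D t x y.
Proof. by move=> t0; rewrite fineK// (domain_kernel_fin alpha_gt0 hX). Qed.

Let mp t x : 0 < t -> measurable_fun setT (p t x).
Proof. by move=> t0; exact: measurable_pdensr. Qed.

Let mq t x : 0 < t -> measurable_fun setT (q t x).
Proof.
move=> t0; apply: measurableT_comp => //.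
exact: (kernel_measurabler x (is_kernel_domain alpha_gt0 hX D t0)).
Qed.

Let q_ge0 t x y : 0 < t -> 0 <= q t x y.
Proof. by move=> t0; have [_ k0] := is_kernel_domain alpha_gt0 hX D t0; rewrite fine_ge0. Qed.

Let q_le t x y : 0 < t -> q t x y <= p t x y.
Proof. by move=> t0; rewrite -lee_fin qE// (domain_kernel_le alpha_gt0 hX). Qed.

Let q_sym t x y : 0 < t -> q t x y = q t y x.
Proof. by move=> t0; rewrite /q (domain_kernel_sym alpha_gt0 hX). Qed.

Let q_CK s t x y : 0 < s -> 0 < t ->
  (\int[lam]_z (q s x z * \1_D z * q t z y)%:E = (q (s + t) x y)%:E)%E.
Proof.
move=> s0 t0; rewrite qE ?addr_gt0// -(kcomp_domain_kernel alpha_gt0 hX oD)//.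
by apply: eq_integral => z _; rewrite !EFinM !qE.
Qed.

Let p_mass t x : 0 < t -> (\int[lam]_z (p t x z)%:E = 1)%E.
Proof. by move=> t0; exact: (pdens_mass alpha_gt0 hY). Qed.

(** [p_s(x, .)] has mass 1, so the integral is the mass lost by killing. The constant depends on [x]
    only through [n], which guarantees a ball of radius [1 / (2 n + 2)]. *)
Let q_deficiency n : exists2 c, 0 <= c & forall s x, 0 < s -> exhaustion D n x ->
  (\int[lam]_z (p s x z - q s x z)%:E <= (c * s)%:E)%E.
Proof.
exists (2 * (d%:R * (34 * (n.*2.+2%:R^-1 / 2) `^ (- alpha)))).
  by rewrite !mulr_ge0 ?powR_ge0.
move=> s x s0 xn.
have := domain_kernel_mass alpha_gt0 alpha_lt2 hX s0 xn.
have cE : 2 * (d%:R * (34 * s * (n.*2.+2%:R^-1 / 2) `^ (- alpha))) =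
   2 * (d%:R * (34 * (n.*2.+2%:R^-1 / 2) `^ (- alpha))) * s by ring.
rewrite cE; move: (_ * s) => e.
have -> : (\int[lam]_y domain_kernel alpha D s x y = \int[lam]_y (q s x y)%:E)%E.
  by apply: eq_integral => y _; rewrite qE.
have S : (\int[lam]_z (p s x z - q s x z)%:E + \int[lam]_y (q s x y)%:E = 1)%E.
  rewrite -ge0_integralD//.
  - rewrite -[RHS](p_mass x s0); apply: eq_integral => z _.
    by rewrite -EFinD subrK.
  - by move=> z _; rewrite lee_fin subr_ge0 q_le.
  - by apply/measurable_EFinP; apply: measurable_funB; [exact: mp|exact: mq].
  - by move=> z _; rewrite lee_fin q_ge0.
  - by apply/measurable_EFinP; exact: mq.
have I1 : (0 <= \int[lam]_z (p s x z - q s x z)%:E)%E.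
  by apply: integral_ge0 => z _; rewrite lee_fin subr_ge0 q_le.
have I2 : (0 <= \int[lam]_z (q s x z)%:E)%E.
  by apply: integral_ge0 => z _; rewrite lee_fin q_ge0.
move: S I1 I2; case: (integral _ _ _) => [a||]; case: (integral _ _ _) => [b||] //.
by rewrite -EFinD => -[S] _ _; rewrite -EFinB !lee_fin; lra.
Qed.

Lemma domain_kernel_locally_holder :
  locally_holder [set z : R * 'rV[R]_d * 'rV[R]_d | [/\ 0 < z.1.1, D z.1.2 & D z.2]]
    (fun z => q z.1.1 z.1.2 z.2).
Proof.
have [C0 [m0 [C00 hM]]] := @pdens_bound R d alpha alpha_gt0.
have [C1 [m [C10 hL]]] := pdens_L1_le alpha_gt0 alpha_lt2 hY.
pose M t := C0 * (1 + t^-1) ^+ m0.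
have p_le t x y : 0 < t -> p t x y <= M t by move=> t0; have [+ _] := hM t t0; exact.
have M_anti s t : 0 < s -> s <= t -> M t <= M s.
  move=> s0 st; have t0 := lt_le_trans s0 st.
  rewrite ler_wpM2l ?(ltW C00)// lerXn2r ?nnegrE ?addr_ge0 ?invr_ge0 ?(ltW s0) ?(ltW t0)//.
  by rewrite lerD2l lef_pV2.
(* [N] and [g] are fixed before the compact set, as [locally_holder] requires a common exponent; the
   compact set affects constants only. *)
pose N : R := (m + d).+1%:R^-1.
have N0 : 0 < N by rewrite invr_gt0.
have N1 : N <= 1 by rewrite invf_le1 ?ler1n.
pose g := 4^-1 * N.
have g0 : 0 < g by rewrite mulr_gt0.
have gN : g <= N by rewrite /g; lra.
exists g; first by rewrite g0 (le_trans gN).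
move=> K cK KU.
(* An increasing open cover: a compact set lies in a single [O n], which bounds times from below by
   [1 / (n + 1)] and keeps both points in [exhaustion D n]. *)
pose O n := [set z : R * 'rV[R]_d * 'rV[R]_d |
  [/\ n.+1%:R^-1 < z.1.1, interior (exhaustion D n) z.1.2 & interior (exhaustion D n) z.2]].
have O_le k n : (k <= n)%N -> O k `<=` O n.
  move=> kn z [h1 h2 h3]; split.
  - by apply: le_lt_trans h1; rewrite lef_pV2 ?posrE// ler_nat.
  - exact: (interiorS (exhaustion_le kn) h2).
  - exact: (interiorS (exhaustion_le kn) h3).
have oO n : open (O n).
  have -> : O n = (fun z => z.1.1) @^-1` [set r : R | n.+1%:R^-1 < r] `&`
      ((fun z => z.1.2) @^-1` interior (exhaustion D n) `&` snd @^-1` interior (exhaustion D n)).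
    by apply/seteqP; split => z; [move=> [? ? ?]|move=> [? [? ?]]].
  apply: openI; last apply: openI.
  - apply: open_comp; last exact: open_gt.
    by move=> z _; apply: continuous_comp; exact: cvg_fst.
  - apply: open_comp; last exact: open_interior.
    by move=> z _; apply: continuous_comp; [exact: cvg_fst|exact: cvg_snd].
  - by apply: open_comp; [move=> z _; exact: cvg_snd|exact: open_interior].
have [|n Kn] := compact_nondecreasing_cover cK oO O_le.
  move=> z /KU [z1 /(exhaustion_nbhs oD)[n2 hn2] /(exhaustion_nbhs oD)[n3 hn3]].
  have [|n1] := @ltr_add_invr R 0 z.1.1; first by [].
  rewrite add0r => hn1; exists (n1 + n2 + n3)%N => //; split.
  - by apply: le_lt_trans hn1; rewrite lef_pV2 ?posrE// ler_nat ltnS -addnA leq_addr.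
  - by apply: (interiorS (exhaustion_le _) hn2); rewrite -addnA addnCA leq_addr.
  - by apply: (interiorS (exhaustion_le _) hn3); rewrite leq_addl.
pose t0 : R := n.+1%:R^-1; have t00 : 0 < t0 by rewrite invr_gt0.
have M1 : 0 <= M t0 by rewrite mulr_ge0 ?(ltW C00)// exprn_ge0// addr_ge0// invr_ge0 ltW.
(* Two levels: the time estimate at a point of [exhaustion D n] uses the space estimate on a ball
   around it, which lies in [exhaustion D n.*2.+1]. *)
have [c c0 hc] := q_deficiency n; have [c' c'0 hc'] := q_deficiency n.*2.+1.
have [Cs Cs0 hs] := space_holder mD mp mq q_ge0 q_le q_sym q_CK p_le M_anti
  c'0 (ltW C10) alpha_gt0 t00 hc' hL.
have [c2 c20 hc2] : exists2 c2, 0 <= c2 & forall s x r, 0 < s -> 0 < r ->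
    (\int[lam]_(z in ~` norm_ball x r) (p s x z)%:E <= (c2 * s * r `^ (- alpha))%:E)%E.
  exists (d%:R * 34); first by rewrite mulr_ge0.
  move=> s x r s0 r0; have := pdens_tail alpha_gt0 alpha_lt2 hY x s0 r0.
  by have -> : d%:R * 34 * s * r `^ (- alpha) = d%:R * (34 * s * r `^ (- alpha)) by ring.
have rho0 : 0 < n.*2.+2%:R^-1 :> R by rewrite invr_gt0.
have gN1 : 0 < N <= 1 by rewrite N0.
have [Ct Ct0 ht] := time_holder mD mp mq q_ge0 q_le q_sym q_CK p_mass p_le M_anti
  c0 c20 Cs0 gN1 alpha_lt2 rho0 t00 (@exhaustion_sub _ _ D n.*2.+1) (@norm_ball_exhaustion _ _ D n) hc hc2 hs.
exists (Cs + Cs + Ct + M t0 / 1 `^ g) => u v Ku Kv.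
have [u1 /nbhs_singleton u2 /nbhs_singleton u3] := Kn _ Ku.
have [v1 /nbhs_singleton v2 /nbhs_singleton v3] := Kn _ Kv.
have inS z : exhaustion D n z -> exhaustion D n.*2.+1 z.
  by apply: exhaustion_le; rewrite -addnn (leq_trans (leq_addr n n)).
have nE : `|u - v| = Num.max (Num.max `|u.1.1 - v.1.1| `|u.1.2 - v.1.2|) `|u.2 - v.2|.
  by rewrite prod_normE/= prod_normE.
have [n1 n2 n3] : [/\ `|u.1.1 - v.1.1| <= `|u - v|, `|u.1.2 - v.1.2| <= `|u - v| & `|u.2 - v.2| <= `|u - v|].
  by rewrite nE !le_max !lexx !orbT.
move: u1 u2 u3 v1 v2 v3 n1 n2 n3 {Ku Kv nE}; move: `|u - v| (normr_ge0 (u - v)) => H H0.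
move: u v => [[t x] y] [[t' x'] y'] /= u1 u2 u3 v1 v2 v3 n1 n2 n3.
exact: (joint_holder q_ge0 q_le q_sym p_le M_anti t00 N0 g0 gN Cs0 Ct0 inS hs ht (ltW u1) (ltW v1)).
Qed.

End domain_kernel_holder.

Theorem theorem1p1 (R : realType) (d : nat) (d_ge2 : (2 <= d)%N)
    (alpha : R) (alpha_gt0 : 0 < alpha) (alpha_lt2 : alpha < 2)
    (disp : measure_display) (Omega : measurableType disp)
    (X : R -> Omega -> 'rV[R]_d) (P : 'rV[R]_d -> probability Omega R)
    (X_stable : forall x, rectilinear_stable alpha (P x) X)
    (X_start : forall x, {ae P x, forall w, X 0 w = x})
    (D : set 'rV[R]_d) (D_open : open D) (D_neq0 : D !=set0) :
  exists p : R -> 'rV[R]_d -> 'rV[R]_d -> R,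
    [/\ locally_holder
          [set z : R * 'rV[R]_d * 'rV[R]_d | [/\ 0 < z.1.1, D z.1.2 & D z.2]]
          (fun z => p z.1.1 z.1.2 z.2),
        forall (t : R) (x y : 'rV[R]_d), 0 < t -> D x -> D y -> 0 <= p t x y
      & forall (t : R) (x : 'rV[R]_d) (phi : 'rV[R]_d -> R), 0 < t -> D x ->
          measurable_fun D phi -> (forall y, D y -> 0 <= phi y) ->
          ('E_(P x)[fun w => extend0 phi (killed D (X^~ w) t)] =
           \int[@lebesgue_rV R d]_(y in D) (p t x y * phi y)%:E)%E].
Proof.
exists (fun t x y => fine (domain_kernel alpha D t x y)); split.
(* The kernel is built from [alpha] and [D] alone, so the same [p] serves every starting point, and
   its regularity may be derived under any one of the laws, here [P 0]. *)
- exact: (domain_kernel_locally_holder alpha_gt0 alpha_lt2 (X_stable 0) D_open).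
- move=> t x y t0 _ _; have [_ k0] := is_kernel_domain alpha_gt0 (X_stable x) D t0.
  by rewrite fine_ge0.
- move=> t x phi t0 Dx.
  exact: (killed_expectation alpha_gt0 alpha_lt2 (X_stable x) D_open Dx t0 (X_start x)).
Qed.
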